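(* Let $p\in(\sqrt{3}-1,1)$. Then the closed convex hull of the class $Co(p)$ is a proper subset of the class of all functions $f$ of the form $$f(z)=\frac{z-\frac{p}{1+p^2}\left(1+\omega(z)\right)z^2}{\left(1-\frac{z}{p}\right)(1-zp)},\qquad z\in\mathbb{D},$$ where $\omega:\mathbb{D}\to\overline{\mathbb{D}}$ is holomorphic in $\mathbb{D}$.
   Context: $\mathbb{D}=\{z\in\mathbb{C}:|z|<1\}$ is the open unit disc, $\overline{\mathbb{D}}$ its closure, and $\overline{\mathbb{C}}$ is the Riemann sphere. For $p\in(0,1)$, $Co(p)$ denotes the family of functions $f:\mathbb{D}\to\overline{\mathbb{C}}$ such that: (i) $f$ is meromorphic in $\mathbb{D}$ and has a simple pole at the point $p$; (ii) $f(0)=f'(0)-1=0$; (iii) $f$ maps $\mathbb{D}$ conformally (in particular injectively) onto a set whose complement with respect to $\overline{\mathbb{C}}$ is convex. The closed convex hull is taken in the topology of uniform convergence on compact subsets of $\mathbb{D}$; since the functions considered are holomorphic in $\mathbb{D}\setminus\{p\}$ with at most a simple pole at $p$, this is understood as uniform convergence on compact subsets of $\mathbb{D}\setminus\{p\}$ (equivalently, for such functions, uniform convergence of $(z-p)f(z)$ on compact subsets of $\mathbb{D}$). *)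

(* Defs.v *)
From HB Require Import structures.
From mathcomp Require Import all_boot all_order all_algebra.
From mathcomp Require Import all_classical all_reals all_analysis.
From mathcomp Require Import complex.

Set Implicit Arguments.
Unset Strict Implicit.
Unset Printing Implicit Defensive.

Import Order.TTheory GRing.Theory Num.Theory.
Import numFieldNormedType.Exports.

Local Open Scope classical_set_scope.
Local Open Scope ring_scope.
Local Open Scope complex_scope.

(* R[i] gets the topology and the R[i]-normed structure of its modulus, so that
   [derivable f z 1] below is complex differentiability at z. *)
HB.instance Definition _ (R : realType) :=
  PseudoPointedMetric.copy R[i] R[i]^o.
HB.instance Definition _ (R : realType) := NormedModule.copy R[i] R[i]^o.

Section Co.
Variable R : realType.

Definition riemann_sphere : Type := one_point_compactification R[i].

Definition infty : riemann_sphere := None.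

Definition finite (w : R[i]) : riemann_sphere := Some w.

Definition unit_disc : set R[i] := [set z | `|z| < 1].

Definition holomorphic_at (g : R[i] -> R[i]) (a : R[i]) : Prop :=
  \forall z \near a, derivable g z 1.

(* Functions on the disc are total functions on R[i]; every condition below on
   such a function f only involves the values of f on the disc. *)
Implicit Types f : R[i] -> riemann_sphere.

Definition finite_holomorphic_at f (a : R[i]) : Prop :=
  exists2 g, holomorphic_at g a & \forall z \near a, f z = finite (g z).

Definition pole_of_order (n : nat) f (a : R[i]) : Prop :=
  [/\ (0 < n)%N, f a = infty
    & exists h, [/\ holomorphic_at h a, h a != 0
        & \forall z \near a^', f z = finite (h z / (z - a) ^+ n)]].

Definition simple_pole := pole_of_order 1.

Definition meromorphic_on (U : set R[i]) f : Prop :=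
  forall a, U a -> finite_holomorphic_at f a \/ exists n, pole_of_order n f a.

Definition conformal_on (U : set R[i]) f : Prop :=
  meromorphic_on U f /\ set_inj U f.

(* [convex_set] over R[i] is ordinary convexity: the scalars t : R[i] with
   0 <= t <= 1 are real. A set containing infinity is not convex. *)
Definition sphere_convex (A : set riemann_sphere) : Prop :=
  exists2 K : set R[i], convex_set K & A = finite @` K.

(* The value 0 at poles is immaterial: only values at finite points matter. *)
Definition finite_part f : R[i] -> R[i] := fun z => odflt 0 (f z).

Definition Co (p : R) : set (R[i] -> riemann_sphere) :=
  [set f | [/\ meromorphic_on unit_disc f /\ simple_pole f p%:C,
               f 0 = finite 0 /\ derive1 (finite_part f) 0 - 1 = 0,
               conformal_on unit_disc f
             & sphere_convex (~` (f @` unit_disc))]].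

Definition punctured_disc (p : R) : set R[i] := unit_disc `\ p%:C.

(* The smallest convex set containing F that is closed for uniform convergence
   on the compact subsets of U. Closed sets do not see values outside U, so this
   is the closed convex hull of the restrictions to U of the functions in F; all
   locally uniform limits on an open U of functions holomorphic on U being
   holomorphic on U, the ambient space of all functions is harmless. *)
Definition closed_convex_hull (U : set R[i]) (F : set (R[i] -> R[i])) :
    set (R[i] -> R[i]) :=
  smallest [set A | closed (A : set {family compactly_in U, R[i] -> R[i]}) /\
                    convex_set A] F.

(* Functions in Co p are finite on the disc except at p, by injectivity. *)
Definition closed_convex_hull_Co (p : R) : set (R[i] -> R[i]) :=
  closed_convex_hull (punctured_disc p) (finite_part @` Co p).

Definition holomorphic_to_closed_disc (omega : R[i] -> R[i]) : Prop :=
  forall z, unit_disc z -> derivable omega z 1 /\ `|omega z| <= 1.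

(* At z = p the denominator vanishes and the numerator does not, as
   |omega p| <= 1 < 1 / p^2: the function has the value infinity there, and it
   is represented, like those in the hull, by its values on the punctured
   disc. *)
Definition omega_class (p : R) : set (R[i] -> R[i]) :=
  [set f | exists2 omega, holomorphic_to_closed_disc omega &
    forall z, punctured_disc p z ->
      f z = (z - (p / (1 + p ^+ 2))%:C * (1 + omega z) * z ^+ 2) /
            ((1 - z / p%:C) * (1 - z * p%:C))].

End Co.

(* Main.v *)
Require Import Defs.
From HB Require Import structures.
From mathcomp Require Import all_boot all_order all_algebra.
From mathcomp Require Import all_classical all_reals all_analysis.
From mathcomp Require Import complex ring lra.
Import Order.TTheory GRing.Theory Num.Theory.
Import numFieldNormedType.Exports.
Local Open Scope classical_set_scope.
Local Open Scope ring_scope.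
Local Open Scope complex_scope.

(** Let q = p / (1 + p^2), let M(z) = (p - z) / (1 - p z) be the involution of
    the disc that exchanges 0 and p, and for f in Co(p) put F = f o M, so that
    the pole of F is 0. Let K be the convex set omitted by F.

    The inequality behind everything. If |c| = 1 and 0 <= t <= 1, the function
    G(z) = t F(z) + (1 - t) F(c z) approaches K when |z| tends to 1, because K
    is convex; where G avoids K, the quotient z / F^-1(G(z)) is therefore at most
    1 in modulus, by the maximum principle ([level_sets_convex]). Letting t
    tend to 1 gives Re (z F'(z) / (F(w) - F(z))) >= 0 whenever |z| = |w|
    ([level_sets_support]). Hence the function
      S_w(z) = 2 z F'(z) / (F(w) - F(z)) + (z + w) / (z - w),
    which is holomorphic across z = w and equal to 1 at 0, has nonnegative real
    part on the circle |z| = |w|, thus in the disc |z| < |w|, and the lemma of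
    Schwarz yields |w| |S_w(z) - 1| <= |z| |S_w(z) + 1| ([suffridge_bound]).

    The hull is included in the class. Define omega from f by the formula of the
    theorem. The bound for S_w at z = p, where f is normalised, says
      |w|^2 |p^2 - omega(x)| <= |1 - p^2 omega(x)| with x = M(w)
    ([omega_ineq]). When |x| tends to 1 so does |w|, hence limsup |omega| <= 1 at
    the boundary and |omega| <= 1 in the disc ([omega_le1]). The class of the
    theorem is convex, since f is affine in omega, and closed, since pointwise
    limits of uniformly bounded holomorphic functions are holomorphic
    ([cdiff_limit]) and bounded isolated singularities are removable
    ([removable]), here at 0 and p, where the formula does not determine omega.

    The inclusion is strict. The derivative of S_w at 0 gives
    |F(w) - A / w - b| <= |A| / |w| ([suffridge_pole]), where A is the residue
    of F at 0, and |A| <= p^2 / (1 - p^2)^2 because |omega(p)| <= 1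
    ([pole_bound]). The real-linear functional
      L(f) = Re (F(s) - F(-s) - i F(is) + i F(-is)), 0 < s < 1,
    ignores A / w + b, so that L <= 4 p^2 / ((1 - p^2)^2 s) on Co(p) and on its
    closed convex hull. For the function of the class with omega = M the value
    of L is 4 p^2 s (1 + (2 p - 1) / (1 + p^2)) / (1 - p^2)^2, which is larger
    when s is close to 1 because 2 p - 1 > 0.

    The function theory rests on the maximum principle alone. Integration along
    rectangles (Goursat) gives |f(c)| <= 4 max |f| over the boundary of a square
    of centre c; powers of f replace 4 by 1 ([square_max]); multiplication by
    1 + d conj(c) z makes the inequality strict at a maximum, which localises to
    arbitrary bounded open sets ([max_principle]). Applied to difference
    quotients, the maximum principle then bounds them in terms of the function
    only, whence removable singularities, holomorphy of derivatives and of
    limits, and the local theory of injective functions. *)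

Set Implicit Arguments.
Unset Strict Implicit.
Unset Printing Implicit Defensive.

Local Notation Re := (@complex.Re _).
Local Notation Im := (@complex.Im _).

(** * Modulus, continuity and complex derivative *)

Section Modulus.
Variable R : rcfType.
Local Notation C := R[i].
Implicit Types z w : C.

(** The modulus with real values: the norm of [R[i]] takes its values in [R[i]],
    where the order is only partial. *)
Definition cabs z : R := Num.sqrt (Re z ^+ 2 + Im z ^+ 2).

Lemma cabsE z : `|z| = (cabs z)%:C.
Proof. exact: normc_def. Qed.

Lemma cabs_ge0 z : 0 <= cabs z. Proof. exact: sqrtr_ge0. Qed.

Lemma cabsM z w : cabs (z * w) = cabs z * cabs w.
Proof. by apply: complexI; rewrite -cabsE normrM !cabsE rmorphM. Qed.

Lemma cabsV z : cabs z^-1 = (cabs z)^-1.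
Proof. by apply: complexI; rewrite -cabsE normfV !cabsE fmorphV. Qed.

Lemma cabs_div z w : cabs (z / w) = cabs z / cabs w.
Proof. by rewrite cabsM cabsV. Qed.

Lemma cabsX z n : cabs (z ^+ n) = cabs z ^+ n.
Proof. by apply: complexI; rewrite -cabsE normrX !cabsE rmorphXn. Qed.

Lemma cabsN z : cabs (- z) = cabs z.
Proof. by apply: complexI; rewrite -cabsE normrN !cabsE. Qed.

Lemma cabsBC z w : cabs (z - w) = cabs (w - z).
Proof. by rewrite -cabsN opprB. Qed.

Lemma ler_cabsD z w : cabs (z + w) <= cabs z + cabs w.
Proof. by rewrite -lecR rmorphD/= -!cabsE ler_normD. Qed.

Lemma ler_cabsB z w : cabs (z - w) <= cabs z + cabs w.
Proof. by rewrite -[cabs w]cabsN ler_cabsD. Qed.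

Lemma ler_cabs_dist x z w : cabs (z - w) <= cabs (z - x) + cabs (x - w).
Proof. by have := ler_cabsD (z - x) (x - w); rewrite addrA subrK. Qed.

Lemma lerB_cabs z w : cabs z - cabs w <= cabs (z - w).
Proof. by rewrite lerBlDr; have := ler_cabsD (z - w) w; rewrite subrK. Qed.

Lemma lerB_cabsD z w : cabs z - cabs w <= cabs (z + w).
Proof. by have := lerB_cabs z (- w); rewrite cabsN opprK. Qed.

Lemma cabs0 : cabs 0 = 0.
Proof. by apply: complexI; rewrite -cabsE normr0. Qed.

Lemma cabs1 : cabs 1 = 1.
Proof. by apply: complexI; rewrite -cabsE normr1. Qed.

Lemma cabs_i : cabs ('i%C : C) = 1.
Proof. by rewrite /cabs /= !expr2 !(mul0r, mul1r) add0r sqrtr1. Qed.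

Lemma cabs_eq0 z : (cabs z == 0) = (z == 0).
Proof. by rewrite -[RHS]normr_eq0 cabsE (inj_eq (@complexI R) _ 0). Qed.

Lemma cabs_gt0 z : (0 < cabs z) = (z != 0).
Proof. by rewrite lt_def cabs_eq0 cabs_ge0 andbT. Qed.

Lemma cabs_sub_gt0 z w : (0 < cabs (z - w)) = (z != w).
Proof. by rewrite cabs_gt0 subr_eq0. Qed.

Lemma cabs_real (x : R) : cabs x%:C = `|x|.
Proof. by rewrite /cabs /= expr0n addr0 sqrtr_sqr. Qed.

Lemma cabs_pos (x : R) : 0 <= x -> cabs x%:C = x.
Proof. by move=> x0; rewrite cabs_real ger0_norm. Qed.

Lemma sqr_cabs z : cabs z ^+ 2 = Re z ^+ 2 + Im z ^+ 2.
Proof. by rewrite sqr_sqrtr // addr_ge0 ?sqr_ge0. Qed.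

Lemma normr_Re z : `|Re z| <= cabs z.
Proof. by rewrite -sqrtr_sqr ler_wsqrtr // lerDl sqr_ge0. Qed.

Lemma normr_Im z : `|Im z| <= cabs z.
Proof. by rewrite -sqrtr_sqr ler_wsqrtr // lerDr sqr_ge0. Qed.

Lemma ler_Re z : Re z <= cabs z.
Proof. exact: le_trans (ler_norm _) (normr_Re z). Qed.

Lemma ler_Im z : Im z <= cabs z.
Proof. exact: le_trans (ler_norm _) (normr_Im z). Qed.

Lemma cabs_le_ReIm z : cabs z <= `|Re z| + `|Im z|.
Proof.
rewrite -(ler_pXn2r (n := 2)) ?nnegrE ?cabs_ge0 ?addr_ge0 // sqr_cabs.
rewrite sqrrD !real_normK ?num_real //.
have := mulr_ge0 (normr_ge0 (Re z)) (normr_ge0 (Im z)); lra.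
Qed.

Lemma Re_real_mul (x : R) z : Re (x%:C * z) = x * Re z.
Proof. by case: z => a b; rewrite /=; ring. Qed.

Lemma ReD z w : Re (z + w) = Re z + Re w. Proof. exact: raddfD. Qed.
Lemma ImD z w : Im (z + w) = Im z + Im w. Proof. exact: raddfD. Qed.
Lemma ReB z w : Re (z - w) = Re z - Re w. Proof. exact: raddfB. Qed.
Lemma ImB z w : Im (z - w) = Im z - Im w. Proof. exact: raddfB. Qed.

End Modulus.

Section Cont.
Variable R : rcfType.
Local Notation C := R[i].
Implicit Types (f g : C -> C) (a z w l : C).

(** A filter base with real radii, so that the choice of radii is linear
    arithmetic in [R]. *)
Definition nearC (a : C) (P : C -> Prop) :=
  exists2 d : R, 0 < d & forall z, cabs (z - a) < d -> P z.

Lemma near_and a P Q : nearC a P -> nearC a Q -> nearC a (fun z => P z /\ Q z).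
Proof.
move=> [d d0 dP] [e e0 eQ]; exists (Num.min d e); first by rewrite lt_min d0.
by move=> z; rewrite lt_min => /andP[/dP ? /eQ].
Qed.

Lemma near_imp a (P Q : C -> Prop) : (forall z, P z -> Q z) -> nearC a P -> nearC a Q.
Proof. by move=> PQ [d d0 dP]; exists d => // z /dP/PQ. Qed.

Lemma near_self a (P : C -> Prop) : nearC a P -> P a.
Proof. by move=> [d d0]; apply; rewrite subrr cabs0. Qed.

Lemma near_all a (P : C -> Prop) : (forall z, P z) -> nearC a P.
Proof. by move=> ?; exists 1. Qed.

Lemma near_ball a (r : R) z : cabs (z - a) < r -> nearC z (fun y => cabs (y - a) < r).
Proof.
move=> zr; exists (r - cabs (z - a)); first by rewrite subr_gt0.
move=> y yz; apply: le_lt_trans (ler_cabs_dist z _ _) _; lra.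
Qed.

Lemma near_neq a z : z != a -> nearC z (fun y => y != a).
Proof.
move=> za; exists (cabs (z - a)); first by rewrite cabs_sub_gt0.
move=> y; apply: contraTneq => ->; by rewrite cabsBC ltxx.
Qed.

Definition cont f a := forall e : R, 0 < e -> nearC a (fun z => cabs (f z - f a) < e).

Lemma cont_cst c a : cont (fun _ => c) a.
Proof. by move=> e e0; apply: near_all => z; rewrite subrr cabs0. Qed.

Lemma cont_id a : cont id a.
Proof. by move=> e e0; exists e. Qed.

Lemma contD f g a : cont f a -> cont g a -> cont (fun z => f z + g z) a.
Proof.
move=> cf cg e e0.
have e2 : 0 < e / 2 by rewrite divr_gt0.
apply: near_imp (near_and (cf _ e2) (cg _ e2)) => z [h1 h2].
rewrite opprD addrACA; apply: le_lt_trans (ler_cabsD _ _) _; lra.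
Qed.

Lemma contN f a : cont f a -> cont (fun z => - f z) a.
Proof.
move=> cf e e0; apply: near_imp (cf e e0) => z; by rewrite -opprD cabsN.
Qed.

Lemma contB f g a : cont f a -> cont g a -> cont (fun z => f z - g z) a.
Proof. by move=> cf cg; apply: contD => //; exact: contN. Qed.

Lemma contM f g a : cont f a -> cont g a -> cont (fun z => f z * g z) a.
Proof.
move=> cf cg e e0.
pose M := cabs (f a) + cabs (g a) + 1.
have M1 : 1 <= M by rewrite /M; have := cabs_ge0 (f a); have := cabs_ge0 (g a); lra.
pose d := Num.min 1 (e / (2 * M)).
have d0 : 0 < d by rewrite lt_min ltr01 divr_gt0 // mulr_gt0 //; lra.
apply: near_imp (near_and (cf _ d0) (cg _ d0)) => z [h1 h2].
have -> : f z * g z - f a * g a = (f z - f a) * g z + f a * (g z - g a) by ring.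
apply: le_lt_trans (ler_cabsD _ _) _; rewrite !cabsM.
have gz : cabs (g z) <= M.
  have -> : g z = (g z - g a) + g a by rewrite subrK.
  apply: le_trans (ler_cabsD _ _) _.
  have : d <= 1 by rewrite ge_min lexx.
  rewrite /M; have := cabs_ge0 (f a); lra.
have dM : d * M <= e / 2.
  have : d <= e / (2 * M) by rewrite ge_min lexx orbT.
  rewrite ler_pdivlMr; lra.
have fM : cabs (f a) < M by rewrite /M; have := cabs_ge0 (g a); lra.
have b1 : cabs (f z - f a) * cabs (g z) < d * M.
  apply: (@le_lt_trans _ _ (cabs (f z - f a) * M)).
    by rewrite ler_wpM2l ?cabs_ge0.
  by rewrite ltr_pM2r //; lra.
have b2 : cabs (f a) * cabs (g z - g a) <= M * d.
  by apply: ler_pM; rewrite ?cabs_ge0 // ltW.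
rewrite mulrC in b2; lra.
Qed.

Lemma near_neq0 f a : cont f a -> f a != 0 -> nearC a (fun z => f z != 0).
Proof.
move=> cf fa; have fa0 : 0 < cabs (f a) by rewrite cabs_gt0.
apply: near_imp (cf _ fa0) => z; apply: contraTneq => ->.
by rewrite sub0r cabsN ltxx.
Qed.

Lemma contV f a : cont f a -> f a != 0 -> cont (fun z => (f z)^-1) a.
Proof.
move=> cf fa e e0; have fa0 : 0 < cabs (f a) by rewrite cabs_gt0.
pose m := cabs (f a).
have d0 : 0 < Num.min (m / 2) (e * m ^+ 2 / 2).
  by rewrite lt_min !divr_gt0 // mulr_gt0 // exprn_gt0.
apply: near_imp (near_and (near_neq0 cf fa) (cf _ d0)) => z [fz].
rewrite lt_min => /andP[h1 h2].
have -> : (f z)^-1 - (f a)^-1 = - (f z - f a) / (f z * f a) by field; rewrite fz fa.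
rewrite cabs_div cabsN cabsM -/m.
have mz : m / 2 <= cabs (f z).
  have := lerB_cabs (f a) (f z); rewrite cabsBC -/m; lra.
rewrite ltr_pdivrMr; last by rewrite mulr_gt0 ?cabs_gt0.
apply: lt_le_trans h2 _; rewrite -mulrA ler_wpM2l ?(ltW e0) //.
by rewrite expr2 mulrAC ler_wpM2r // ltW.
Qed.

Lemma contX f n a : cont f a -> cont (fun z => f z ^+ n) a.
Proof.
move=> cf; elim: n => [|n IH].
  by under [X in cont X]eq_fun do rewrite expr0; exact: cont_cst.
by under [X in cont X]eq_fun do rewrite exprS; exact: contM.
Qed.

Lemma cont_comp f g a : cont f a -> cont g (f a) -> cont (fun z => g (f z)) a.
Proof.
move=> cf cg e e0; have [d d0 H] := cg e e0.
by apply: near_imp (cf d d0) => z /H.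
Qed.

Lemma cont_congr f g a : nearC a (fun z => f z = g z) -> cont f a -> cont g a.
Proof.
move=> fg cf e e0; apply: near_imp (near_and fg (cf e e0)) => z [<-].
by rewrite (near_self fg).
Qed.

Lemma cont_near_bd f a : cont f a -> nearC a (fun z => cabs (f z) <= cabs (f a) + 1).
Proof.
move=> cf; apply: near_imp (cf 1 ltr01) => z h.
have := lerB_cabs (f z) (f a); lra.
Qed.

(** The difference quotient, completed at the base point by a value [l]. A
    derivative is the value that makes it continuous (Caratheodory), which
    reduces the rules of calculus to those of continuity. *)
Definition dqv f a l z : C := if z == a then l else (f z - f a) / (z - a).

Lemma dqvP f a l z : f z - f a = dqv f a l z * (z - a).
Proof.
rewrite /dqv; case: eqVneq => [->|za]; first by rewrite !subrr mulr0.
by rewrite divfK // subr_eq0.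
Qed.

Definition has_der f a l := cont (dqv f a l) a.

Lemma dqvaa f a l : dqv f a l a = l. Proof. by rewrite /dqv eqxx. Qed.

Lemma has_derI f a phi : cont phi a ->
  nearC a (fun z => f z - f a = phi z * (z - a)) -> has_der f a (phi a).
Proof.
move=> cphi H; apply: cont_congr cphi; apply: near_imp H => z H.
rewrite /dqv; case: eqVneq => [->//|za].
by rewrite H mulfK // subr_eq0.
Qed.

Lemma has_derI' f a l phi : cont phi a -> phi a = l ->
  (forall z, f z - f a = phi z * (z - a)) -> has_der f a l.
Proof. by move=> cphi <- H; apply: has_derI => //; apply: near_all. Qed.

Lemma has_der_cont f a l : has_der f a l -> cont f a.
Proof.
move=> H; apply: (@cont_congr (fun z => f a + dqv f a l z * (z - a))).
  by apply: near_all => z; rewrite -dqvP addrC subrK.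
apply: contD; first exact: cont_cst.
apply: contM => //; apply: contB; [exact: cont_id|exact: cont_cst].
Qed.

Lemma has_der_congr f g a l : nearC a (fun z => f z = g z) -> has_der f a l -> has_der g a l.
Proof.
move=> fg; apply: cont_congr; apply: near_imp (fg) => z fz.
by rewrite /dqv fz (near_self fg).
Qed.

Lemma has_der_cst c a : has_der (fun _ => c) a 0.
Proof.
apply: (@has_derI' _ _ _ (fun _ => 0)) => //; first exact: cont_cst.
by move=> z; rewrite subrr mul0r.
Qed.

Lemma has_der_id a : has_der id a 1.
Proof.
apply: (@has_derI' _ _ _ (fun _ => 1)) => //; first exact: cont_cst.
by move=> z; rewrite mul1r.
Qed.

Lemma has_derD f g a l m : has_der f a l -> has_der g a m -> has_der (fun z => f z + g z) a (l + m).
Proof.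
move=> hf hg; apply: (@has_derI' _ _ _ (fun z => dqv f a l z + dqv g a m z)).
- exact: contD.
- by rewrite !dqvaa.
- by move=> z; rewrite mulrDl -!dqvP; ring.
Qed.

Lemma has_derN f a l : has_der f a l -> has_der (fun z => - f z) a (- l).
Proof.
move=> hf; apply: (@has_derI' _ _ _ (fun z => - dqv f a l z)).
- exact: contN.
- by rewrite !dqvaa.
- by move=> z; rewrite mulNr -!dqvP; ring.
Qed.

Lemma has_derB f g a l m : has_der f a l -> has_der g a m -> has_der (fun z => f z - g z) a (l - m).
Proof. by move=> hf hg; apply: has_derD => //; apply: has_derN. Qed.

Lemma has_derM f g a l m : has_der f a l -> has_der g a m ->
  has_der (fun z => f z * g z) a (l * g a + f a * m).
Proof.
move=> hf hg; apply: (@has_derI' _ _ _ (fun z => dqv f a l z * g z + f a * dqv g a m z)).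
- apply: contD; apply: contM => //; [exact: has_der_cont hg|exact: cont_cst].
- by rewrite !dqvaa.
- move=> z; have H1 := dqvP f a l z; have H2 := dqvP g a m z.
  by rewrite mulrDl mulrAC -H1 -mulrA -H2; ring.
Qed.

Lemma has_derV f a l : has_der f a l -> f a != 0 -> has_der (fun z => (f z)^-1) a (- l / f a ^+ 2).
Proof.
move=> hf fa.
pose phi z := - dqv f a l z * ((f z)^-1 * (f a)^-1).
have -> : - l / f a ^+ 2 = phi a by rewrite /phi dqvaa; field.
apply: (@has_derI _ _ phi).
  apply: contM; first exact: contN.
  apply: contM; last exact: cont_cst.
  apply: contV => //; exact: has_der_cont hf.
apply: near_imp (near_neq0 (has_der_cont hf) fa) => z fz.
rewrite /phi mulrAC mulNr -dqvP; field; by rewrite fz fa.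
Qed.

Lemma has_der_comp f g a l m : has_der f a l -> has_der g (f a) m ->
  has_der (fun z => g (f z)) a (m * l).
Proof.
move=> hf hg.
apply: (@has_derI' _ _ _ (fun z => dqv g (f a) m (f z) * dqv f a l z)).
- apply: contM => //; apply: (cont_comp (has_der_cont hf)); exact: hg.
- by rewrite !dqvaa.
- by move=> z; rewrite -mulrA -!dqvP.
Qed.

(** This identifies values across a removable point, where two expressions
    agree only off [a]. *)
Lemma cont_uniq f g a : cont f a -> cont g a ->
  nearC a (fun z => z != a -> f z = g z) -> f a = g a.
Proof.
move=> cf cg fg; apply/eqP; rewrite -subr_eq0 -cabs_eq0; apply/negP => /negP n0.
have e0 : 0 < cabs (f a - g a) / 2 by rewrite divr_gt0 // lt_def n0 cabs_ge0.
have [d d0 H] := near_and (near_and (cf _ e0) (cg _ e0)) fg.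
pose z := a + (d / 2)%:C.
have za : cabs (z - a) = d / 2 by rewrite /z addrAC subrr add0r cabs_pos // divr_ge0 // ltW.
have zna : z != a by rewrite -cabs_sub_gt0 za divr_gt0.
have [] := H z; first by rewrite za; lra.
move=> [h1 h2] /(_ zna) E; rewrite E cabsBC in h1.
have := ler_cabs_dist (g z) (f a) (g a); lra.
Qed.

Lemma has_der_uniq f a l m : has_der f a l -> has_der f a m -> l = m.
Proof.
move=> hl hm; have := cont_uniq hl hm; rewrite !dqvaa; apply; apply: near_all => z za.
by rewrite /dqv (negbTE za).
Qed.

Definition cdiff f a := exists l, has_der f a l.

Lemma cdiff_cst c a : cdiff (fun _ => c) a. Proof. by exists 0; exact: has_der_cst. Qed.
Lemma cdiff_id a : cdiff id a. Proof. by exists 1; exact: has_der_id. Qed.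
Lemma cdiffD f g a : cdiff f a -> cdiff g a -> cdiff (fun z => f z + g z) a.
Proof. by move=> [l hl] [m hm]; exists (l + m); exact: (has_derD hl hm). Qed.
Lemma cdiffB f g a : cdiff f a -> cdiff g a -> cdiff (fun z => f z - g z) a.
Proof. by move=> [l hl] [m hm]; exists (l - m); exact: (has_derB hl hm). Qed.
Lemma cdiffN f a : cdiff f a -> cdiff (fun z => - f z) a.
Proof. by move=> [l hl]; exists (- l); exact: (has_derN hl). Qed.
Lemma cdiffM f g a : cdiff f a -> cdiff g a -> cdiff (fun z => f z * g z) a.
Proof. by move=> [l hl] [m hm]; exists (l * g a + f a * m); exact: (has_derM hl hm). Qed.
Lemma cdiffV f a : cdiff f a -> f a != 0 -> cdiff (fun z => (f z)^-1) a.
Proof. by move=> [l hl] fa; exists (- l / f a ^+ 2); exact: (has_derV hl fa). Qed.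
Lemma cdiff_div f g a : cdiff f a -> cdiff g a -> g a != 0 ->
  cdiff (fun z => f z / g z) a.
Proof. by move=> df dg ga; apply: cdiffM => //; apply: cdiffV. Qed.
Lemma cdiffX f n a : cdiff f a -> cdiff (fun z => f z ^+ n) a.
Proof.
move=> df; elim: n => [|n IH].
  by under [X in cdiff X]eq_fun do rewrite expr0; exact: cdiff_cst.
by under [X in cdiff X]eq_fun do rewrite exprS; exact: cdiffM.
Qed.
Lemma cdiff_comp f g a : cdiff f a -> cdiff g (f a) -> cdiff (fun z => g (f z)) a.
Proof. by move=> [l hl] [m hm]; exists (m * l); exact: (has_der_comp hl hm). Qed.
Lemma cdiff_congr f g a : nearC a (fun z => f z = g z) -> cdiff f a -> cdiff g a.
Proof. by move=> fg [l hl]; exists l; apply: has_der_congr hl. Qed.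
Lemma cdiff_cont f a : cdiff f a -> cont f a.
Proof. by move=> [l /has_der_cont]. Qed.

End Cont.

(** * Bisection and integrals along segments *)

Section Cousin.
Variable R : realType.

Lemma nested_point (x : nat -> R) (w : R) :
  (forall n, x n <= x n.+1 <= x n + w / 2 ^+ n.+1) ->
  exists a, forall n, x n <= a <= x n + w / 2 ^+ n.
Proof.
move=> H.
have mono n k : x n <= x (n + k)%N.
  elim: k => [|k IH]; first by rewrite addn0.
  by rewrite addnS (le_trans IH) //; case/andP: (H (n + k)%N).
have bd n k : x (n + k)%N + w / 2 ^+ (n + k) <= x n + w / 2 ^+ n.
  elim: k => [|k IH]; first by rewrite addn0.
  apply: le_trans IH; rewrite addnS; case/andP: (H (n + k)%N) => _.
  rewrite !exprS invfM; move: (x _) (x _) (2 ^+ _) => u v t.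
  set s := w * _; set s' := w / t; have -> : s = s' / 2 by rewrite /s /s'; ring.
  lra.
have w0 n : 0 <= w / 2 ^+ n.
  case/andP: (H 0) => h1 h2; have : 0 <= w / 2 ^+ 1 by lra.
  by rewrite !pmulr_lge0 // invr_gt0 ?exprn_gt0.
have ub n m : x m <= x n + w / 2 ^+ n.
  apply: (@le_trans _ _ (x (n + m)%N)); first by rewrite addnC mono.
  by apply: le_trans (bd n m); rewrite lerDl.
exists (sup (range x)) => n; apply/andP; split.
  apply: sup_ubound; last by exists n.
  by exists (x 0 + w / 2 ^+ 0) => _ [m _ <-]; exact: ub.
by apply: ge_sup; [exists (x 0); exists 0%N|move=> _ [m _ <-]; exact: ub].
Qed.

Lemma small_pow (w d : R) : 0 < d -> exists n, w / 2 ^+ n < d.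
Proof.
move=> d0; have := archi_boundP (normr_ge0 (w / d)).
set n := Num.bound _ => Hn; exists n.
rewrite ltr_pdivrMr ?exprn_gt0 // mulrC -ltr_pdivrMr //.
apply: le_lt_trans (ler_norm _) _; apply: lt_le_trans Hn _.
rewrite -natrX ler_nat; exact: ltnW (ltn_expl _ _).
Qed.

(** Cousin's principle: if the property failed, some quarter would inherit the
    failure at every step, contradicting the local hypothesis at the common
    point of the nested rectangles. It serves both for Goursat's theorem and for
    compactness. *)
Lemma cousin2 (P : R -> R -> R -> R -> Prop) (x0 y0 w h : R) :
  0 <= w -> 0 <= h ->
  (forall x y w h, 0 <= w -> 0 <= h -> 
     P x y (w / 2) (h / 2) -> P (x + w / 2) y (w / 2) (h / 2) ->
     P x (y + h / 2) (w / 2) (h / 2) -> P (x + w / 2) (y + h / 2) (w / 2) (h / 2) ->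
     P x y w h) ->
  (forall a b, x0 <= a <= x0 + w -> y0 <= b <= y0 + h ->
     exists2 d, 0 < d & forall x y w h, 0 <= w < d -> 0 <= h < d ->
       x <= a <= x + w -> y <= b <= y + h -> P x y w h) ->
  P x0 y0 w h.
Proof.
move=> w0 h0 join loc; apply: contrapT => nP.
pose nx (w h : R) (z : R * R) :=
  let: (x, y) := z in
  if `[< ~ P x y w h >] then (x, y)
  else if `[< ~ P (x + w) y w h >] then (x + w, y)
  else if `[< ~ P x (y + h) w h >] then (x, y + h)
  else (x + w, y + h).
pose s := fix s n := if n is m.+1 then nx (w / 2 ^+ m.+1) (h / 2 ^+ m.+1) (s m) else (x0, y0).
have pos (v : R) n : 0 <= v -> 0 <= v / 2 ^+ n.
  by move=> v0; rewrite divr_ge0 // exprn_ge0.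
have half (v : R) n : v / 2 ^+ n.+1 = v / 2 ^+ n / 2 by rewrite exprS invfM; ring.
have sP n : ~ P (s n).1 (s n).2 (w / 2 ^+ n) (h / 2 ^+ n).
  elim: n => [|n IH]; first by rewrite /= !divr1.
  rewrite [s n.+1]/=; case: (s n) IH => x y /= IH; rewrite /nx.
  case: asboolP => [//|/contrapT P1].
  case: asboolP => [//|/contrapT P2].
  case: asboolP => [//|/contrapT P3] P4; apply: IH.
  apply: join; rewrite ?pos // -!half //.
have s1 n : (s n).1 <= (s n.+1).1 <= (s n).1 + w / 2 ^+ n.+1.
  rewrite [s n.+1]/=; case: (s n) => x y; rewrite /nx.
  have := pos w n.+1 w0.
  by do 3 (case: asboolP => _ /=; first lra); lra.
have s2 n : (s n).2 <= (s n.+1).2 <= (s n).2 + h / 2 ^+ n.+1.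
  rewrite [s n.+1]/=; case: (s n) => x y; rewrite /nx.
  have := pos h n.+1 h0.
  by do 3 (case: asboolP => _ /=; first lra); lra.
have [a Ha] := nested_point s1; have [b Hb] := nested_point s2.
have := Ha 0%N; have := Hb 0%N; rewrite /= !divr1 => b0 a0.
have [d d0 Hd] := loc a b a0 b0.
have [n1 N1] := small_pow w d0; have [n2 N2] := small_pow h d0.
apply: (sP (n1 + n2)%N); apply: Hd; rewrite ?pos // ?Ha ?Hb //=.
  rewrite exprD invfM mulrA; apply: le_lt_trans N1.
  by rewrite ler_pdivrMr ?exprn_gt0 // ler_peMr ?pos // exprn_ege1 // ler1n.
rewrite addnC exprD invfM mulrA; apply: le_lt_trans N2.
by rewrite ler_pdivrMr ?exprn_gt0 // ler_peMr ?pos // exprn_ege1 // ler1n.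
Qed.
End Cousin.

Section SegmentIntegral.
Variable R : realType.
Local Notation mu := (@lebesgue_measure R).
Implicit Types (u v : R -> R) (a b c : R).

Definition rint u a b : R := \int[mu]_(x in `[a, b]) u x.

Definition rcont u a b := forall x, a <= x <= b ->
  forall e, 0 < e -> exists2 d, 0 < d & forall y, `|y - x| < d -> `|u y - u x| < e.

Lemma rcont_integrable u a b : rcont u a b -> mu.-integrable `[a, b] (EFin \o u).
Proof.
move=> H; apply: continuous_compact_integrable; first exact: segment_compact.
apply: continuous_in_subspaceT => x; rewrite inE /= in_itv /= => xab.
apply/cvgrPdist_lt => e e0; have [d d0 Hd] := H x xab e e0.
apply/nbhs_ballP; exists d => // y; rewrite /ball /= => yx.
by rewrite distrC; apply: Hd; rewrite distrC.
Qed.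

Lemma rint_split u a c b : a <= c <= b -> rcont u a b ->
  rint u a b = rint u a c + rint u c b.
Proof.
move=> /andP[ac cb] /rcont_integrable H.
have := @Rintegral_itvB R u (BLeft a) (BRight b) c H.
rewrite !bnd_simp => /(_ ac cb) /eqP; rewrite subr_eq => /eqP; rewrite /rint => ->.
rewrite addrC; congr (_ + _); rewrite -Rintegral_itv_obnd_cbnd //.
apply: (@integrableS _ _ _ mu `[a, b]) => //.
  by move=> x /=; rewrite !in_itv /= => /andP[h1 ->]; rewrite andbT; lra.
Qed.

Lemma rint_lin u v (k : R) a b : rcont u a b -> rcont v a b ->
  rint (fun x => k * u x + v x) a b = k * rint u a b + rint v a b.
Proof.
move=> /rcont_integrable Hu /rcont_integrable Hv.
rewrite /rint RintegralD //; first by rewrite RintegralZl.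
have -> : EFin \o (fun x => k * u x) = (fun x => k%:E * (EFin \o u) x)%E by apply/funext.
exact: integrableZl.
Qed.

Lemma rint_cst (k : R) a b : a <= b -> rint (fun=> k) a b = k * (b - a).
Proof.
move=> ab; rewrite /rint Rintegral_cst //= lebesgue_measure_itv /= lte_fin.
by move: ab; rewrite le_eqVlt => /orP[/eqP->|ab]; rewrite ?ltxx ?subrr ?ab.
Qed.

Lemma le_rint u v a b : rcont u a b -> rcont v a b ->
  (forall x, a <= x <= b -> u x <= v x) -> rint u a b <= rint v a b.
Proof.
move=> /rcont_integrable Hu /rcont_integrable Hv H; exact: le_Rintegral.
Qed.

Lemma rcont_cst (k : R) a b : rcont (fun=> k) a b.
Proof. by move=> x _ e e0; exists 1 => // y _; rewrite subrr normr0. Qed.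

Lemma normr_rint u a b M : a <= b -> rcont u a b ->
  (forall x, a <= x <= b -> `|u x| <= M) -> `|rint u a b| <= M * (b - a).
Proof.
move=> ab cu H; rewrite ler_norml -mulNr -!rint_cst //.
by apply/andP; split; apply: le_rint => //; try exact: rcont_cst;
  move=> x /H; rewrite ler_norml => /andP[].
Qed.

End SegmentIntegral.

Section ComplexIntegral.
Variable R : realType.
Local Notation C := R[i].
Implicit Types (p q : R -> C) (a b c : R).

Lemma rcont_lin (u v : R -> R) (k : R) a b : rcont u a b -> rcont v a b ->
  rcont (fun x => k * u x + v x) a b.
Proof.
move=> cu cv x xab e e0.
have k1 : 0 < `|k| + 1 by have := normr_ge0 k; lra.
have [d d0 Hd] := cu x xab (e / (2 * (`|k| + 1))) ltac:(by rewrite divr_gt0 // mulr_gt0).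
have [d' d'0 Hd'] := cv x xab (e / 2) ltac:(by rewrite divr_gt0).
exists (Num.min d d'); first by rewrite lt_min d0.
move=> y; rewrite lt_min => /andP[/Hd h1 /Hd' h2].
have -> : k * u y + v y - (k * u x + v x) = k * (u y - u x) + (v y - v x) by ring.
apply: le_lt_trans (ler_normD _ _) _; rewrite normrM.
rewrite ltr_pdivlMr ?mulr_gt0 // in h1.
have := normr_ge0 (u y - u x); nra.
Qed.

Definition ccont p a b := forall x, a <= x <= b ->
  forall e, 0 < e -> exists2 d, 0 < d & forall y, `|y - x| < d -> cabs (p y - p x) < e.

Lemma ccont_Re p a b : ccont p a b -> rcont (fun x => Re (p x)) a b.
Proof.
move=> H x xab e e0; have [d d0 Hd] := H x xab e e0; exists d => // y /Hd.
by apply: le_lt_trans; rewrite -ReB normr_Re.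
Qed.

Lemma ccont_Im p a b : ccont p a b -> rcont (fun x => Im (p x)) a b.
Proof.
move=> H x xab e e0; have [d d0 Hd] := H x xab e e0; exists d => // y /Hd.
by apply: le_lt_trans; rewrite -ImB normr_Im.
Qed.

Lemma ccontB p q a b : ccont p a b -> ccont q a b -> ccont (fun x => p x - q x) a b.
Proof.
move=> cu cv x xab e e0; have e2 : 0 < e / 2 by rewrite divr_gt0.
have [d d0 Hd] := cu x xab _ e2; have [d' d'0 Hd'] := cv x xab _ e2.
exists (Num.min d d'); first by rewrite lt_min d0.
move=> y; rewrite lt_min => /andP[/Hd h1 /Hd' h2].
have -> : p y - q y - (p x - q x) = (p y - p x) - (q y - q x) by ring.
apply: le_lt_trans (ler_cabsB _ _) _; lra.
Qed.

Definition cint p a b : C :=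
  (rint (fun x => Re (p x)) a b) +i* (rint (fun x => Im (p x)) a b).

Lemma eq_cint p q a b : (forall x, p x = q x) -> cint p a b = cint q a b.
Proof. by move=> /funext ->. Qed.

Lemma cint_split p a c b : a <= c <= b -> ccont p a b -> cint p a b = cint p a c + cint p c b.
Proof.
move=> acb cp; rewrite /cint (rint_split acb (ccont_Re cp)) (rint_split acb (ccont_Im cp)).
by [].
Qed.

Lemma cint_lin (k : C) p q a b : ccont p a b -> ccont q a b ->
  cint (fun x => k * p x + q x) a b = k * cint p a b + cint q a b.
Proof.
move=> cp cq; apply/eqP; rewrite eq_complex; case: k => k1 k2.
have rp := ccont_Re cp; have ip := ccont_Im cp.
have rq := ccont_Re cq; have iq := ccont_Im cq.
apply/andP; split; apply/eqP => /=.
  transitivity (rint (fun x => k1 * Re (p x) + ((- k2) * Im (p x) + Re (q x))) a b).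
    by congr rint; apply/funext => x; case: (p x) => ? ?; case: (q x) => ? ?; rewrite /=; ring.
  by rewrite rint_lin ?rint_lin //; [ring|exact: rcont_lin].
transitivity (rint (fun x => k1 * Im (p x) + (k2 * Re (p x) + Im (q x))) a b).
  by congr rint; apply/funext => x; case: (p x) => ? ?; case: (q x) => ? ?; rewrite /=; ring.
by rewrite rint_lin ?rint_lin //; [ring|exact: rcont_lin].
Qed.

Lemma cint_cst (k : C) a b : a <= b -> cint (fun=> k) a b = k * (b - a)%:C.
Proof.
move=> ab; rewrite /cint !rint_cst //; case: k => x y /=.
by apply/eqP; rewrite eq_complex /=; apply/andP; split; apply/eqP; ring.
Qed.

Lemma cabs_cint p a b M : a <= b -> ccont p a b ->
  (forall x, a <= x <= b -> cabs (p x) <= M) -> cabs (cint p a b) <= 2 * M * (b - a).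
Proof.
move=> ab cp H; apply: le_trans (cabs_le_ReIm _) _ => /=.
have := normr_rint ab (ccont_Re cp) (fun x xab => le_trans (normr_Re _) (H x xab)).
have := normr_rint ab (ccont_Im cp) (fun x xab => le_trans (normr_Im _) (H x xab)).
lra.
Qed.

Implicit Types (f g : C -> C).

(** The integral of [g] along the boundary of a rectangle. Opposite sides are
    grouped, so that the contributions of a constant cancel under the integral
    sign. *)
Definition rectI g x0 x1 y0 y1 : C :=
  cint (fun t => g (t +i* y0) - g (t +i* y1)) x0 x1 +
  'i%C * cint (fun t => g (x1 +i* t) - g (x0 +i* t)) y0 y1.

Definition on_hside (P : C -> Prop) y x0 x1 := forall t : R, x0 <= t <= x1 -> P (t +i* y).
Definition on_vside (P : C -> Prop) x y0 y1 := forall t : R, y0 <= t <= y1 -> P (x +i* t).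

Lemma ccont_h g y a b : on_hside (cont g) y a b -> ccont (fun t => g (t +i* y)) a b.
Proof.
move=> H x xab e e0; have [d d0 Hd] := H x xab e e0; exists d => // t tx.
apply: Hd; suff -> : (t +i* y) - (x +i* y) = (t - x)%:C by rewrite cabs_real.
by apply/eqP; rewrite eq_complex /= subrr !eqxx.
Qed.

Lemma ccont_v g x a b : on_vside (cont g) x a b -> ccont (fun t => g (x +i* t)) a b.
Proof.
move=> H y xab e e0; have [d d0 Hd] := H y xab e e0; exists d => // t tx.
apply: Hd; suff -> : (x +i* t) - (x +i* y) = (t - y)%:C * 'i%C.
  by rewrite cabsM cabs_real cabs_i mulr1.
by apply/eqP; rewrite eq_complex /= subrr !(mul0r, mulr0, mulr1, subr0, addr0) !eqxx.
Qed.

Lemma rectI_cutx g x0 m x1 y0 y1 : x0 <= m <= x1 ->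
  on_hside (cont g) y0 x0 x1 -> on_hside (cont g) y1 x0 x1 ->
  on_vside (cont g) x0 y0 y1 -> on_vside (cont g) m y0 y1 -> on_vside (cont g) x1 y0 y1 ->
  rectI g x0 x1 y0 y1 = rectI g x0 m y0 y1 + rectI g m x1 y0 y1.
Proof.
move=> xm /ccont_h c1 /ccont_h c2 /ccont_v c3 /ccont_v c4 /ccont_v c5.
rewrite /rectI (cint_split xm (ccontB c1 c2)).
rewrite (@eq_cint (fun t => g (x1 +i* t) - g (x0 +i* t))
  (fun t => 1 * (g (x1 +i* t) - g (m +i* t)) + (g (m +i* t) - g (x0 +i* t)))).
  rewrite cint_lin; [|exact: ccontB|exact: ccontB].
  ring.
by move=> x; ring.
Qed.

Lemma rectI_cuty g x0 x1 y0 m y1 : y0 <= m <= y1 ->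
  on_vside (cont g) x0 y0 y1 -> on_vside (cont g) x1 y0 y1 ->
  on_hside (cont g) y0 x0 x1 -> on_hside (cont g) m x0 x1 -> on_hside (cont g) y1 x0 x1 ->
  rectI g x0 x1 y0 y1 = rectI g x0 x1 y0 m + rectI g x0 x1 m y1.
Proof.
move=> xm /ccont_v c1 /ccont_v c2 /ccont_h c3 /ccont_h c4 /ccont_h c5.
rewrite /rectI (cint_split xm (ccontB c2 c1)).
rewrite (@eq_cint (fun t => g (t +i* y0) - g (t +i* y1))
  (fun t => 1 * (g (t +i* y0) - g (t +i* m)) + (g (t +i* m) - g (t +i* y1)))).
  rewrite cint_lin; [|exact: ccontB|exact: ccontB].
  ring.
by move=> x; ring.
Qed.

Definition on_bdry (P : C -> Prop) x0 x1 y0 y1 :=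
  [/\ on_hside P y0 x0 x1, on_hside P y1 x0 x1, on_vside P x0 y0 y1 & on_vside P x1 y0 y1].

Lemma rectI_lin (k : C) f g x0 x1 y0 y1 :
  on_bdry (cont f) x0 x1 y0 y1 -> on_bdry (cont g) x0 x1 y0 y1 ->
  rectI (fun z => k * f z + g z) x0 x1 y0 y1 = k * rectI f x0 x1 y0 y1 + rectI g x0 x1 y0 y1.
Proof.
move=> [/ccont_h f1 /ccont_h f2 /ccont_v f3 /ccont_v f4].
move=> [/ccont_h g1 /ccont_h g2 /ccont_v g3 /ccont_v g4].
transitivity (cint (fun t => k * (f (t +i* y0) - f (t +i* y1)) + (g (t +i* y0) - g (t +i* y1))) x0 x1
  + 'i%C * cint (fun t => k * (f (x1 +i* t) - f (x0 +i* t)) + (g (x1 +i* t) - g (x0 +i* t))) y0 y1).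
  by congr (_ + _ * _); apply: eq_cint => t; ring.
rewrite !cint_lin; try exact: ccontB.
by rewrite /rectI; ring.
Qed.

Lemma rectI_bound g x0 x1 y0 y1 M : x0 <= x1 -> y0 <= y1 ->
  on_bdry (cont g) x0 x1 y0 y1 -> on_bdry (fun z => cabs (g z) <= M) x0 x1 y0 y1 ->
  cabs (rectI g x0 x1 y0 y1) <= 4 * M * ((x1 - x0) + (y1 - y0)).
Proof.
move=> xx yy [/ccont_h f1 /ccont_h f2 /ccont_v f3 /ccont_v f4] [h1 h2 h3 h4].
have H1 := @cabs_cint (fun t => g (t +i* y0) - g (t +i* y1)) x0 x1 (2 * M) xx (ccontB f1 f2).
have H2 := @cabs_cint (fun t => g (x1 +i* t) - g (x0 +i* t)) y0 y1 (2 * M) yy (ccontB f4 f3).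
apply: le_trans (ler_cabsD _ _) _; rewrite cabsM.
rewrite cabs_i mul1r.
have {}H1 := H1 ltac:(by move=> t tt; have := ler_cabsB (g (t +i* y0)) (g (t +i* y1)); have := h1 t tt; have := h2 t tt; lra).
have {}H2 := H2 ltac:(by move=> t tt; have := ler_cabsB (g (x1 +i* t)) (g (x0 +i* t)); have := h3 t tt; have := h4 t tt; lra).
lra.
Qed.

Lemma rectI_affine (A B : C) x0 x1 y0 y1 : x0 <= x1 -> y0 <= y1 ->
  rectI (fun z => A + B * z) x0 x1 y0 y1 = 0.
Proof.
move=> xx yy.
transitivity (cint (fun=> B * ('i%C * (y0 - y1)%:C)) x0 x1 + 'i%C * cint (fun=> B * (x1 - x0)%:C) y0 y1).
  congr (_ + _ * _); apply: eq_cint => t.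
    rewrite (_ : A + B * (t +i* y0) - (A + B * (t +i* y1)) = B * ((t +i* y0) - (t +i* y1))); last ring.
    by congr (_ * _); apply/eqP; rewrite eq_complex /=; apply/andP; split; apply/eqP; ring.
  rewrite (_ : A + B * (x1 +i* t) - (A + B * (x0 +i* t)) = B * ((x1 +i* t) - (x0 +i* t))); last ring.
  by congr (_ * _); apply/eqP; rewrite eq_complex /=; apply/andP; split; apply/eqP; ring.
by rewrite !cint_cst // !rmorphB /=; ring.
Qed.

End ComplexIntegral.

(** * Cauchy's theorem for rectangles and the maximum principle on squares *)

Section Goursat.
Variable R : realType.
Local Notation C := R[i].
Implicit Types (f g : C -> C) (z c : C).

Definition on_rect (P : C -> Prop) (x0 x1 y0 y1 : R) :=
  forall x y, x0 <= x <= x1 -> y0 <= y <= y1 -> P (x +i* y).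

Lemma on_rect_bdry P x0 x1 y0 y1 : x0 <= x1 -> y0 <= y1 ->
  on_rect P x0 x1 y0 y1 -> on_bdry P x0 x1 y0 y1.
Proof. by move=> xx yy H; split=> t tt; apply: H => //; rewrite lexx ?andbT. Qed.

Lemma cont_affine (A B : C) z : cont (fun z => A + B * z) z.
Proof.
by apply: contD; [exact: cont_cst|apply: contM; [exact: cont_cst|exact: cont_id]].
Qed.

(** The bound [e * (w + h) ^+ 2] is additive under quartering, and holds for small
    rectangles around any point because the affine part of [g] there has zero
    integral; [cousin2] propagates it to the whole rectangle. *)
Lemma goursat g x0 w y0 h : 0 <= w -> 0 <= h ->
  on_rect (cdiff g) x0 (x0 + w) y0 (y0 + h) -> rectI g x0 (x0 + w) y0 (y0 + h) = 0.
Proof.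
move=> w0 h0 dg; apply/eqP; rewrite -cabs_eq0; apply/eqP; apply/le_anti.
rewrite cabs_ge0 andbT; apply/ler_addgt0Pl => e' e'0; rewrite addr0.
pose e := e' / ((w + h + 1) ^+ 2).
have wh0 : 0 < (w + h + 1) ^+ 2 by rewrite exprn_gt0 //; lra.
have e0 : 0 < e by rewrite divr_gt0.
suff H : cabs (rectI g x0 (x0 + w) y0 (y0 + h)) <= e * (w + h) ^+ 2.
(* The factor absorbs the size of the rectangle; the added 1 covers an empty one. *)
    apply: le_trans H _; rewrite /e mulrAC ler_pdivrMr // ler_wpM2l ?(ltW e'0) //.
  by rewrite ler_pXn2r ?nnegrE //; lra.
pose P (x y w' h' : R) := x0 <= x -> x + w' <= x0 + w -> y0 <= y -> y + h' <= y0 + h ->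
  cabs (rectI g x (x + w') y (y + h')) <= e * (w' + h') ^+ 2.
have : P x0 y0 w h; last by apply.
have cg (x y : R) : x0 <= x <= x0 + w -> y0 <= y <= y0 + h -> cont g (x +i* y).
  by move=> hx hy; apply: cdiff_cont; exact: dg.
apply: cousin2 => //.
  move=> x y w1 h1 w10 h10 P1 P2 P3 P4 xa xb ya yb.
  have cH y' : y <= y' <= y + h1 -> on_hside (cont g) y' x (x + w1).
    by move=> hy t ht; apply: cg; lra.
  have cV x' : x <= x' <= x + w1 -> on_vside (cont g) x' y (y + h1).
    by move=> hy t ht; apply: cg; lra.
  rewrite (@rectI_cutx _ g x (x + w1 / 2)); [|lra|apply: cH; lra|apply: cH; lra|apply: cV; lra|apply: cV; lra|apply: cV; lra].
  have cut x' x'' : x <= x' -> x' <= x'' -> x'' <= x + w1 ->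
    rectI g x' x'' y (y + h1) = rectI g x' x'' y (y + h1 / 2) + rectI g x' x'' (y + h1 / 2) (y + h1).
    move=> ? ? ?; apply: rectI_cuty; try lra; try (apply: cV; lra).
    - by move=> t ht; apply: cg; lra.
    - by move=> t ht; apply: cg; lra.
    - by move=> t ht; apply: cg; lra.
  rewrite !cut; try lra.
  have {}P1 := P1 ltac:(lra) ltac:(lra) ltac:(lra) ltac:(lra).
  have {}P2 := P2 ltac:(lra) ltac:(lra) ltac:(lra) ltac:(lra).
  have {}P3 := P3 ltac:(lra) ltac:(lra) ltac:(lra) ltac:(lra).
  have {}P4 := P4 ltac:(lra) ltac:(lra) ltac:(lra) ltac:(lra).
  have E v : v + w1 / 2 + w1 / 2 = v + w1 by lra.
  have E' v : v + h1 / 2 + h1 / 2 = v + h1 by lra.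
  rewrite E in P2 P4; rewrite E' in P3 P4.
  have q : e * (w1 / 2 + h1 / 2) ^+ 2 = e * (w1 + h1) ^+ 2 / 4 by field.
  rewrite q in P1 P2 P3 P4.
  apply: le_trans (ler_cabsD _ _) _.
  apply: le_trans (lerD (ler_cabsD _ _) (ler_cabsD _ _)) _; lra.
move=> a b ha hb; have [l hl] := dg a b ha hb.
have [d d0 Hd] := hl (e / 4) ltac:(by rewrite divr_gt0).
exists (d / 2) => [|x y w1 h1 hw hh hax hby xa xb ya yb]; first by rewrite divr_gt0.
set A := g (a +i* b) - l * (a +i* b).
pose r z := g z - (A + l * z).
have cr z : cont g z -> cont r z.
  by move=> cgz; apply: contB => //; exact: cont_affine.
have rE : g = (fun z => 1 * (A + l * z) + r z) by apply/funext => z; rewrite /r; ring.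
rewrite rE rectI_lin.
- rewrite rectI_affine; [|lra|lra].
  rewrite mulr0 add0r.
  have := @rectI_bound _ r x (x + w1) y (y + h1) (e / 4 * (w1 + h1)).
  have -> : 4 * (e / 4 * (w1 + h1)) * (x + w1 - x + (y + h1 - y)) = e * (w1 + h1) ^+ 2 by field.
  apply; [lra|lra| |].
    apply: on_rect_bdry; [lra|lra|] => s t hs ht; apply: cr; apply: cg; lra.
  apply: on_rect_bdry; [lra|lra|] => s t hs ht.
  have -> : r (s +i* t) = (dqv g (a +i* b) l (s +i* t) - l) * ((s +i* t) - (a +i* b)).
    by rewrite mulrBl -dqvP /r /A; ring.
  have zz : cabs ((s +i* t) - (a +i* b)) <= w1 + h1.
    apply: le_trans (cabs_le_ReIm _) _; rewrite ReB ImB /=.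
    by apply: lerD; rewrite ler_norml; apply/andP; split; lra.
  rewrite cabsM; apply: ler_pM; rewrite ?cabs_ge0 //.
  have := Hd (s +i* t); rewrite dqvaa => Hd'; apply: ltW; apply: Hd'.
  by apply: le_lt_trans zz _; lra.
- by apply: on_rect_bdry; [lra|lra|] => s t hs ht; exact: cont_affine.
- by apply: on_rect_bdry; [lra|lra|] => s t hs ht; apply: cr; apply: cg; lra.
Qed.

Lemma goursat' g x0 x1 y0 y1 : x0 <= x1 -> y0 <= y1 ->
  on_rect (cdiff g) x0 x1 y0 y1 -> rectI g x0 x1 y0 y1 = 0.
Proof.
move=> xx yy H; have := @goursat g x0 (x1 - x0) y0 (y1 - y0).
rewrite !(addrC _ (_ - _)) !subrK; apply; rewrite ?subr_ge0 //.
Qed.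

End Goursat.

Section LocalMax.
Variable R : realType.
Local Notation C := R[i].
Implicit Types (f g : C -> C) (z c : C).

Lemma complexB (a b x y : R) : (x +i* y) - (a +i* b) = (x - a) +i* (y - b).
Proof. by []. Qed.

Lemma neq_complex (a b x y : R) : (x != a) || (y != b) -> (x +i* y) != (a +i* b).
Proof. by rewrite eq_complex /= negb_and. Qed.

(** The difference is the sum of four rectangles avoiding the centre. *)
Lemma rectI_shrink g a b r s : 0 < s -> s < r ->
  (forall x y, a - r <= x <= a + r -> b - r <= y <= b + r ->
     (x != a) || (y != b) -> cdiff g (x +i* y)) ->
  rectI g (a - r) (a + r) (b - r) (b + r) = rectI g (a - s) (a + s) (b - s) (b + s).
Proof.
move=> s0 sr dg.
have cg x y : a - r <= x <= a + r -> b - r <= y <= b + r ->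
    (x != a) || (y != b) -> cont g (x +i* y).
  by move=> ? ? ?; apply: cdiff_cont; exact: dg.
have cH y : b - r <= y <= b + r -> y != b -> on_hside (cont g) y (a - r) (a + r).
  by move=> hy yb t ht; apply: cg => //; rewrite yb orbT.
have cV x : a - r <= x <= a + r -> x != a -> on_vside (cont g) x (b - r) (b + r).
  by move=> hy yb t ht; apply: cg => //; rewrite yb.
have neg (x y : R) : x < y -> x != y by move=> h; rewrite lt_eqF.
have pos (x y : R) : y < x -> x != y by move=> h; rewrite gt_eqF.
have nr : b - r != b by apply: neg; lra.
have pr : b + r != b by apply: pos; lra.
have ns : b - s != b by apply: neg; lra.
have ps : b + s != b by apply: pos; lra.
have nra : a - r != a by apply: neg; lra.
have pra : a + r != a by apply: pos; lra.
have nsa : a - s != a by apply: neg; lra.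
have psa : a + s != a by apply: pos; lra.
have cHs y : b - r <= y <= b + r -> y != b -> on_hside (cont g) y (a - s) (a + r).
  by move=> hy yb t ht; apply: cg => //; rewrite ?yb ?orbT //; lra.
have cHs' y : b - r <= y <= b + r -> y != b -> on_hside (cont g) y (a - s) (a + s).
  by move=> hy yb t ht; apply: cg => //; rewrite ?yb ?orbT //; lra.
have cVs x : a - r <= x <= a + r -> x != a -> on_vside (cont g) x (b - s) (b + r).
  by move=> hy yb t ht; apply: cg => //; rewrite ?yb //; lra.
rewrite (@rectI_cutx _ g _ (a - s)); [|lra|apply: cH => //; lra|apply: cH => //; lra
  |apply: cV => //; lra|apply: cV => //; lra|apply: cV => //; lra].
rewrite (@goursat' _ g (a - r)); [|lra|lra|]; last first.
  by move=> x y hx hy; apply: dg; [lra|lra|]; rewrite neg //; lra.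
rewrite add0r.
rewrite (@rectI_cutx _ g (a - s) (a + s)); [|lra|apply: cHs => //; lra|apply: cHs => //; lra
  |apply: cV => //; lra|apply: cV => //; lra|apply: cV => //; lra].
rewrite (@goursat' _ g (a + s)); [|lra|lra|]; last first.
  by move=> x y hx hy; apply: dg; [lra|lra|]; rewrite pos //; lra.
rewrite addr0.
rewrite (@rectI_cuty _ g _ _ _ (b - s)); [|lra|apply: cV => //; lra|apply: cV => //; lra
  |apply: cHs' => //; lra|apply: cHs' => //; lra|apply: cHs' => //; lra].
rewrite (@goursat' _ g _ _ (b - r)); [|lra|lra|]; last first.
  by move=> x y hx hy; apply: dg; [lra|lra|]; rewrite (neg y) ?orbT //; lra.
rewrite add0r.
rewrite (@rectI_cuty _ g _ _ _ (b + s)); [|lra|apply: cVs => //; lra|apply: cVs => //; lra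
  |apply: cHs' => //; lra|apply: cHs' => //; lra|apply: cHs' => //; lra].
rewrite (@goursat' _ g _ _ (b + s)); [|lra|lra|]; last first.
  by move=> x y hx hy; apply: dg; [lra|lra|]; rewrite (pos y) ?orbT //; lra.
by rewrite addr0.
Qed.

Lemma cont_divc c z : z != c -> cont (fun z => (z - c)^-1) z.
Proof.
move=> zc; apply: contV; last by rewrite subr_eq0.
by apply: contB; [exact: cont_id|exact: cont_cst].
Qed.

Lemma cdiff_divc c z : z != c -> cdiff (fun z => (z - c)^-1) z.
Proof.
move=> zc; apply: cdiffV; last by rewrite subr_eq0.
by apply: cdiffB; [exact: cdiff_id|exact: cdiff_cst].
Qed.

Lemma sq_bdry (P : C -> Prop) a b r : 0 < r ->
  (forall z, r <= cabs (z - (a +i* b)) -> cabs (z - (a +i* b)) <= 2 * r -> P z) ->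
  on_bdry P (a - r) (a + r) (b - r) (b + r).
Proof.
move=> r0 H.
have K (u v : R) : `|u| <= r -> `|v| <= r -> (`|u| == r) || (`|v| == r) ->
  r <= cabs (u +i* v) /\ cabs (u +i* v) <= 2 * r.
  move=> ur vr h; split; last by apply: le_trans (cabs_le_ReIm _) _ => /=; lra.
  by case/orP: h => /eqP <-; [exact: (normr_Re (u +i* v))|exact: (normr_Im (u +i* v))].
have B (u v : R) : a - r <= u <= a + r -> b - r <= v <= b + r ->
   (`|u - a| == r) || (`|v - b| == r) -> P (u +i* v).
  move=> hu hv h; have [] := K (u - a) (v - b) _ _ h.
  - by rewrite ler_norml; lra.
  - by rewrite ler_norml; lra.
  - by move=> h1 h2; apply: H; rewrite complexB.
have rr : `|r| = r by rewrite gtr0_norm.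
split=> t ht; apply: B => //; try lra.
- by rewrite addrAC subrr add0r normrN rr eqxx orbT.
- by rewrite addrAC subrr add0r rr eqxx orbT.
- by rewrite addrAC subrr add0r normrN rr eqxx.
- by rewrite addrAC subrr add0r rr eqxx.
Qed.

Lemma sq_bdry_imp (P Q : C -> Prop) x0 x1 y0 y1 :
  (forall z, P z -> Q z) -> on_bdry P x0 x1 y0 y1 -> on_bdry Q x0 x1 y0 y1.
Proof. by move=> PQ [h1 h2 h3 h4]; split=> t ht; apply: PQ; auto. Qed.

Lemma sq_bdry_and (P Q : C -> Prop) x0 x1 y0 y1 :
  on_bdry P x0 x1 y0 y1 -> on_bdry Q x0 x1 y0 y1 ->
  on_bdry (fun z => P z /\ Q z) x0 x1 y0 y1.
Proof. by move=> [h1 h2 h3 h4] [k1 k2 k3 k4]; split=> t ht; split; auto. Qed.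

(** The exact value is 2 i pi; it only matters that it stays away from 0
    uniformly in [r]. *)
Lemma rectI_inv a b r : 0 < r ->
  4 <= Im (rectI (fun z => (z - (a +i* b))^-1) (a - r) (a + r) (b - r) (b + r)).
Proof.
move=> r0; set g := fun z => _.
have [c1 c2 c3 c4] : on_bdry (cont g) (a - r) (a + r) (b - r) (b + r).
  apply: sq_bdry => // z rz _; apply: cont_divc; rewrite -cabs_sub_gt0; lra.
have q0 (u v : R) : u != 0 -> 0 < u ^+ 2 + v ^+ 2.
  by move=> u0; rewrite ltr_wpDr ?sqr_ge0 // lt_def sqr_ge0 sqrf_eq0 u0.
have q0' (u v : R) : v != 0 -> 0 < u ^+ 2 + v ^+ 2.
  by move=> u0; rewrite ltr_wpDl ?sqr_ge0 // lt_def sqr_ge0 sqrf_eq0 u0.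
have rn : r != 0 by rewrite gt_eqF.
have bd (t s : R) : s - r <= t <= s + r -> (t - s) ^+ 2 <= r ^+ 2.
  by move=> ht; rewrite -real_normK ?num_real // ler_pXn2r ?nnegrE ?(ltW r0) // ler_norml; lra.
have lb (D : R) : 0 < D -> D <= 2 * r ^+ 2 -> r^-1 <= 2 * r / D.
  move=> D0 DD; rewrite ler_pdivlMr // ler_pdivrMl //; nra.
rewrite /rectI ImD.
have -> (w : C) : Im ('i%C * w) = Re w by case: w => ? ?; rewrite /=; ring.
rewrite [Im (cint _ _ _)]/= [Re (cint _ _ _)]/=.
have H1 : 2 <= rint (fun x => Im (g (x +i* (b - r)) - g (x +i* (b + r)))) (a - r) (a + r).
  have -> : 2 = r^-1 * (a + r - (a - r)) :> R by field.
  rewrite -rint_cst; last lra.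
  apply: le_rint; first exact: rcont_cst.
    by apply: ccont_Im; apply: ccontB; apply: ccont_h.
  move=> x hx; rewrite /g !complexB /=.
  have -> : b - r - b = - r by ring.
  have -> : b + r - b = r by ring.
  have D0 := q0' (x - a) r rn.
  rewrite sqrrN (_ : _ - _ = 2 * r / ((x - a) ^+ 2 + r ^+ 2)); last by field; rewrite gt_eqF.
  by apply: lb => //; have := bd x a hx; lra.
have H2 : 2 <= rint (fun x => Re (g ((a + r) +i* x) - g ((a - r) +i* x))) (b - r) (b + r).
  have -> : 2 = r^-1 * (b + r - (b - r)) :> R by field.
  rewrite -rint_cst; last lra.
  apply: le_rint; first exact: rcont_cst.
    by apply: ccont_Re; apply: ccontB; apply: ccont_v.
  move=> x hx; rewrite /g !complexB /=.
  have -> : a - r - a = - r by ring.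
  have -> : a + r - a = r by ring.
  have D0 := q0 r (x - b) rn.
  rewrite sqrrN (_ : _ - _ = 2 * r / (r ^+ 2 + (x - b) ^+ 2)); last by field; rewrite gt_eqF.
  by apply: lb => //; have := bd x b hx; lra.
lra.
Qed.

(** Cauchy's formula with a lossy constant: shrinking the square in the integral
    of [f z / (z - c)] leaves [f c] times the integral of [1 / (z - c)]. *)
Lemma square_bound4 f a b r M : 0 < r ->
  on_rect (cdiff f) (a - r) (a + r) (b - r) (b + r) ->
  on_bdry (fun z => cabs (f z) <= M) (a - r) (a + r) (b - r) (b + r) ->
  cabs (f (a +i* b)) <= 4 * M.
Proof.
move=> r0 df fM; set c := a +i* b.
have dc : cdiff f c by apply: df; lra.
apply/ler_addgt0Pl => e e0.
have [d d0 Hd] := cdiff_cont dc (e := e / 4) ltac:(by rewrite divr_gt0).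
pose s := Num.min (r / 2) (d / 4).
have s0 : 0 < s by rewrite lt_min !divr_gt0.
have sr2 : s <= r / 2 by rewrite ge_min lexx.
have sr : s < r by lra.
have sd4 : s <= d / 4 by rewrite ge_min lexx orbT.
have sd : 2 * s < d by lra.
pose g z := f z * (z - c)^-1.
have dg x y : a - r <= x <= a + r -> b - r <= y <= b + r ->
     (x != a) || (y != b) -> cdiff g (x +i* y).
  move=> hx hy /neq_complex xy; apply: cdiffM; [exact: df|exact: cdiff_divc].
have B1 : cabs (rectI g (a - r) (a + r) (b - r) (b + r)) <= 16 * M.
  have -> : 16 * M = 4 * (M / r) * ((a + r - (a - r)) + (b + r - (b - r))) by field; rewrite gt_eqF.
  have far : on_bdry (fun z => r <= cabs (z - c)) (a - r) (a + r) (b - r) (b + r).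
    by apply: sq_bdry.
  apply: rectI_bound; [lra|lra| |].
    have : on_bdry (cdiff f) (a - r) (a + r) (b - r) (b + r).
      by apply: on_rect_bdry => //; lra.
    move/(sq_bdry_and far); apply: sq_bdry_imp => z [h1 h2].
    apply: contM; first exact: cdiff_cont.
    by apply: cont_divc; rewrite -cabs_sub_gt0; lra.
  move/(sq_bdry_and far): fM; apply: sq_bdry_imp => z [h1 h2].
  rewrite cabsM cabsV; apply: ler_pM; rewrite ?cabs_ge0 ?invr_ge0 ?cabs_ge0 //.
  by rewrite lef_pV2 ?posrE //; lra.
rewrite (rectI_shrink s0 sr dg) in B1.
pose k z := (z - c)^-1.
have farc : on_bdry (fun z => s <= cabs (z - c) /\ cabs (z - c) <= 2 * s) (a - s) (a + s) (b - s) (b + s).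
  by apply: sq_bdry.
have inr : on_bdry (cdiff f) (a - s) (a + s) (b - s) (b + s).
  by apply: on_rect_bdry; [lra|lra|] => x y hx hy; apply: df; lra.
have cg : on_bdry (cont (fun z => (f z - f c) * k z)) (a - s) (a + s) (b - s) (b + s).
  move: (sq_bdry_and farc inr); apply: sq_bdry_imp => z [[h1 h2] h3].
  apply: contM; last by apply: cont_divc; rewrite -cabs_sub_gt0; lra.
  by apply: contB; [exact: cdiff_cont|exact: cont_cst].
have E : g = (fun z => f c * k z + (f z - f c) * k z).
  by apply/funext => z; rewrite /g /k; ring.
rewrite E rectI_lin in B1; [|move: farc; apply: sq_bdry_imp => z [h1 _]; apply: cont_divc; rewrite -cabs_sub_gt0; lra|exact: cg].
have B2 : cabs (rectI (fun z => (f z - f c) * k z) (a - s) (a + s) (b - s) (b + s)) <= 4 * e.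
  have -> : 4 * e = 4 * (e / 4 / s) * ((a + s - (a - s)) + (b + s - (b - s))) by field; rewrite gt_eqF.
  apply: rectI_bound; [lra|lra|exact: cg|].
  move: farc; apply: sq_bdry_imp => z [h1 h2].
  rewrite cabsM cabsV; apply: ler_pM; rewrite ?cabs_ge0 ?invr_ge0 ?cabs_ge0 //.
    by apply: ltW; apply: Hd; lra.
  by rewrite lef_pV2 ?posrE //; lra.
have B3 := le_trans (rectI_inv a b s0) (ler_Im _); rewrite -/c -/k in B3.
have := lerB_cabsD (f c * rectI k (a - s) (a + s) (b - s) (b + s)) (rectI (fun z => (f z - f c) * k z) (a - s) (a + s) (b - s) (b + s)).
rewrite cabsM; have := ler_wpM2l (cabs_ge0 (f c)) B3; lra.
Qed.

Lemma pow_le_limit (x M K : R) : 0 <= x -> 0 <= M -> 0 < K ->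
  (forall n, x ^+ n <= K * M ^+ n) -> x <= M.
Proof.
move=> x0 M0 K0 H; rewrite leNgt; apply/negP => Mx.
have xp : 0 < x by lra.
have [M1|M1] := leP M (x / 2).
  have [n Hn] := small_pow K (ltr01 : 0 < 1 :> R).
  have := H n; apply/negP; rewrite -ltNge.
  apply: (@le_lt_trans _ _ (K * (x / 2) ^+ n)).
    by rewrite ler_wpM2l ?(ltW K0) //; apply: lerXn2r; rewrite ?nnegrE; lra.
  rewrite expr_div_n mulrCA gtr_pMr ?exprn_gt0 //.
have Mp : 0 < M by lra.
pose t := x / M - 1.
have t0 : 0 < t by rewrite subr_gt0 ltr_pdivlMr // mul1r.
have bern n : 1 + n%:R * t <= (1 + t) ^+ n.
  elim: n => [|n IH]; first by rewrite mul0r addr0 expr0.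
  rewrite exprS -natr1; apply: (@le_trans _ _ ((1 + t) * (1 + n%:R * t))).
    by have : 0 <= n%:R * t ^+ 2 by [rewrite mulr_ge0 ?sqr_ge0]; lra.
  by rewrite ler_wpM2l //; lra.
have tE : x / M = 1 + t by rewrite /t addrC subrK.
have := archi_boundP (ltW (divr_gt0 K0 t0)); set n := Num.bound _ => Hn.
have := H n; apply/negP; rewrite -ltNge -ltr_pdivlMr ?exprn_gt0 // -expr_div_n tE.
apply: lt_le_trans (bern n); rewrite ltr_pdivrMr // in Hn; lra.
Qed.

(** The constant 4 of [square_bound4] does not depend on [f], so it disappears
    when the bound is applied to the powers of [f]. *)
Lemma square_max f a b r M : 0 < r -> 0 <= M ->
  on_rect (cdiff f) (a - r) (a + r) (b - r) (b + r) ->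
  on_bdry (fun z => cabs (f z) <= M) (a - r) (a + r) (b - r) (b + r) ->
  cabs (f (a +i* b)) <= M.
Proof.
move=> r0 M0 df fM; apply: (@pow_le_limit _ _ 4) => //; first exact: cabs_ge0.
move=> n; rewrite -cabsX; apply: (@square_bound4 (fun z => f z ^+ n) a b r) => //.
  by move=> x y hx hy; apply: cdiffX; exact: df.
move: fM; apply: sq_bdry_imp => z h; rewrite cabsX.
by apply: lerXn2r; rewrite ?nnegrE ?cabs_ge0.
Qed.

(** The boundary of the square of half-side [r] lies in this annulus. *)
Lemma ball_max f c r M : 0 < r -> 0 <= M ->
  (forall z, cabs (z - c) <= 2 * r -> cdiff f z) ->
  (forall z, r <= cabs (z - c) -> cabs (z - c) <= 2 * r -> cabs (f z) <= M) ->
  cabs (f c) <= M.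
Proof.
case: c => a b r0 M0 df fM; apply: (@square_max f a b r) => //; last exact: sq_bdry.
move=> x y hx hy; apply: df; apply: le_trans (cabs_le_ReIm _) _; rewrite complexB /=.
have : `|x - a| <= r by rewrite ler_norml; lra.
have : `|y - b| <= r by rewrite ler_norml; lra.
lra.
Qed.

End LocalMax.

(** * Compactness and the maximum principle on bounded open sets *)

Section MaxPrinciple.
Variable R : realType.
Local Notation C := R[i].
Implicit Types (f g q : C -> C) (z c : C) (S U : C -> Prop).

(** Compactness of bounded closed sets as an induction principle: a property of
    sets that is stable under subsets and unions and holds locally holds
    globally. *)
Lemma compact_ind S (Q : (C -> Prop) -> Prop) (B : R) :
  (forall z, S z -> cabs z <= B) ->
  (forall z, ~ S z -> nearC z (fun y => ~ S y)) ->
  (forall A A' : C -> Prop, (forall z, A z -> A' z) -> Q A' -> Q A) ->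
  Q (fun=> False) ->
  (forall A A' : C -> Prop, Q A -> Q A' -> Q (fun z => A z \/ A' z)) ->
  (forall a, S a -> exists2 d, 0 < d & Q (fun z => S z /\ cabs (z - a) < d)) ->
  Q S.
Proof.
move=> SB Sc Qm Q0 QU Ql.
pose P (x y w h : R) := Q (fun z => [/\ S z, x <= Re z <= x + w & y <= Im z <= y + h]).
have [B0|B0] := ltP B 0.
  apply: Qm Q0 => z /SB; have := cabs_ge0 z; lra.
suff : P (- B) (- B) (2 * B) (2 * B).
  apply: Qm => z Sz; have := normr_Re z; have := normr_Im z; have := SB z Sz.
  rewrite !ler_norml => h /andP[h1 h2] /andP[h3 h4]; split=> //; lra.
apply: cousin2; [lra|lra| |].
  move=> x y w h w0 h0 P1 P2 P3 P4.
  apply: Qm (QU _ _ (QU _ _ P1 P2) (QU _ _ P3 P4)) => z [Sz hx hy].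
  have [h1|h1] := leP (Re z) (x + w / 2); have [h2|h2] := leP (Im z) (y + h / 2).
  - by left; left; split=> //; lra.
  - by right; left; split=> //; lra.
  - by left; right; split=> //; lra.
  - by right; right; split=> //; lra.
move=> a b _ _.
have [d d0 Hd] : exists2 d, 0 < d & Q (fun z => S z /\ cabs (z - (a +i* b)) < d).
  have [Sa|nSa] := pselect (S (a +i* b)).
    exact: Ql.
  have [d d0 Hd] := Sc _ nSa; exists d => //.
  by apply: Qm Q0 => z [Sz /Hd].
exists (d / 2) => [|x y w h hw hh hx hy]; first by rewrite divr_gt0.
apply: Qm Hd => z [Sz zx zy]; split=> //.
apply: le_lt_trans (cabs_le_ReIm _) _; rewrite ReB ImB /=.
have : `|Re z - a| <= w by rewrite ler_norml; lra.
have : `|Im z - b| <= h by rewrite ler_norml; lra.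
lra.
Qed.

Lemma compact_attains S (phi : C -> R) (B : R) :
  (forall z, S z -> cabs z <= B) ->
  (forall z, ~ S z -> nearC z (fun y => ~ S y)) ->
  (forall a, S a -> forall e, 0 < e -> nearC a (fun z => S z -> phi z < phi a + e)) ->
  (exists z, S z) -> exists2 m, S m & forall z, S z -> phi z <= phi m.
Proof.
move=> SB Sc cphi [z1 Sz1]; apply: contrapT => nomax.
have up a : S a -> exists2 b, S b & phi a < phi b.
  move=> Sa; apply: contrapT => H; apply: nomax; exists a => // z Sz.
  by rewrite leNgt; apply/negP => az; apply: H; exists z.
pose Q (A : C -> Prop) := exists2 b, S b & forall z, A z -> S z -> phi z < phi b.
have : Q S.
  apply: (compact_ind (B := B)) => //.
  - by move=> A A' AA' [b Sb H]; exists b => // z /AA'; exact: H.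
  - by exists z1.
  - move=> A A' [b Sb H] [b' Sb' H'].
    have [bb|bb] := leP (phi b) (phi b').
      exists b' => // z [/H|/H'] // h /h hh; exact: lt_le_trans hh bb.
    exists b => // z [/H|/H'] // h /h hh; exact: lt_trans hh bb.
  - move=> a Sa; have [b Sb ab] := up a Sa.
    have [d d0 Hd] := cphi a Sa (phi b - phi a) ltac:(by rewrite subr_gt0).
    exists d => //; exists b => // z [Sz zd] _.
    by have := Hd z zd Sz; rewrite addrC subrK.
by move=> [b Sb H]; have := H b Sb Sb; rewrite ltxx.
Qed.

Lemma cont_sqr_weight q a (d e : R) : cont q a -> 0 < e -> 
  nearC a (fun z => `|cabs (q z) ^+ 2 * (1 + d * cabs z ^+ 2)
                     - cabs (q a) ^+ 2 * (1 + d * cabs a ^+ 2)| < e).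
Proof.
move=> cq e0.
have contcabs f : cont f a -> cont (fun z => (cabs (f z))%:C) a.
  move=> cf e' e'0; apply: near_imp (cf _ e'0) => z; apply: le_lt_trans.
  rewrite -rmorphB cabs_real ler_norml lerB_cabs andbT lerNl opprB cabsBC; exact: lerB_cabs.
have := contM (contX 2 (contcabs _ cq))
  (contD (cont_cst 1 _) (contM (cont_cst d%:C _) (contX 2 (contcabs _ (@cont_id _ a))))).
move/(_ e e0); apply: near_imp => z.
by rewrite -!rmorphXn -!rmorphM -(rmorph1 (real_complex R)) -!rmorphD -!rmorphM -rmorphB cabs_real.
Qed.

(** The defect in a Cauchy-Schwarz inequality; it makes strict the comparison
    of [1 + d * cabs z ^+ 2] with the square modulus of a holomorphic function. *)
Lemma weight_identity (d : R) z w :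
  cabs (1 + d%:C * (conjc w * z)) ^+ 2 =
  (1 + d * cabs w ^+ 2) * (1 + d * cabs z ^+ 2) - d * cabs (z - w) ^+ 2.
Proof.
rewrite !sqr_cabs; case: z => a b; case: w => x y /=; ring.
Qed.

(** If [cabs (q z)] exceeded [B], the function
    [cabs (q z) ^+ 2 * (1 + d * cabs z ^+ 2)] would, for small [d], have an
    interior maximum at some [m]. By [weight_identity] the holomorphic function
    [q z * (1 + d * conj m * z)] would then be strictly smaller on an annulus
    around [m] than at [m], against [ball_max]. *)
Theorem max_principle U q (Bd B : R) : 0 <= B ->
  (forall z, U z -> nearC z U) ->
  (forall z, U z -> cabs z <= Bd) ->
  (forall z, U z -> cdiff q z) ->
  (forall z, ~ U z -> forall e, 0 < e -> nearC z (fun y => U y -> cabs (q y) <= B + e)) ->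
  forall z, U z -> cabs (q z) <= B.
Proof.
move=> B0 Uo Ub dq bd z1 Uz1; rewrite leNgt; apply/negP => Bz.
pose t := (B + cabs (q z1)) / 2.
pose b := cabs (q z1) ^+ 2.
have t0 : 0 <= t by rewrite /t; have := cabs_ge0 (q z1); lra.
have tb : t ^+ 2 < b by rewrite ltr_pXn2r ?nnegrE ?cabs_ge0 // /t; lra.
have Bd0 : 0 <= Bd := le_trans (cabs_ge0 _) (Ub _ Uz1).
have sBd z : U z -> cabs z ^+ 2 <= Bd ^+ 2.
  by move=> Uz; rewrite ler_pXn2r ?nnegrE ?cabs_ge0 ?Ub.
have D0 : 0 < t ^+ 2 * Bd ^+ 2 + 1 by rewrite ltr_wpDl // mulr_ge0 ?sqr_ge0.
(* [d] is so small that the weight cannot compensate the gap between the level [t] near the boundary and the value at [z1]. *)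
pose d := (b - t ^+ 2) / (2 * (t ^+ 2 * Bd ^+ 2 + 1)).
have d0 : 0 < d by rewrite divr_gt0 ?subr_gt0 // mulr_gt0.
have dB : t ^+ 2 * (1 + d * Bd ^+ 2) < b.
  have dd : d * (2 * (t ^+ 2 * Bd ^+ 2 + 1)) = b - t ^+ 2 by rewrite divfK // gt_eqF // mulr_gt0.
  lra.
pose phi z := cabs (q z) ^+ 2 * (1 + d * cabs z ^+ 2).
pose S z := U z /\ phi z1 <= phi z.
have w1 z : 1 <= 1 + d * cabs z ^+ 2 by rewrite lerDl mulr_ge0 ?sqr_ge0 // ltW.
have bphi : b <= phi z1 by rewrite /phi ler_peMr ?sqr_ge0.
have [m [Um _] mS] : exists2 m, S m & forall z, S z -> phi z <= phi m.
  apply: (compact_attains (B := Bd)).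
  - by move=> z [/Ub].
  - move=> z nS; have [Uz|nU] := pselect (U z).
      have hz : phi z < phi z1 by rewrite ltNge; apply/negP => ?; apply: nS.
      have := @cont_sqr_weight q z d (phi z1 - phi z) (cdiff_cont (dq z Uz)).
      rewrite subr_gt0 => /(_ hz); apply: near_imp => y; rewrite -!/(phi _) => h [_].
      by have := ler_norm (phi y - phi z); lra.
    have tB : 0 < t - B by rewrite /t; lra.
    apply: near_imp (bd z nU _ tB) => y Hy [Uy].
    have {}Hy : cabs (q y) <= t by have := Hy Uy; lra.
    suff : phi y < phi z1 by lra.
    apply: lt_le_trans bphi; apply: le_lt_trans dB.
    apply: ler_pM; rewrite ?sqr_ge0 //.
    + by apply: le_trans (w1 y).
    + by rewrite ler_pXn2r ?nnegrE ?cabs_ge0.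
    + by rewrite lerD2l ler_wpM2l ?sBd // ltW.
  - move=> a [Ua _] e e0; apply: near_imp (@cont_sqr_weight q a d e (cdiff_cont (dq a Ua)) e0).
    by move=> y; rewrite -!/(phi _) => h _; have := ler_norm (phi y - phi a); lra.
  - by exists z1; split.
have {}mS z : U z -> phi z <= phi m.
  move=> Uz; have [h|h] := leP (phi z1) (phi z); first exact: mS.
  by apply: ltW; apply: lt_le_trans h _; apply: mS.
have pm : 0 < phi m.
  by apply: lt_le_trans (mS _ Uz1); apply: lt_le_trans bphi; apply: le_lt_trans tb; rewrite sqr_ge0.
have qm : 0 < cabs (q m).
  rewrite lt_def cabs_ge0 andbT; apply: contraTneq pm => h.
  by rewrite /phi h expr0n mul0r ltxx.
have [rho rho0 Hrho] := Uo m Um.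
pose r := rho / 3.
have r0 : 0 < r by rewrite divr_gt0.
have inU z : cabs (z - m) <= 2 * r -> U z by move=> h; apply: Hrho; rewrite /r in h; lra.
pose W := 1 + d * cabs m ^+ 2.
pose f z := q z * (1 + d%:C * (conjc m * z)).
pose Y := cabs (q m) * W.
have W1 : 1 <= W := w1 m.
have Xm : 1 <= (1 + d * Bd ^+ 2) ^+ 2.
  have : 0 <= d * Bd ^+ 2 by rewrite mulr_ge0 ?sqr_ge0 // ltW.
  by move=> dB0; apply: exprn_ege1; lra.
(* The relative gain on the annulus, where [cabs (z - m)] is at least [r]. *)
pose k := Num.min 1 (d * r ^+ 2 / (1 + d * Bd ^+ 2) ^+ 2).
have X0 : 0 < (1 + d * Bd ^+ 2) ^+ 2 by lra.
have k0 : 0 < k.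
  by rewrite lt_min ltr01 /=; apply: divr_gt0 => //; rewrite mulr_gt0 ?exprn_gt0.
have k1 : k <= 1 by rewrite ge_min lexx.
have kE : k * (1 + d * Bd ^+ 2) ^+ 2 <= d * r ^+ 2.
  by rewrite -ler_pdivlMr // ge_min lexx orbT.
have Y0 : 0 < Y by rewrite mulr_gt0 //; lra.
have fm : cabs (f m) = Y.
  rewrite /f cabsM; congr (_ * _).
  have -> : 1 + d%:C * (conjc m * m) = W%:C.
    rewrite /W sqr_cabs; case: (m) => x y.
    by apply/eqP; rewrite eq_complex /=; apply/andP; split; apply/eqP; ring.
  by rewrite cabs_pos //; lra.
suff : Y <= Y * (1 - k / 2) by have := mulr_gt0 Y0 k0; lra.
rewrite -{1}fm; apply: (@ball_max _ f m r) => //.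
- by rewrite mulr_ge0 //; lra.
- move=> z hz; apply: cdiffM; first by apply: dq; exact: inU.
  apply: cdiffD; first exact: cdiff_cst.
  apply: cdiffM; first exact: cdiff_cst.
  by apply: cdiffM; [exact: cdiff_cst|exact: cdiff_id].
- move=> z rz hz; have Uz := inU z hz.
  rewrite -(@ler_pXn2r _ 2) ?nnegrE ?cabs_ge0 ?mulr_ge0 //; try lra.
  rewrite /f cabsM exprMn weight_identity -/W.
  have zr : r ^+ 2 <= cabs (z - m) ^+ 2 by rewrite ler_pXn2r ?nnegrE ?cabs_ge0 // ltW.
  have Wz := w1 z; set Z := 1 + d * cabs z ^+ 2 in Wz *.
  have WZ : W * Z <= (1 + d * Bd ^+ 2) ^+ 2.
    rewrite expr2; apply: ler_pM; try lra; rewrite lerD2l ler_wpM2l ?sBd //; lra.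
  have h1 : W * Z - d * cabs (z - m) ^+ 2 <= W * Z * (1 - k).
    have : d * r ^+ 2 <= d * cabs (z - m) ^+ 2 by rewrite ler_wpM2l // ltW.
    have : k * (W * Z) <= k * (1 + d * Bd ^+ 2) ^+ 2 by rewrite ler_wpM2l // ltW.
    lra.
  apply: (@le_trans _ _ (cabs (q z) ^+ 2 * (W * Z * (1 - k)))).
    by rewrite ler_wpM2l ?sqr_ge0.
  apply: (@le_trans _ _ (phi m * W * (1 - k))).
    have -> : cabs (q z) ^+ 2 * (W * Z * (1 - k)) = phi z * W * (1 - k) by rewrite /phi -/Z; ring.
    by do 2 (apply: ler_wpM2r; first lra); exact: mS.
  have -> : phi m * W = Y ^+ 2 by rewrite /phi /Y -/W; ring.
  rewrite [leRHS]exprMn; apply: ler_wpM2l; first exact: sqr_ge0.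
  have := sqr_ge0 k; lra.
Qed.

(** Boundary points where [q] is merely bounded do not matter if a holomorphic
    [chi] vanishes there: apply the maximum principle to [q ^+ n * chi] and let
    [n] grow. *)
Theorem max_principle_except U q chi (Bd B D : R) : 0 <= B ->
  (forall z, U z -> nearC z U) ->
  (forall z, U z -> cabs z <= Bd) ->
  (forall z, U z -> cdiff q z) ->
  (forall z, cdiff chi z) -> (forall z, U z -> chi z != 0) ->
  (forall z, U z -> cabs (chi z) <= D) ->
  (forall z, ~ U z -> 
     (forall e, 0 < e -> nearC z (fun y => U y -> cabs (q y) <= B + e)) \/
     (chi z = 0 /\ exists K, nearC z (fun y => U y -> cabs (q y) <= K))) ->
  forall z, U z -> cabs (q z) <= B.
Proof.
move=> B0 Uo Ub dq dchi chi0 chiD bd z Uz.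
have cz : 0 < cabs (chi z) by rewrite cabs_gt0 chi0.
have D0 : 0 < D by apply: lt_le_trans cz (chiD z Uz).
apply/ler_addgt0Pr => e e0.
apply: (@pow_le_limit _ _ _ (D / cabs (chi z))); rewrite ?cabs_ge0 ?divr_gt0 //; first lra.
move=> n; rewrite mulrAC ler_pdivlMr // -cabsX -cabsM.
have P0 : 0 <= (B + e) ^+ n by rewrite exprn_ge0 //; lra.
apply: (@max_principle U (fun z => q z ^+ n * chi z) Bd) => //.
- by rewrite mulr_ge0 // ltW.
- by move=> y Uy; apply: cdiffM => //; apply: cdiffX; exact: dq.
- move=> y nU e' e'0; case: (bd y nU) => [H|[c0 [K HK]]].
    apply: near_imp (H e e0) => x Hx Ux; rewrite cabsM cabsX mulrC.
    apply: le_trans (_ : D * (B + e) ^+ n <= _); last by rewrite lerDl ltW.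
    apply: ler_pM; rewrite ?exprn_ge0 ?cabs_ge0 ?chiD //.
    by apply: lerXn2r; rewrite ?nnegrE ?cabs_ge0 ?Hx //; lra.
  pose K' := `|K| + 1.
  have K'0 : 0 < K' by rewrite /K'; have := normr_ge0 K; lra.
  have e2 : 0 < e' / K' ^+ n by rewrite divr_gt0 // exprn_gt0.
  apply: near_imp (near_and HK (cdiff_cont (dchi y) e2)) => x [Hx].
  rewrite c0 subr0 ltr_pdivlMr ?exprn_gt0 // => hx Ux.
  rewrite cabsM cabsX mulrC.
  apply: le_trans (_ : e' <= _); last by rewrite lerDr mulr_ge0 // ltW.
  apply: le_trans (ltW hx); rewrite ler_wpM2l ?cabs_ge0 //.
  apply: lerXn2r; rewrite ?nnegrE ?cabs_ge0 ?(ltW K'0) //.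
  by apply: le_trans (Hx Ux) _; rewrite /K'; have := ler_norm K; lra.
Qed.

End MaxPrinciple.

(** * Removable singularities, limits, derivatives and injective functions *)

Section HolomorphicTheory.
Variable R : realType.
Local Notation C := R[i].
Implicit Types (f g q : C -> C) (a k z w c l : C) (r M B K : R).

Lemma near_far a r z : r < cabs (z - a) -> nearC z (fun y => r < cabs (y - a)).
Proof.
move=> zr; exists (cabs (z - a) - r); first by rewrite subr_gt0.
move=> y yz; have := ler_cabs_dist y z a; rewrite (cabsBC z y); lra.
Qed.

Lemma near_le_cont f z B e : cont f z -> cabs (f z) <= B -> 0 < e ->
  nearC z (fun y => cabs (f y) <= B + e).
Proof.
move=> cf fB e0; apply: near_imp (cf e e0) => y h; have := lerB_cabs (f y) (f z); lra.
Qed.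

Lemma near_lt_cont f z B : cont f z -> cabs (f z) < B -> nearC z (fun y => cabs (f y) < B).
Proof.
move=> cf fB; have e0 : 0 < B - cabs (f z) by lra.
by apply: near_imp (cf _ e0) => y h; have := lerB_cabs (f y) (f z); lra.
Qed.

Lemma cdiff_shift k z : cdiff (fun z => z - k) z.
Proof. by apply: cdiffB; [exact: cdiff_id|exact: cdiff_cst]. Qed.

Lemma max_ball_except a r q k B : 0 <= B ->
  (forall z, cabs (z - a) < r -> z != k -> cdiff q z) ->
  (exists K, nearC k (fun y => y != k -> cabs (q y) <= K)) ->
  (forall z, cabs (z - a) = r -> z != k -> cont q z /\ cabs (q z) <= B) ->
  forall z, cabs (z - a) < r -> z != k -> cabs (q z) <= B.
Proof.
move=> B0 dq [K HK] bd z za zk.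
have ab y : cabs (y - a) < r -> cabs y <= r + cabs a.
  by move=> h; have := ler_cabsD (y - a) a; rewrite subrK; lra.
apply: (@max_principle_except _ (fun z => cabs (z - a) < r /\ z != k) q (fun z => z - k)
  (r + cabs a) B (r + cabs a + cabs k)) => //.
- by move=> y [ya yk]; apply: near_and; [exact: near_ball|exact: near_neq].
- by move=> y [/ab].
- by move=> y [ya yk]; exact: dq.
- by move=> y; exact: cdiff_shift.
- by move=> y [ya yk]; rewrite subr_eq0.
- by move=> y [/ab ya _]; have := ler_cabsB y k; lra.
move=> y nU; have [->|yk] := eqVneq y k.
  right; split; first by rewrite subrr.
  by exists K; apply: near_imp HK => x h [_ xk]; exact: h.
left=> e e0; have [h|h|h] := ltgtP (cabs (y - a)) r.
- by exfalso; apply: nU; split.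
- by apply: near_imp (near_far h) => x hx [hx']; lra.
- have [cq qB] := bd y h yk.
  by apply: near_imp (near_le_cont cq qB e0) => x ? _.
Qed.

Lemma max_ball a r q B : 0 <= B ->
  (forall z, cabs (z - a) < r -> cdiff q z) ->
  (forall z, cabs (z - a) = r -> cont q z /\ cabs (q z) <= B) ->
  forall z, cabs (z - a) < r -> cabs (q z) <= B.
Proof.
move=> B0 dq bd z za.
apply: (@max_principle _ (fun z => cabs (z - a) < r) q (r + cabs a) B) => //.
- by move=> y ya; exact: near_ball.
- by move=> y h; have := ler_cabsD (y - a) a; rewrite subrK; lra.
move=> y nU e e0; have [h|h|h] := ltgtP (cabs (y - a)) r.
- by [].
- by apply: near_imp (near_far h) => x hx hx'; lra.
- have [cq qB] := bd y h.
  by apply: near_imp (near_le_cont cq qB e0) => x ? _.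
Qed.

(** The maximum principle for the difference quotient [(q z - q k) / (z - k)],
    which is bounded near [k] by differentiability and near [a] because [q] is. *)
Lemma punctured_lipschitz q a r M : 
  (forall z, cabs (z - a) < r -> z != a -> cdiff q z) ->
  (forall z, cabs (z - a) < r -> z != a -> cabs (q z) <= M) ->
  forall z k, cabs (z - a) < r -> z != a -> cabs (k - a) < r / 2 -> k != a ->
  cabs (q z - q k) <= 4 * M / r * cabs (z - k).
Proof.
move=> dq qM z k za zna ka kna.
have [->|zk] := eqVneq z k; first by rewrite !subrr cabs0 mulr0.
have r0 : 0 < r by have := cabs_ge0 (z - a); lra.
have M0 : 0 <= M by apply: le_trans (qM z za zna); exact: cabs_ge0.
have kr : cabs (k - a) < r by lra.
pose d y := (q y - q k) / (y - k).
rewrite -ler_pdivrMr ?cabs_sub_gt0 // -cabs_div -/(d z).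
have ab y : cabs (y - a) < r -> cabs y <= r + cabs a.
  by move=> h; have := ler_cabsD (y - a) a; rewrite subrK; lra.
have d2 y : cabs (y - a) < r -> y != a -> cabs (q y - q k) <= 2 * M.
  move=> h1 h2; apply: le_trans (ler_cabsB _ _) _.
  by have := qM y h1 h2; have := qM k kr kna; lra.
apply: (@max_principle_except _ (fun z => [/\ cabs (z - a) < r, z != a & z != k]) d
   (fun z => (z - a) * (z - k)) (r + cabs a) _ (r * (2 * r))) => //.
- by rewrite divr_ge0 ?mulr_ge0 // ltW.
- move=> y [h1 h2 h3]; apply: near_imp (near_and (near_ball h1) (near_and (near_neq h2) (near_neq h3))).
  by move=> x [? []].
- by move=> y [/ab].
- move=> y [h1 h2 h3]; apply: cdiff_div; last by rewrite subr_eq0.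
    by apply: cdiffB; [exact: dq|exact: cdiff_cst].
  exact: cdiff_shift.
- by move=> y; apply: cdiffM; exact: cdiff_shift.
- by move=> y [h1 h2 h3]; rewrite mulf_neq0 ?subr_eq0.
- move=> y [h1 h2 h3]; rewrite cabsM; apply: ler_pM; rewrite ?cabs_ge0 ?(ltW h1) //.
  by have := ler_cabs_dist a y k; rewrite (cabsBC a k); lra.
move=> y nU; have [->|ya] := eqVneq y a.
  right; split; first by rewrite subrr mul0r.
  have ak : 0 < cabs (a - k) by rewrite cabs_sub_gt0 eq_sym.
  exists (2 * M / (cabs (a - k) / 2)).
  have half : cabs (a - k) / 2 < cabs (a - k) by lra.
  apply: near_imp (near_far half) => x hx [h1 h2 h3].
  rewrite /d cabs_div; apply: ler_pM; rewrite ?cabs_ge0 ?invr_ge0 ?cabs_ge0 ?d2 //.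
  by rewrite lef_pV2 ?posrE; lra.
have [->|yk] := eqVneq y k.
  right; split; first by rewrite subrr mulr0.
  have [l hl] := dq k kr kna; exists (cabs l + 1).
  apply: near_imp (cont_near_bd hl) => x; rewrite dqvaa /dqv => H [_ _ xk].
  by move: H; rewrite (negbTE xk).
left=> e e0.
have yr : r <= cabs (y - a) by rewrite leNgt; apply/negP => h; apply: nU; split.
have yk2 : r / 2 < cabs (y - k) by have := ler_cabs_dist k y a; lra.
apply: near_imp (near_far yk2) => x hx [h1 h2 h3].
apply: (@le_trans _ _ (4 * M / r)); last by rewrite lerDl ltW.
have -> : 4 * M / r = 2 * M / (r / 2) by field; rewrite gt_eqF.
rewrite /d cabs_div; apply: ler_pM; rewrite ?cabs_ge0 ?invr_ge0 ?cabs_ge0 ?d2 //.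
by rewrite lef_pV2 ?posrE; lra.
Qed.

(** A Lipschitz function has a limit at a missing point: the infimal cone above
    it provides the value. *)
Lemma mcshane (u : C -> R) a r K : 0 < r -> 0 <= K ->
  (forall z k, cabs (z - a) < r -> z != a -> cabs (k - a) < r -> k != a ->
     `|u z - u k| <= K * cabs (z - k)) ->
  exists s, forall z, cabs (z - a) < r -> z != a -> `|u z - s| <= K * cabs (z - a).
Proof.
move=> r0 K0 H.
pose E : set R := [set t | exists z, [/\ cabs (z - a) < r, z != a & t = u z - K * cabs (z - a)]].
have ub z t : cabs (z - a) < r -> z != a -> E t -> t <= u z + K * cabs (z - a).
  move=> za zna [y [ya yna ->]].
  have := H y z ya yna za zna; have := ler_norm (u y - u z).
  have := ler_wpM2l K0 (ler_cabs_dist a y z); rewrite (cabsBC a z); lra.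
have k0 : cabs (a + (r / 2)%:C - a) < r.
  by rewrite addrAC subrr add0r cabs_pos; lra.
have k1 : a + (r / 2)%:C != a.
  by rewrite -cabs_sub_gt0 addrAC subrr add0r cabs_pos; lra.
exists (sup E) => z za zna; rewrite ler_norml; apply/andP; split.
  suff : sup E <= u z + K * cabs (z - a) by lra.
  apply: ge_sup; last by move=> t; exact: ub.
  by exists (u z - K * cabs (z - a)); exists z.
suff : u z - K * cabs (z - a) <= sup E by lra.
apply: ub_le_sup; last by exists z.
by exists (u z + K * cabs (z - a)) => t; exact: ub.
Qed.

Lemma lip_ext q a r K : 0 < r -> 0 <= K ->
  (forall z k, cabs (z - a) < r -> z != a -> cabs (k - a) < r -> k != a ->
     cabs (q z - q k) <= K * cabs (z - k)) ->
  exists l, forall z, cabs (z - a) < r -> z != a -> cabs (q z - l) <= 2 * K * cabs (z - a).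
Proof.
move=> r0 K0 H.
have [x Hx] := @mcshane (fun z => Re (q z)) a r K r0 K0 (fun z k h1 h2 h3 h4 =>
  le_trans (eq_ind _ (fun t => `|t| <= _) (normr_Re (q z - q k)) _ (ReB _ _)) (H z k h1 h2 h3 h4)).
have [y Hy] := @mcshane (fun z => Im (q z)) a r K r0 K0 (fun z k h1 h2 h3 h4 =>
  le_trans (eq_ind _ (fun t => `|t| <= _) (normr_Im (q z - q k)) _ (ImB _ _)) (H z k h1 h2 h3 h4)).
exists (x +i* y) => z za zna; apply: le_trans (cabs_le_ReIm _) _.
by rewrite ReB ImB /=; have := Hx z za zna; have := Hy z za zna; lra.
Qed.

Lemma lip_cont q a r K l : 0 < r ->
  (forall z, cabs (z - a) < r -> z != a -> cabs (q z - l) <= K * cabs (z - a)) ->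
  cont (fun z => if z == a then l else q z) a.
Proof.
move=> r0 H e e0; pose K' := `|K| + 1.
have K'0 : 0 < K' by rewrite /K'; have := normr_ge0 K; lra.
exists (Num.min r (e / K')); first by rewrite lt_min r0 divr_gt0.
move=> z; rewrite lt_min => /andP[h1 h2]; rewrite eqxx.
case: eqVneq => [_|za]; first by rewrite subrr cabs0.
apply: le_lt_trans (H z h1 za) _.
rewrite ltr_pdivlMr // in h2; rewrite mulrC; apply: le_lt_trans h2.
by rewrite ler_wpM2l ?cabs_ge0 // /K'; have := ler_norm K; lra.
Qed.

Lemma has_der_of_lip f a l r K : 0 < r ->
  (forall z, cabs (z - a) < r -> z != a -> cabs ((f z - f a) / (z - a) - l) <= K * cabs (z - a)) ->
  has_der f a l.
Proof. by move=> r0 H; apply: lip_cont r0 H. Qed.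

(** The function is Lipschitz near the puncture, hence extends; its difference
    quotient at the puncture is holomorphic and bounded, hence extends as well,
    and this extension is the derivative. *)
Theorem removable q a r M : 0 < r -> 
  (forall z, cabs (z - a) < r -> z != a -> cdiff q z) ->
  (forall z, cabs (z - a) < r -> z != a -> cabs (q z) <= M) ->
  exists l, cdiff (fun z => if z == a then l else q z) a.
Proof.
move=> r0 dq qM.
have M0 : 0 <= M.
  apply: le_trans (cabs_ge0 (q (a + (r / 2)%:C))) (qM _ _ _); last rewrite -cabs_sub_gt0.
    by rewrite addrAC subrr add0r cabs_pos; lra.
  by rewrite addrAC subrr add0r cabs_pos; lra.
have L1 := punctured_lipschitz dq qM; set L := 4 * M / r in L1.
have L0 : 0 <= L by rewrite /L divr_ge0 ?mulr_ge0 // ltW.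
have r2 : 0 < r / 2 by lra.
have [l Hl] := @lip_ext q a (r / 2) L r2 L0 (fun z k h1 h2 h3 h4 => L1 z k ltac:(lra) h2 h3 h4).
exists l; pose D z := (q z - l) / (z - a).
have dD z : cabs (z - a) < r / 2 -> z != a -> cdiff D z.
  move=> h1 h2; apply: cdiff_div; [|exact: cdiff_shift|by rewrite subr_eq0].
  by apply: cdiffB; [apply: dq => //; lra|exact: cdiff_cst].
have bD z : cabs (z - a) < r / 2 -> z != a -> cabs (D z) <= 2 * L.
  by move=> h1 h2; rewrite /D cabs_div ler_pdivrMr ?cabs_sub_gt0 //; exact: Hl.
have L2 := punctured_lipschitz dD bD; set L' := 4 * (2 * L) / (r / 2) in L2.
have L'0 : 0 <= L' by apply: divr_ge0; [do 2 apply: mulr_ge0 => //|exact: ltW].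
have r4 : 0 < r / 2 / 2 by lra.
have [l' Hl'] := @lip_ext D a (r / 2 / 2) L' r4 L'0 (fun z k h1 h2 h3 h4 => L2 z k ltac:(lra) h2 h3 h4).
exists l'; apply: (@has_der_of_lip _ _ _ (r / 2 / 2) (2 * L')) => // z za zna.
by rewrite eqxx (negbTE zna); exact: Hl'.
Qed.

Lemma cdiff_lipschitz f a r M : 0 < r ->
  (forall z, cabs (z - a) < r -> cdiff f z) ->
  (forall z, cabs (z - a) < r -> cabs (f z) <= M) ->
  forall z, cabs (z - a) < r / 2 -> cabs (f z - f a) <= 8 * M / r * cabs (z - a).
Proof.
move=> r0 df fM z za.
have aa : cabs (a - a) < r by rewrite subrr cabs0.
have M0 : 0 <= M := le_trans (cabs_ge0 _) (fM a aa).
have [->|zna] := eqVneq z a; first by rewrite !subrr cabs0 mulr0.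
have L1 := punctured_lipschitz (fun z h _ => df z h) (fun z h _ => fM z h).
set L := 4 * M / r in L1.
have L0 : 0 <= L by rewrite /L divr_ge0 ?mulr_ge0 // ltW.
have r2 : 0 < r / 2 by lra.
have [l Hl] := @lip_ext f a (r / 2) L r2 L0 (fun z k h1 h2 h3 h4 => L1 z k ltac:(lra) h2 h3 h4).
suff -> : f a = l by apply: le_trans (Hl z za zna) _; rewrite /L; lra.
have := cont_uniq (cdiff_cont (df a aa)) (lip_cont r2 Hl); rewrite eqxx; apply.
by apply: near_all => y /negbTE ->.
Qed.

(** The estimate contains no derivative and no limit: it involves three values
    of [f] only, so it passes to pointwise limits. *)
Lemma cdiff_dd_lipschitz f a r M : 0 < r ->
  (forall z, cabs (z - a) < r -> cdiff f z) ->
  (forall z, cabs (z - a) < r -> cabs (f z) <= M) ->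
  forall z k, cabs (z - a) < r / 4 -> z != a -> cabs (k - a) < r / 4 -> k != a ->
  cabs ((f z - f a) / (z - a) - (f k - f a) / (k - a)) <= 64 * M / r ^+ 2 * cabs (z - k).
Proof.
move=> r0 df fM z k za zna ka kna.
have H := @punctured_lipschitz (fun z => (f z - f a) / (z - a)) a (r / 2) (8 * M / r).
have -> : 64 * M / r ^+ 2 = 4 * (8 * M / r) / (r / 2) by field; rewrite gt_eqF.
apply: H => //; try lra.
  move=> y h1 h2; apply: cdiff_div; [|exact: cdiff_shift|by rewrite subr_eq0].
  by apply: cdiffB; [apply: df => //; lra|exact: cdiff_cst].
move=> y h1 h2; rewrite cabs_div ler_pdivrMr ?cabs_sub_gt0 //.
exact: cdiff_lipschitz df fM _ h1.
Qed.

(** Three points at a time suffice, because differentiability at [a] follows from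
    the three-point estimate [cdiff_dd_lipschitz]. *)
Theorem cdiff_limit f a r M : 0 < r ->
  (forall z k, cabs (z - a) < r -> cabs (k - a) < r -> forall e, 0 < e -> 
     exists g, [/\ forall y, cabs (y - a) < r -> cdiff g y,
       forall y, cabs (y - a) < r -> cabs (g y) <= M &
       [/\ cabs (g a - f a) < e, cabs (g z - f z) < e & cabs (g k - f k) < e]]) ->
  cdiff f a.
Proof.
move=> r0 H.
have aa : cabs (a - a) < r by rewrite subrr cabs0.
have M0 : 0 <= M.
  have [g [_ gM _]] := H a a aa aa 1 ltr01.
  exact: le_trans (cabs_ge0 _) (gM a aa).
pose D z := (f z - f a) / (z - a).
have r4 : 0 < r / 4 by lra.
pose K := 64 * M / r ^+ 2.
have K0 : 0 <= K by apply: divr_ge0; [apply: mulr_ge0 => //; exact: ler0n|exact: sqr_ge0].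
have LD z k : cabs (z - a) < r / 4 -> z != a -> cabs (k - a) < r / 4 -> k != a ->
   cabs (D z - D k) <= K * cabs (z - k).
  move=> za zna ka kna; apply/ler_addgt0Pr => e e0.
  have zp : 0 < cabs (z - a) by rewrite cabs_sub_gt0.
  have kp : 0 < cabs (k - a) by rewrite cabs_sub_gt0.
  pose m := Num.min (cabs (z - a)) (cabs (k - a)).
  have m0 : 0 < m by rewrite lt_min zp.
  have mz : m <= cabs (z - a) by rewrite ge_min lexx.
  have mk : m <= cabs (k - a) by rewrite ge_min lexx orbT.
  have e'0 : 0 < e * m / 4 by rewrite divr_gt0 // mulr_gt0.
  have [g [dg gM [ga gz gk]]] := H z k ltac:(lra) ltac:(lra) _ e'0.
  have := cdiff_dd_lipschitz r0 dg gM za zna ka kna; rewrite -/K => HK.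
  have err y : cabs (g y - f y) < e * m / 4 -> m <= cabs (y - a) ->
     cabs (D y - (g y - g a) / (y - a)) <= e / 2.
    move=> gy my; have yp : 0 < cabs (y - a) by lra.
    have ya : y - a != 0 by rewrite -cabs_gt0.
    have -> : D y - (g y - g a) / (y - a) = ((g a - f a) - (g y - f y)) / (y - a).
      by rewrite /D; field.
    rewrite cabs_div ler_pdivrMr //; apply: le_trans (ler_cabsB _ _) _.
    have : e / 2 * m <= e / 2 * cabs (y - a) by rewrite ler_wpM2l //; lra.
    lra.
  have := err z gz mz; have := err k gk mk.
  set Gz := (g z - g a) / (z - a) in HK *; set Gk := (g k - g a) / (k - a) in HK *.
  have -> : D z - D k = (D z - Gz) + (Gz - Gk) - (D k - Gk) by ring.
  move=> h1 h2; apply: le_trans (ler_cabsB _ _) _.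
  have := ler_cabsD (D z - Gz) (Gz - Gk); lra.
have [l Hl] := lip_ext r4 K0 LD.
by exists l; exact: has_der_of_lip r4 Hl.
Qed.

Definition der f a : C := xget 0 [set l | has_der f a l].

Lemma der_spec f a : cdiff f a -> has_der f a (der f a).
Proof. by move=> [l hl]; apply: (@xgetPex _ _ [set l | has_der f a l]); exists l. Qed.

Lemma has_der_der f a l : has_der f a l -> der f a = l.
Proof. by move=> hl; apply: has_der_uniq (hl); apply: der_spec; exists l. Qed.

Definition dq f a := dqv f a (der f a).

Lemma dqaa f a : dq f a a = der f a. Proof. exact: dqvaa. Qed.

Lemma dqE f a z : z != a -> dq f a z = (f z - f a) / (z - a).
Proof. by move=> za; rewrite /dq /dqv (negbTE za). Qed.

Lemma dqP f a z : f z - f a = dq f a z * (z - a). Proof. exact: dqvP. Qed.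

Lemma cdiff_dq_neq f a z : z != a -> cdiff f z -> cdiff (dq f a) z.
Proof.
move=> za df; apply: (@cdiff_congr _ (fun z => (f z - f a) / (z - a))).
  by apply: near_imp (near_neq za) => y ya; rewrite dqE.
apply: cdiff_div; [|exact: cdiff_shift|by rewrite subr_eq0].
by apply: cdiffB => //; exact: cdiff_cst.
Qed.

Lemma cdiff_dq f a z : cdiff f z -> nearC a (cdiff f) -> cdiff (dq f a) z.
Proof.
move=> df [d d0 Hd]; have [->|za] := eqVneq z a; last exact: cdiff_dq_neq.
have aa : cabs (a - a) < d by rewrite subrr cabs0.
have cD : cont (dq f a) a by apply: der_spec; exact: Hd.
have [d' d'0 Hd'] := cont_near_bd cD.
pose r := Num.min d d'.
have r0 : 0 < r by rewrite lt_min d0.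
have rd : r <= d by rewrite ge_min lexx.
have rd' : r <= d' by rewrite ge_min lexx orbT.
have [l Hl] := @removable (dq f a) a r (cabs (dq f a a) + 1) r0
  (fun z h1 h2 => cdiff_dq_neq h2 (Hd z (lt_le_trans h1 rd)))
  (fun z h1 h2 => Hd' z (lt_le_trans h1 rd')).
have E : l = dq f a a.
  have := cont_uniq (cdiff_cont Hl) cD; rewrite eqxx; apply.
  by apply: near_all => y /negbTE ->.
suff -> : dq f a = (fun z => if z == a then l else dq f a z) by [].
by apply/funext => y; case: eqVneq => [->|//].
Qed.

(** The derivative is a pointwise limit of the functions
    [(f (y + h) - f y) / h], which are uniformly bounded. *)
Theorem cdiff_der f a : nearC a (cdiff f) -> cdiff (der f) a.
Proof.
move=> df; have [d d0 Hd] := near_and df (cont_near_bd (cdiff_cont (near_self df))).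
set M := cabs (f a) + 1 in Hd.
pose r := d / 4; have r0 : 0 < r by rewrite /r; lra.
apply: (@cdiff_limit _ _ r (8 * M / (2 * r)) r0) => z k za ka e e0.
have sel y : cabs (y - a) < r -> exists2 t, 0 < t & forall h : R, 0 < h < t ->
   cabs ((f (y + h%:C) - f y) / h%:C - der f y) < e.
  move=> ya; have yd : cabs (y - a) < d by rewrite /r in ya; lra.
  have [t t0 Ht] := der_spec (proj1 (Hd y yd)) e0.
  exists t => // h /andP[h0 ht]; have := Ht (y + h%:C).
  have -> : y + h%:C - y = h%:C by ring.
  rewrite cabs_pos ?(ltW h0) // => /(_ ht); rewrite dqvaa.
  have hn : (h%:C : C) != 0 by rewrite -cabs_gt0 cabs_pos // ltW.
  have hy : y + h%:C != y by rewrite -subr_eq0 addrAC subrr add0r.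
  by rewrite -/(dq f y _) dqE // addrAC subrr add0r.
have aa : cabs (a - a) < r by rewrite subrr cabs0.
have [t1 t10 H1] := sel a aa; have [t2 t20 H2] := sel z za; have [t3 t30 H3] := sel k ka.
(* One increment serves the three points. *)
pose h := Num.min (Num.min t1 t2) (Num.min t3 r) / 2.
have m0 : 0 < Num.min (Num.min t1 t2) (Num.min t3 r) by rewrite !lt_min t10 t20 t30.
have hm : h < Num.min (Num.min t1 t2) (Num.min t3 r) by rewrite /h; lra.
have h0 : 0 < h by rewrite /h; lra.
move: hm; rewrite !lt_min => /andP[/andP[ht1 ht2] /andP[ht3 hr]].
have hn : (h%:C : C) != 0 by rewrite -cabs_gt0 cabs_pos // ltW.
have yh y : cabs (y - a) < r -> cabs (y + h%:C - a) < d.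
  move=> ya; have := ler_cabs_dist y (y + h%:C) a.
  have -> : y + h%:C - y = h%:C by ring.
  by rewrite cabs_pos ?(ltW h0) //; rewrite /r in ya hr; lra.
exists (fun y => (f (y + h%:C) - f y) / h%:C); split.
- move=> y ya; apply: cdiff_div => //; last exact: cdiff_cst.
  apply: cdiffB; last by apply: (proj1 (Hd y _)); rewrite /r in ya; lra.
  apply: (@cdiff_comp _ (fun y => y + h%:C) f).
    by apply: cdiffD; [exact: cdiff_id|exact: cdiff_cst].
  by apply: (proj1 (Hd _ _)); exact: yh.
- move=> y ya; rewrite cabs_div ler_pdivrMr ?cabs_gt0 //.
  have := @cdiff_lipschitz f y (2 * r) M ltac:(lra).
  have inb w : cabs (w - y) < 2 * r -> cabs (w - a) < d.
    by move=> wy; have := ler_cabs_dist y w a; rewrite /r in wy ya; lra.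
  move=> /(_ (fun w hw => proj1 (Hd w (inb w hw))) (fun w hw => proj2 (Hd w (inb w hw)))).
  move=> /(_ (y + h%:C)); rewrite addrAC subrr add0r; apply.
  by rewrite cabs_pos ?(ltW h0) //; lra.
- by split; [apply: H1|apply: H2|apply: H3]; rewrite h0.
Qed.

(** [cousin2] on the segment from [a] to [z], the second dimension being degenerate. *)
Lemma cdiff_const f a r : (forall z, cabs (z - a) < r -> has_der f z 0) ->
  forall z, cabs (z - a) < r -> f z = f a.
Proof.
move=> df z za; apply/eqP; rewrite -subr_eq0 -cabs_eq0; apply/eqP/le_anti.
rewrite cabs_ge0 andbT; apply/ler_addgt0Pl => e e0; rewrite addr0.
pose v := z - a; pose p (t : R) := a + t%:C * v.
pose e' := e / (cabs v + 1).
have v1 : 0 < cabs v + 1 by have := cabs_ge0 v; lra.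
have e'0 : 0 < e' by rewrite divr_gt0.
have e'E : e' * cabs v <= e.
  have : e' * (cabs v + 1) = e by rewrite divfK // gt_eqF.
  lra.
have pB (s t : R) : p t - p s = (t - s)%:C * v by rewrite /p rmorphB; ring.
pose P (x y w h : R) := cabs (f (p (x + w)) - f (p x)) <= e * w.
have : P 0 0 1 0; last first.
  rewrite /P add0r mulr1.
  have -> : p 1 = z by rewrite /p rmorph1 mul1r addrC subrK.
  by have -> : p 0 = a by rewrite /p rmorph0 mul0r addr0.
apply: (@cousin2 _ P) => //.
  move=> x y w h _ _ P1 P2 _ _; rewrite /P in P1 P2 *.
  have E : x + w / 2 + w / 2 = x + w by lra.
  rewrite E in P2; apply: le_trans (ler_cabs_dist (f (p (x + w / 2))) _ _) _; lra.
move=> s b hs _; have ps : cabs (p s - a) < r.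
  rewrite /p addrAC subrr add0r cabsM cabs_pos; last lra.
  apply: le_lt_trans za; rewrite -/v ler_piMl ?cabs_ge0 //; lra.
have [d d0 Hd] := df _ ps _ e'0.
exists (d / (cabs v + 1)); first by rewrite divr_gt0.
move=> x y w h /andP[w0 wd] _ hx _; rewrite /P.
have key t : `|t - s| <= w -> cabs (f (p t) - f (p s)) <= e * `|t - s|.
  move=> ts; have tv : cabs (p t - p s) < d.
    rewrite pB cabsM cabs_real; rewrite ltr_pdivlMr // in wd.
    apply: le_lt_trans wd; apply: ler_pM; rewrite ?normr_ge0 ?cabs_ge0 //; lra.
  have := Hd _ tv; rewrite dqvaa subr0 (dqvP f (p s) 0) cabsM => h1.
  rewrite pB cabsM cabs_real mulrCA.
  apply: le_trans (_ : `|t - s| * (e' * cabs v) <= _).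
    by apply: ler_wpM2l => //; rewrite ler_wpM2r ?cabs_ge0 // ltW.
  by rewrite mulrC ler_wpM2r.
have k1 := key (x + w) ltac:(rewrite ler_norml; lra).
have k2 := key x ltac:(rewrite ler_norml; lra).
apply: le_trans (ler_cabs_dist (f (p s)) _ _) _; rewrite (cabsBC (f (p s)) (f (p x))).
rewrite ger0_norm in k1; last lra.
rewrite ler0_norm in k2; last lra.
lra.
Qed.

Section Injective.
Variables (e : C -> C) (a : C) (rho : R).
Hypotheses (rho0 : 0 < rho) (de : forall z, cabs (z - a) <= rho -> cdiff e z).
Hypothesis ie : forall z w, cabs (z - a) <= rho -> cabs (w - a) <= rho -> e z = e w -> z = w.

Let aa : cabs (a - a) <= rho. Proof. by rewrite subrr cabs0 ltW. Qed.

Lemma circle_gap : exists2 d, 0 < d & forall z, cabs (z - a) = rho -> 2 * d <= cabs (e z - e a).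
Proof.
pose S z := cabs (z - a) = rho.
have [m Sm Hm] : exists2 m, S m & forall z, S z -> - cabs (e z - e a) <= - cabs (e m - e a).
  apply: (compact_attains (B := rho + cabs a)).
  - by move=> z Sz; have := ler_cabsD (z - a) a; rewrite subrK Sz.
  - move=> z nS; have [h|h|//] := ltgtP (cabs (z - a)) rho.
      by apply: near_imp (near_ball h) => y; rewrite /S => hy hy'; lra.
    by apply: near_imp (near_far h) => y; rewrite /S => hy hy'; lra.
  - move=> z Sz e' e'0; have dz : cdiff e z by apply: de; rewrite Sz.
    apply: near_imp (cdiff_cont dz e'0) => y hy _.
    have := ler_cabs_dist (e y) (e z) (e a); rewrite (cabsBC (e z) (e y)); lra.
  - by exists (a + rho%:C); rewrite /S addrAC subrr add0r cabs_pos // ltW.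
exists (cabs (e m - e a) / 2) => [|z Sz]; last by have := Hm z Sz; lra.
rewrite divr_gt0 // cabs_sub_gt0; apply/negP => /eqP E.
have am : m = a by apply: ie => //; rewrite Sm.
by move: Sm rho0; rewrite /S am subrr cabs0 => <-; rewrite ltxx.
Qed.

(** If [e] omitted a value [w] close to [e a], the maximum principle for
    [1 / (e - w)] would contradict the gap on the circle. *)
Lemma open_image : exists2 d, 0 < d & forall w, cabs (w - e a) < d ->
  exists2 z, cabs (z - a) < rho & e z = w.
Proof.
have [d d0 Hd] := circle_gap; exists d => // w wd; apply: contrapT => nz.
have nz' z : cabs (z - a) < rho -> e z - w != 0.
  by move=> za; rewrite subr_eq0; apply/negP => /eqP ezw; apply: nz; exists z.
have circ z : cabs (z - a) = rho -> d <= cabs (e z - w).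
  by move=> /Hd h; have := ler_cabs_dist w (e z) (e a); lra.
have d'0 : 0 <= d^-1 by rewrite invr_ge0 ltW.
have := @max_ball a rho (fun z => (e z - w)^-1) d^-1 d'0 _ _ a.
rewrite subrr cabs0 => H.
have : cabs ((e a - w)^-1) <= d^-1.
  apply: H => //.
  - move=> z za; apply: cdiffV; last exact: nz'.
    by apply: cdiffB; [apply: de; exact: ltW|exact: cdiff_cst].
  - move=> z za; have h := circ z za.
    have n0 : e z - w != 0 by rewrite -cabs_gt0; lra.
    split; last by rewrite cabsV lef_pV2 ?posrE //; lra.
    apply: contV => //; apply: contB; last exact: cont_cst.
    by apply: cdiff_cont; apply: de; rewrite za.
rewrite cabsV cabsBC lef_pV2 ?posrE // ?leNgt ?wd //.
by rewrite cabs_sub_gt0 eq_sym -subr_eq0; apply: nz'; rewrite subrr cabs0.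
Qed.

(** At a point [k] where the derivative is nonzero, [(z - k) / (e z - e k)] is
    bounded near [k], so the maximum principle bounds it by its values on the
    circle, uniformly in [k]. Such points accumulate at [a], since otherwise [e]
    would be constant nearby, and the bound passes to the limit. *)
Lemma lower_lipschitz : exists2 K, 0 < K & 
  forall z, cabs (z - a) < rho -> cabs (z - a) <= K * cabs (e z - e a).
Proof.
have [d d0 Hd] := circle_gap; pose K := 2 * rho / d.
have K0 : 0 < K by rewrite /K divr_gt0 // mulr_gt0.
exists K => // z za.
have L k : cabs (k - a) < rho -> cabs (e k - e a) < d -> der e k != 0 -> z != k ->
  cabs (z - k) <= K * cabs (e z - e k).
  move=> ka ked dk zk.
  have inj y : cabs (y - a) <= rho -> y != k -> e y - e k != 0.
    move=> ya; apply: contra_neq => /eqP; rewrite subr_eq0 => /eqP.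
    by apply: ie => //; exact: ltW.
  rewrite -ler_pdivrMr; last by rewrite cabs_gt0 inj // ltW.
  rewrite -cabs_div.
  apply: (@max_ball_except a rho (fun y => (y - k) / (e y - e k)) k) => //; first exact: ltW.
  - move=> y ya yk; apply: cdiff_div; [exact: cdiff_shift| |by apply: inj => //; exact: ltW].
    by apply: cdiffB; [apply: de; exact: ltW|exact: cdiff_cst].
  - have ck : cont (dq e k) k by apply: der_spec; apply: de; exact: ltW.
    have := contV ck; rewrite dqaa => /(_ dk) /cont_near_bd H.
    eexists; apply: near_imp H => y H yk; move: H.
    by rewrite {1}dqE // invf_div; apply.
  - move=> y ya yk; have n0 : e y - e k != 0 by apply: inj => //; rewrite ya.
    split.
      apply: contM; first by apply: cdiff_cont; exact: cdiff_shift.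
      apply: contV => //; apply: contB; last exact: cont_cst.
      by apply: cdiff_cont; apply: de; rewrite ya.
    have h1 : d <= cabs (e y - e k).
      by have := Hd y ya; have := ler_cabs_dist (e k) (e y) (e a); lra.
    rewrite cabs_div; apply: ler_pM; rewrite ?cabs_ge0 ?invr_ge0 ?cabs_ge0 //.
      by have := ler_cabs_dist a y k; rewrite (cabsBC a k); lra.
    by rewrite lef_pV2 ?posrE //; lra.
have dense s : 0 < s -> exists2 k, cabs (k - a) < s & der e k != 0.
  move=> s0; apply: contrapT => H.
  pose s' := Num.min s rho; have s'0 : 0 < s' by rewrite lt_min s0.
  have s's : s' <= s by rewrite ge_min lexx.
  have s'r : s' <= rho by rewrite ge_min lexx orbT.
  pose y := a + (s' / 2)%:C.
  have ya : cabs (y - a) = s' / 2 by rewrite /y addrAC subrr add0r cabs_pos; lra.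
  have /ie : e y = e a.
    apply: (@cdiff_const e a s'); last by rewrite ya; lra.
    move=> k ks; have := der_spec (de (ltW (lt_le_trans ks s'r))).
    suff -> : der e k = 0 by [].
    by apply/eqP; apply/negP => /negP dk; apply: H; exists k => //; lra.
  rewrite ya => /(_ ltac:(lra) aa) ya'; move: ya; rewrite ya' subrr cabs0; lra.
have [->|zna] := eqVneq z a; first by rewrite subrr cabs0 mulr_ge0 ?cabs_ge0 // ltW.
apply/ler_addgt0Pr => t t0.
have m0 : 0 < Num.min d (t / (2 * K)) by rewrite lt_min d0 divr_gt0 // mulr_gt0.
have [s s0 Hs] := cdiff_cont (de aa) m0.
have za0 : 0 < cabs (z - a) by rewrite cabs_sub_gt0.
have [k ks dk] := dense (Num.min (Num.min s rho) (Num.min (t / 2) (cabs (z - a))))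
  ltac:(by rewrite !lt_min s0 rho0 za0 divr_gt0).
move: ks; rewrite !lt_min => /andP[/andP[ks kr] /andP[kt kz]].
have := Hs k ks; rewrite lt_min => /andP[kd kK].
have zk : z != k by apply: contraTneq kz => ->; rewrite ltxx.
have K2 : 0 < 2 * K by rewrite mulr_gt0.
have := L k kr kd dk zk; rewrite ltr_pdivlMr // in kK.
have := ler_cabs_dist k z a; have := ler_wpM2l (ltW K0) (ler_cabs_dist (e a) (e z) (e k)).
rewrite (cabsBC (e a) (e k)); lra.
Qed.

Lemma injective_der_neq0 : der e a != 0.
Proof.
have [K K0 HK] := lower_lipschitz; apply/negP => /eqP d0.
have K2 : 0 < (2 * K)^-1 by rewrite invr_gt0 mulr_gt0.
have [s s0 Hs] := der_spec (de aa) K2.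
pose t := Num.min s rho / 2.
have t0 : 0 < t by rewrite divr_gt0 // lt_min s0.
have ts : t < s by have : Num.min s rho <= s by [rewrite ge_min lexx]; rewrite /t; have : 0 < Num.min s rho by [rewrite lt_min s0]; lra.
have tr : t < rho by have : Num.min s rho <= rho by [rewrite ge_min lexx orbT]; rewrite /t; have : 0 < Num.min s rho by [rewrite lt_min s0]; lra.
pose z := a + t%:C.
have za : cabs (z - a) = t by rewrite /z addrAC subrr add0r cabs_pos // ltW.
have := HK z; have := Hs z; rewrite -/(dq e a) za dqaa d0 subr0 dqP cabsM za.
move=> /(_ ts) h1 /(_ tr) h2.
have := ler_wpM2l (ltW K0) (ltW h1).
have -> : K * (2 * K)^-1 = 2^-1 by field; rewrite gt_eqF.
nra.
Qed.

Lemma inverse_has_der g : (forall z, cabs (z - a) < rho -> g (e z) = z) ->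
  has_der g (e a) (der e a)^-1.
Proof.
move=> ge; have [K K0 HK] := lower_lipschitz.
have [d d0 Hd] := open_image.
have ga : g (e a) = a by apply: ge; rewrite subrr cabs0.
have cg : cont g (e a).
  move=> s s0; exists (Num.min d (s / K)); first by rewrite lt_min d0 divr_gt0.
  move=> w; rewrite lt_min => /andP[/Hd[z za <-]].
  by rewrite ltr_pdivlMr // mulrC ga ge // => h; apply: le_lt_trans (HK z za) h.
have := @has_derI R g (e a) (fun w => (dq e a (g w))^-1); rewrite ga dqaa; apply.
  apply: (@cont_comp _ g (fun z => (dq e a z)^-1)) => //; rewrite ga.
  by apply: contV; [apply: der_spec; exact: de|rewrite dqaa; exact: injective_der_neq0].
exists d => // w /Hd[z za <-]; rewrite ge // dqP.
have [->|zna] := eqVneq z a; first by rewrite !subrr !mulr0.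
rewrite mulKf //; rewrite dqE // mulf_neq0 ?invr_eq0 ?subr_eq0 //.
by apply: contra_neq zna; apply: ie => //; exact: ltW.
Qed.

End Injective.

End HolomorphicTheory.

(** * The reciprocal of a concave function with pole at 0 *)

Section Reciprocal.
Variable R : realType.
Local Notation C := R[i].
Implicit Types (z w k c : C) (r d : R).

Lemma cabs_inv_sub z w : z != 0 -> w != 0 ->
  cabs (z^-1 - w) = cabs w * cabs (w^-1 - z) / cabs z.
Proof.
by move=> z0 w0; rewrite -cabsM -cabs_div; congr cabs; field; rewrite z0.
Qed.

Lemma Re_inv_ge0 z : 0 <= Re z -> 0 <= Re z^-1.
Proof.
by case: z => a b /= a0; rewrite divr_ge0 // addr_ge0 ?sqr_ge0.
Qed.

(** The Cayley transform maps the right half-plane to the unit disc. *)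
Lemma Re_ge0_dist z : (0 <= Re z) = (cabs (z - 1) <= cabs (z + 1)).
Proof.
rewrite -[RHS](@ler_pXn2r _ 2) ?nnegrE ?cabs_ge0 // !sqr_cabs ReB ReD ImB ImD /=.
by apply/idP/idP => h; lra.
Qed.

(** A curve that does not enter the disc through [h 0] leaves [h 0] in an outward
    direction. *)
Lemma outward_derivative (h : C -> C) l (tau : R) : has_der h 0 l -> h 0 != 0 -> 0 < tau ->
  (forall t : R, 0 < t < tau -> cabs (h 0) <= cabs (h t%:C)) -> 0 <= Re (l / h 0).
Proof.
move=> hl h0 tau0 H; rewrite leNgt; apply/negP => neg.
pose m := - Re (l / h 0).
have m0 : 0 < m by rewrite /m; lra.
pose be z := dqv h 0 l z / h 0.
have cb : cont be 0 by apply: contM => //; exact: cont_cst.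
have [s s0 Hs] := cb (m / 2) ltac:(by rewrite divr_gt0).
pose b := cabs (l / h 0) + m / 2.
have b0 : 0 < b by rewrite /b; have := cabs_ge0 (l / h 0); lra.
have mb : 0 < m / b ^+ 2 by rewrite divr_gt0 // exprn_gt0.
pose t := Num.min (Num.min s tau) (m / b ^+ 2) / 2.
have mm : 0 < Num.min (Num.min s tau) (m / b ^+ 2) by rewrite !lt_min s0 tau0 mb.
have t0 : 0 < t by rewrite /t; lra.
have : t < Num.min (Num.min s tau) (m / b ^+ 2) by rewrite /t; lra.
rewrite !lt_min => /andP[/andP[ts tt] tm].
have := H t; rewrite t0 tt => /(_ isT).
have ct : cabs (t%:C - 0) = t by rewrite subr0 cabs_pos // ltW.
have hE : h t%:C = h 0 * (1 + t%:C * be t%:C).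
  have := dqvP h 0 l t%:C; rewrite subr0 => E.
  rewrite (_ : h t%:C = h 0 + dqv h 0 l t%:C * t%:C); last by rewrite -E addrC subrK.
  by rewrite /be; field.
rewrite hE cabsM ler_pMr ?cabs_gt0 //.
have := Hs t%:C; rewrite ct => /(_ ts); rewrite /be dqvaa => Hb.
set v := dqv h 0 l t%:C / h 0 in Hb *.
have r1 : Re v <= - m / 2.
  by have := ler_Re (v - l / h 0); rewrite ReB -[Re (l / h 0)]opprK -/m; lra.
have r2 : cabs v <= b by have := lerB_cabs v (l / h 0); rewrite /b; lra.
apply/negP; rewrite -ltNge -(@ltr_pXn2r _ 2) ?nnegrE ?cabs_ge0 // expr1n.
have -> : cabs (1 + t%:C * v) ^+ 2 = 1 + 2 * t * Re v + t ^+ 2 * cabs v ^+ 2.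
  by rewrite !sqr_cabs; case: (v) => x y /=; ring.
have r3 : cabs v ^+ 2 <= b ^+ 2 by rewrite ler_pXn2r ?nnegrE ?cabs_ge0 // ltW.
rewrite ltr_pdivlMr ?exprn_gt0 // in tm.
have k1 : t * cabs v ^+ 2 < m.
  by apply: le_lt_trans tm; rewrite ler_wpM2l // ltW.
have : t * (2 * Re v + t * cabs v ^+ 2) < 0 by rewrite pmulr_rlt0 //; lra.
lra.
Qed.

Lemma cont_bounded (f : C -> C) r : 0 <= r -> (forall z, cabs z <= r -> cont f z) ->
  exists M : R, forall z, cabs z <= r -> cabs (f z) <= M.
Proof.
move=> r0 cf.
have [m _ Hm] : exists2 m, cabs m <= r & forall z, cabs z <= r -> cabs (f z) <= cabs (f m).
  apply: (@compact_attains R (fun z => cabs z <= r) (fun z => cabs (f z)) r) => //.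
  - move=> z /negP; rewrite -ltNge => h; have h' : r < cabs (z - 0) by rewrite subr0.
    by apply: near_imp (near_far h') => y; rewrite subr0 => hy; apply/negP; rewrite -ltNge.
  - move=> a ra e e0; apply: near_imp (cf a ra e e0) => z h _.
    by have := lerB_cabs (f z) (f a); lra.
  - by exists 0; rewrite cabs0.
by exists (cabs (f m)).
Qed.

(* A function with a pole at 0 and values on the sphere is handled through its
   reciprocal [e], which is an ordinary injective holomorphic function; the
   function itself is [1 / e]. *)
Variable e : C -> C.
Hypothesis de : forall z, cabs z < 1 -> cdiff e z.
Hypothesis ie : forall z w, cabs z < 1 -> cabs w < 1 -> e z = e w -> z = w.
Hypothesis e0 : e 0 = 0.

(** The set omitted by [1 / e]. Since [e] is finite, [1 / e] omits 0. *)
Definition inv_omitted w := w = 0 \/ forall z, cabs z < 1 -> e z != w^-1.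

Hypothesis Kconv : forall w1 w2 (t : R), 0 <= t <= 1 -> inv_omitted w1 -> inv_omitted w2 ->
  inv_omitted (t%:C * w1 + (1 - t)%:C * w2).

Lemma in_disc_near a : cabs a < 1 -> nearC a (fun z => cabs z < 1).
Proof.
move=> a1; rewrite -(subr0 a) in a1.
by apply: near_imp (near_ball a1) => y; rewrite subr0.
Qed.

Lemma e_neq0 z : cabs z < 1 -> z != 0 -> e z != 0.
Proof.
move=> z1; apply: contra_neq => ez; apply: ie => //; last by rewrite e0.
by rewrite cabs0 ltr01.
Qed.

Lemma e_neq z w : cabs z < 1 -> cabs w < 1 -> z != w -> e z - e w != 0.
Proof. by move=> z1 w1; apply: contra_neq => /eqP; rewrite subr_eq0 => /eqP; exact: ie. Qed.

Let rad (a : C) : R := (1 - cabs a) / 2.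
Let rad0 a : cabs a < 1 -> 0 < rad a. Proof. by rewrite /rad => h; lra. Qed.
Let rad1 a z : cabs a < 1 -> cabs (z - a) <= rad a -> cabs z < 1.
Proof. by rewrite /rad => h h'; have := ler_cabsD (z - a) a; rewrite subrK; lra. Qed.

Lemma e_open a r : cabs a < 1 -> 0 < r ->
  nearC (e a) (fun w => exists z, [/\ cabs (z - a) < r, cabs z < 1 & e z = w]).
Proof.
move=> a1 r0; pose s := Num.min r (rad a).
have s0 : 0 < s by rewrite lt_min r0 rad0.
have sr : s <= r by rewrite ge_min lexx.
have sr' : s <= rad a by rewrite ge_min lexx orbT.
have in1 z : cabs (z - a) <= s -> cabs z < 1.
  by move=> h; apply: (rad1 a1); exact: le_trans h sr'.
have [d d0 Hd] := @open_image R e a s s0 (fun z h => de (in1 z h))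
  (fun z w h h' => ie (in1 z h) (in1 w h')).
exists d => // w /Hd[z za <-]; exists z; split=> //; first exact: lt_le_trans za sr.
by apply: in1; exact: ltW.
Qed.

Lemma der_e_neq0 a : cabs a < 1 -> der e a != 0.
Proof.
move=> a1; apply: (@injective_der_neq0 R e a (rad a) (rad0 a1)).
  by move=> z h; apply: de; exact: rad1 h.
by move=> z w h h'; apply: ie; [exact: rad1 h|exact: rad1 h'].
Qed.

Definition einv u := xget 0 [set z | cabs z < 1 /\ e z = u].

Lemma einvP u z : cabs z < 1 -> e z = u -> cabs (einv u) < 1 /\ e (einv u) = u.
Proof. by move=> z1 ez; apply: (@xgetPex _ 0 [set z | cabs z < 1 /\ e z = u]); exists z. Qed.

Lemma einvK z : cabs z < 1 -> einv (e z) = z.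
Proof. by move=> z1; have [h1 h2] := einvP z1 erefl; apply: ie. Qed.

Lemma einv_has_der a : cabs a < 1 -> has_der einv (e a) (der e a)^-1.
Proof.
move=> a1; apply: (@inverse_has_der R e a (rad a) (rad0 a1)).
- by move=> z h; apply: de; exact: rad1 h.
- by move=> z w h h'; apply: ie; [exact: rad1 h|exact: rad1 h'].
- by move=> z h; apply: einvK; apply: (rad1 a1); exact: ltW.
Qed.

Lemma not_inv_omitted w : ~ inv_omitted w -> w != 0 /\ exists2 k, cabs k < 1 & e k = w^-1.
Proof.
move=> nK; split; first by apply/negP => /eqP w0; apply: nK; left.
apply: contrapT => H; apply: nK; right => z z1; apply/negP => /eqP ez.
by apply: H; exists z.
Qed.

(** The values that keep distance [d] from the omitted set form, together with
    infinity, a compact subset of the image; by injectivity and openness they are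
    all taken in a smaller disc. Multiplying the distance condition by [u = e z]
    includes infinity as [u = 0]. *)
Lemma boundary_near_omitted d : 0 < d ->
  exists2 r, r < 1 & forall z, r < cabs z < 1 ->
    exists2 w, inv_omitted w & cabs ((e z)^-1 - w) < d.
Proof.
move=> d0.
pose S u := cabs u <= d^-1 /\ forall w, inv_omitted w -> d * cabs u <= cabs (1 - u * w).
pose Q (A : C -> Prop) := exists2 r, r < 1 & forall z, cabs z < 1 -> A (e z) -> cabs z <= r.
have : Q S.
  apply: (@compact_ind R S Q d^-1).
  - by move=> z [].
  - move=> u nS; have [h|h] := ltP d^-1 (cabs u).
      have h' : d^-1 < cabs (u - 0) by rewrite subr0.
      by apply: near_imp (near_far h') => y; rewrite subr0 => hy [hy' _]; lra.
    have [w Kw hw] : exists2 w, inv_omitted w & cabs (1 - u * w) < d * cabs u.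
      apply: contrapT => H; apply: nS; split=> // w Kw; rewrite leNgt; apply/negP => hw.
      by apply: H; exists w.
    pose m := (cabs (1 - u * w) + d * cabs u) / 2.
    have m1 : cabs (1 - u * w) < m by rewrite /m; lra.
    have m2 : m / d < cabs (u - 0) by rewrite subr0 ltr_pdivrMr // /m; lra.
    have cw : cont (fun u => 1 - u * w) u.
      apply: contB; first exact: cont_cst.
      by apply: contM; [exact: cont_id|exact: cont_cst].
    apply: near_imp (near_and (near_lt_cont cw m1) (near_far m2)) => y.
    by rewrite subr0 ltr_pdivrMr // => -[h1 h2] [_ /(_ w Kw)]; lra.
  - by move=> A A' AA' [r r1 H]; exists r => // z z1 /AA'; exact: H.
  - by exists 0.
  - move=> A A' [r r1 H] [r' r'1 H']; exists (Num.max r r'); first by rewrite gt_max r1.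
    by move=> z z1 [/H|/H'] h; rewrite le_max h ?orbT.
  move=> u [_ Hu].
  have [a a1 ea] : exists2 a, cabs a < 1 & e a = u.
    have [->|u0] := eqVneq u 0; first by exists 0; rewrite ?cabs0.
    have nK : ~ inv_omitted u^-1.
      by move=> /Hu; rewrite divff // subrr cabs0; apply/negP; rewrite -ltNge mulr_gt0 // cabs_gt0.
    by have [_ [k k1 ek]] := not_inv_omitted nK; exists k => //; rewrite ek invrK.
  have [s s0 Hs] := e_open a1 (rad0 a1).
  exists s => //; exists (cabs a + rad a); first by rewrite /rad; lra.
  move=> z z1 [_]; rewrite -ea => /Hs[z' [z'a z'1 /(ie z'1 z1) zz]].
  by have := ler_cabsD (z' - a) a; rewrite subrK -zz; lra.
move=> [r r1 Hr]; exists (Num.max r 0); first by rewrite gt_max r1 ltr01.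
move=> z /andP[]; rewrite gt_max => /andP[rz z0] z1.
have ez : e z != 0 by apply: e_neq0 => //; rewrite -cabs_gt0.
have ez0 : 0 < cabs (e z) by rewrite cabs_gt0.
have [h|h] := ltP d^-1 (cabs (e z)).
  exists 0; first by left.
  by rewrite subr0 cabsV -[d]invrK ltf_pV2 ?posrE ?invr_gt0.
apply: contrapT => H; suff : cabs z <= r by lra.
apply: Hr => //; split=> // w Kw; rewrite leNgt; apply/negP => hw; apply: H; exists w => //.
have -> : (e z)^-1 - w = (1 - e z * w) / e z by field.
by rewrite cabs_div ltr_pdivrMr.
Qed.

(** The reciprocals of nonzero omitted values avoid the open image of [e], hence
    stay away from the compact set of values of [e] on the smaller disc; small
    omitted values are far from [1 / e k] because [e k] is bounded. *)
Lemma compact_far_omitted r : 0 <= r -> r < 1 -> exists2 d, 0 < d &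
  forall k w, cabs k <= r -> k != 0 -> inv_omitted w -> d <= cabs ((e k)^-1 - w).
Proof.
move=> r0 r1; pose S k := cabs k <= r.
pose Q (A : C -> Prop) := exists2 d, 0 < d & 
  forall k w, A k -> cabs k <= r -> k != 0 -> inv_omitted w -> d <= cabs ((e k)^-1 - w).
suff : Q S by move=> [d d0 H]; exists d => // k w h; apply: H.
apply: (@compact_ind R S Q r) => //.
- move=> z /negP; rewrite -ltNge => h; have h' : r < cabs (z - 0) by rewrite subr0.
  by apply: near_imp (near_far h') => y; rewrite subr0 /S => hy; apply/negP; rewrite -ltNge.
- by move=> A A' AA' [d d0 H]; exists d => // k w /AA'; exact: H.
- by exists 1.
- move=> A A' [d d0 H] [d' d'0 H']; exists (Num.min d d'); first by rewrite lt_min d0.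
  move=> k w [Ak|Ak] h1 h2 h3; rewrite ge_min.
    by rewrite (H k w).
  by rewrite (H' k w) ?orbT.
move=> a Sa; have a1 : cabs a < 1 by apply: le_lt_trans Sa r1.
have [s s0 Hs] := e_open a1 ltr01.
pose M := cabs (e a) + 1.
have M0 : 0 < M by rewrite /M; have := cabs_ge0 (e a); lra.
have m0 : 0 < Num.min 1 (s / 2) by rewrite lt_min ltr01; lra.
have [t t0 Ht] := cdiff_cont (de a1) m0.
exists t => //; exists (Num.min (2 * M)^-1 ((2 * M)^-1 * (s / 2) / M)).
  by rewrite lt_min invr_gt0 mulr_gt0 // divr_gt0 // mulr_gt0 ?invr_gt0 ?mulr_gt0 //; lra.
move=> k w [_ /Ht]; rewrite lt_min => /andP[k1 ks] kr k0 Kw.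
have k1' : cabs k < 1 by exact: le_lt_trans kr r1.
have ek0 := e_neq0 k1' k0; have ekp : 0 < cabs (e k) by rewrite cabs_gt0.
have ekM : cabs (e k) <= M by have := lerB_cabs (e k) (e a); rewrite /M; lra.
have iM : M^-1 <= cabs (e k)^-1 by rewrite cabsV lef_pV2.
have hM : (2 * M)^-1 = M^-1 / 2 by rewrite invfM mulrC.
rewrite ge_min; have [h|h] := ltP (cabs w) (2 * M)^-1.
  by have := lerB_cabs ((e k)^-1) w; rewrite hM in h * => hh; apply/orP; left; lra.
apply/orP; right.
have w0 : w != 0 by rewrite -cabs_gt0; apply: lt_le_trans h; rewrite invr_gt0 mulr_gt0.
case: Kw => [w00|Kw]; first by rewrite w00 eqxx in w0.
have far : s / 2 <= cabs (w^-1 - e k).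
  rewrite leNgt; apply/negP => near; have [] := Hs w^-1.
    by have := ler_cabs_dist (e k) w^-1 (e a); lra.
  by move=> z [_ z1 ez]; have := Kw z z1; rewrite ez eqxx.
rewrite cabs_inv_sub //; apply: ler_pM; rewrite ?invr_ge0 ?(ltW M0) //.
- by rewrite mulr_ge0 ?invr_ge0 ?mulr_ge0 //; lra.
- by apply: ler_pM => //; rewrite ?invr_ge0 ?mulr_ge0 //; lra.
- by rewrite lef_pV2.
Qed.

Lemma e_dq0 z : e z = dq e 0 z * z.
Proof. by have := dqP e 0 z; rewrite e0 !subr0. Qed.

Lemma dq_e_neq0 w z : cabs w < 1 -> cabs z < 1 -> dq e w z != 0.
Proof.
move=> w1 z1; have [->|zw] := eqVneq z w; first by rewrite dqaa; exact: der_e_neq0.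
by rewrite dqE // mulf_neq0 ?invr_eq0 ?subr_eq0 //; rewrite -subr_eq0 e_neq.
Qed.

Lemma near_diff_e w : cabs w < 1 -> nearC w (cdiff e).
Proof. by move=> w1; apply: near_imp (in_disc_near w1) => z; exact: de. Qed.

Lemma cdiff_dq_e w z : cabs w < 1 -> cabs z < 1 -> cdiff (dq e w) z.
Proof. by move=> w1 z1; apply: cdiff_dq; [exact: de|exact: near_diff_e]. Qed.

(** A point of the chord between two values of [1 / e] at points of equal modulus
    (when [cabs c = 1]). *)
Definition chord (t : R) c z := t%:C / e z + (1 - t)%:C / e (c * z).

Lemma chord_cdiff t c z : cabs c = 1 -> cabs z < 1 -> z != 0 -> cdiff (chord t c) z.
Proof.
move=> c1 z1 z0; have cz1 : cabs (c * z) < 1 by rewrite cabsM c1 mul1r.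
have cz0 : c * z != 0 by rewrite mulf_neq0 // -cabs_gt0 c1.
have dcz : cdiff (fun z => e (c * z)) z.
  by apply: cdiff_comp (de cz1); exact: (cdiffM (cdiff_cst _ _) (cdiff_id _)).
exact: (cdiffD (cdiff_div (cdiff_cst _ _) (de z1) (e_neq0 z1 z0))
  (cdiff_div (cdiff_cst _ _) dcz (e_neq0 cz1 cz0))).
Qed.

Lemma chord_near0 (t : R) c d : cabs c = 1 -> 0 <= t <= 1 -> 0 < d -> nearC 0 (fun x =>
  x != 0 -> cabs (x * chord t c x) <= (1 + d) / cabs (der e 0)).
Proof.
move=> c1 t01 d0.
have o1 : cabs (0 : C) < 1 by rewrite cabs0 ltr01.
have a0 : 0 < cabs (der e 0) by rewrite cabs_gt0 der_e_neq0.
have cE : cont (dq e 0) 0 by apply: cdiff_cont; exact: cdiff_dq_e.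
have ciE : cont (fun x => (dq e 0 x)^-1) 0 by apply: contV => //; exact: dq_e_neq0.
have B : cabs ((dq e 0 0)^-1) < (1 + d) / cabs (der e 0).
  by rewrite dqaa cabsV ltr_pdivlMr // mulVf ?gt_eqF //; lra.
have [s s0 Hs] := near_and (near_lt_cont ciE B) (in_disc_near o1).
have c0 : c != 0 by rewrite -cabs_gt0 c1.
exists s => // x; rewrite subr0 => xs x0.
have h1 : cabs (dq e 0 x)^-1 < (1 + d) / cabs (der e 0) by apply: (proj1 (Hs x _)); rewrite subr0.
have h2 : cabs (dq e 0 (c * x))^-1 < (1 + d) / cabs (der e 0).
  by apply: (proj1 (Hs _ _)); rewrite subr0 cabsM c1 mul1r.
have x1 : cabs x < 1 by apply: (proj2 (Hs x _)); rewrite subr0.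
have n1 : dq e 0 x != 0 by apply: dq_e_neq0.
have n2 : dq e 0 (c * x) != 0 by apply: dq_e_neq0 => //; rewrite cabsM c1 mul1r.
have -> : x * chord t c x = t%:C * (dq e 0 x)^-1 + (1 - t)%:C * ((dq e 0 (c * x))^-1 * c^-1).
  by rewrite /chord (e_dq0 x) (e_dq0 (c * x)); field; rewrite c0 n1 n2 x0.
apply: le_trans (ler_cabsD _ _) _; rewrite !cabsM cabs_pos; last by case/andP: t01.
rewrite cabs_pos; last lra.
rewrite (cabsV c) c1 invr1 mulr1.
have := ler_wpM2l (proj1 (andP t01)) (ltW h1).
have t1 : 0 <= 1 - t by lra.
have := ler_wpM2l t1 (ltW h2); lra.
Qed.

(** The maximum principle for [z / kk z], where [kk z] is the preimage of
    [chord t c z], on the set where the chord avoids the omitted set. On the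
    boundary of that set, either the chord meets the omitted set or [z] tends to
    the unit circle and the chord approaches the omitted set by convexity; in
    both cases [kk z] tends to the unit circle. At 0 both functions have a simple
    pole and the quotient tends to a convex combination of 1 and [1 / c]. *)
Lemma level_sets_convex (t : R) c z k : cabs c = 1 -> 0 <= t <= 1 ->
  cabs z < 1 -> z != 0 -> cabs k < 1 -> k != 0 -> (e k)^-1 = chord t c z -> cabs z <= cabs k.
Proof.
move=> c1 t01 z1 z0 k1 k0 ek.
have c0 : c != 0 by rewrite -cabs_gt0 c1.
pose G := chord t c.
pose U x := [/\ cabs x < 1, x != 0 & ~ inv_omitted (G x)].
pose kk x := einv (G x)^-1.
have kkP x : U x -> [/\ G x != 0, cabs (kk x) < 1, e (kk x) = (G x)^-1 & kk x != 0].
  move=> [x1 x0 /not_inv_omitted[G0 [y y1 ey]]]; have [h1 h2] := einvP y1 ey; split=> //.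
  by apply: contraNneq G0 => h; rewrite -invr_eq0 -h2 -/(kk x) h e0.
have GD x : cabs x < 1 -> x != 0 -> cdiff G x by exact: chord_cdiff.
pose q x := x / kk x.
suff qz : cabs (q z) <= 1.
  have -> : k = kk z by rewrite /kk /G -ek invrK einvK.
  have Uz : U z.
    split=> // -[G0|/(_ k k1)]; last by rewrite /G -ek invrK eqxx.
    by have := e_neq0 k1 k0; rewrite -invr_eq0 ek -/(G z) G0 eqxx.
  have [_ _ _ kk0] := kkP z Uz.
  by move: qz; rewrite /q cabs_div ler_pdivrMr ?mul1r // cabs_gt0.
have Uz : U z.
  split=> // -[G0|/(_ k k1)]; last by rewrite /G -ek invrK eqxx.
  by have := e_neq0 k1 k0; rewrite -invr_eq0 ek -/(G z) G0 eqxx.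
apply: (@max_principle R U q 1 1) => //.
- move=> x Ux; have [x1 x0 nK] := Ux; have [G0 h1 h2 h3] := kkP x Ux.
  have cG : cont (fun y => (G y)^-1) x by apply: contV => //; apply: cdiff_cont; exact: GD.
  have [s s0 Hs] := e_open h1 ltr01; rewrite h2 in Hs.
  have nG : nearC x (fun y => G y != 0) by apply: near_neq0 => //; apply: cdiff_cont; exact: GD.
  apply: near_imp (near_and (near_and (in_disc_near x1) (near_neq x0)) (near_and (cG _ s0) nG)).
  move=> y [[y1 y0] [/Hs[v [_ v1 ev]] Gy]]; split=> // -[Gy0|/(_ v v1)].
    by rewrite Gy0 eqxx in Gy.
  by rewrite ev eqxx.
- by move=> x [/ltW].
- move=> x Ux; have [x1 x0 nK] := Ux; have [G0 h1 h2 h3] := kkP x Ux.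
  apply: cdiff_div => //; first exact: cdiff_id.
  apply: (@cdiff_comp _ (fun y => (G y)^-1)); first by apply: cdiffV => //; exact: GD.
  by rewrite -h2; exists (der e (kk x))^-1; exact: einv_has_der.
move=> y nU s s0.
pose r := (1 + s)^-1.
have r1 : r < 1 by rewrite invf_lt1; lra.
have r0 : 0 <= r by rewrite invr_ge0; lra.
have [d d0 Hd] := compact_far_omitted r0 r1.
have close x : U x -> (exists2 w, inv_omitted w & cabs (G x - w) < d) -> cabs (q x) <= 1 + s.
  move=> Ux [w Kw Gw]; have [G0 h1 h2 h3] := kkP x Ux.
  have rk : r < cabs (kk x).
    rewrite ltNge; apply/negP => h; have := Hd (kk x) w h h3 Kw.
    by rewrite h2 invrK; lra.
  have kp : 0 < cabs (kk x) by rewrite cabs_gt0.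
  rewrite /q cabs_div ler_pdivrMr //.
  have [x1 _ _] := Ux; apply: le_trans (ltW x1) _.
  move: rk; rewrite /r invf_plt ?posrE; [|lra|done].
  by move=> rk; rewrite -ler_pdivrMr // mul1r ltW.
have [y0|yn0] := eqVneq y 0.
(* With this choice [(1 + h) ^+ 2 <= 1 + s]. *)
    rewrite y0; pose h := Num.min 1 (s / 3).
  have h0 : 0 < h by rewrite lt_min ltr01; lra.
  have hh1 : h <= 1 by rewrite ge_min lexx.
  have hs : h <= s / 3 by rewrite ge_min lexx orbT.
  have o1 : cabs (0 : C) < 1 by rewrite cabs0 ltr01.
  have a0 : 0 < cabs (der e 0) by rewrite cabs_gt0 der_e_neq0.
  have cE : cont (dq e 0) 0 by apply: cdiff_cont; exact: cdiff_dq_e.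
  have B1 : cabs (dq e 0 0) < (1 + h) * cabs (der e 0) by rewrite dqaa ltr_pMl //; lra.
  have [u u0 Hu] := near_lt_cont cE B1.
  have [v v0 Hv] := chord_near0 c1 t01 h0.
  exists (Num.min u v) => [|x]; first by rewrite lt_min u0.
  rewrite lt_min subr0 => /andP[xu xv] Ux.
  have [x1 x0 _] := Ux; have [G0 h1 h2 h3] := kkP x Ux.
  have [ku|ku] := ltP (cabs (kk x)) u.
    have qE : q x = x * G x * dq e 0 (kk x).
      have := h2; rewrite (e_dq0 (kk x)) => E; rewrite /q.
      rewrite -[G x]invrK -E invfM; field.
      by rewrite h3 dq_e_neq0.
    rewrite qE cabsM.
    have b1 := Hv x; rewrite subr0 in b1; have {}b1 := b1 xv x0.
    have b2 := Hu (kk x); rewrite subr0 in b2; have {}b2 := ltW (b2 ku).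
    apply: le_trans (ler_pM (cabs_ge0 _) (cabs_ge0 _) b1 b2) _.
    have -> : (1 + h) / cabs (der e 0) * ((1 + h) * cabs (der e 0)) = (1 + h) ^+ 2.
      by field; rewrite gt_eqF.
    have : h * h <= h * 1 by rewrite ler_wpM2l // ltW.
    lra.
  rewrite /q cabs_div ler_pdivrMr ?cabs_gt0 //.
  apply: (@le_trans _ _ (cabs (kk x))); first by lra.
  by rewrite ler_peMl ?cabs_ge0 //; lra.
have [y1|y1|y1] := ltgtP (cabs y) 1.
- have Ky : inv_omitted (G y) by apply: contrapT => nK; apply: nU.
  apply: near_imp (cdiff_cont (GD y y1 yn0) d0) => x Gx Ux.
  by apply: close => //; exists (G y).
- have y1' : 1 < cabs (y - 0) by rewrite subr0.
  by apply: near_imp (near_far y1') => x; rewrite subr0 => hx [hx']; lra.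
- have [r' r'1 Hr'] := boundary_near_omitted d0.
  have y1' : r' < cabs (y - 0) by rewrite subr0 y1.
  apply: near_imp (near_far y1') => x; rewrite subr0 => hx Ux; have [x1 x0 _] := Ux.
  apply: close => //.
  have [w1 K1 W1] := Hr' x ltac:(by rewrite hx).
  have [w2 K2 W2] := Hr' (c * x) ltac:(by rewrite cabsM c1 mul1r hx).
  exists (t%:C * w1 + (1 - t)%:C * w2); first exact: Kconv.
  rewrite /G /chord.
  have -> : t%:C / e x + (1 - t)%:C / e (c * x) - (t%:C * w1 + (1 - t)%:C * w2)
     = t%:C * ((e x)^-1 - w1) + (1 - t)%:C * ((e (c * x))^-1 - w2) by ring.
  apply: le_lt_trans (ler_cabsD _ _) _; rewrite !cabsM cabs_pos; last by case/andP: t01.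
  rewrite cabs_pos; last lra.
  have [/andP[t0 t1]] := t01.
  have [->|tn0] := eqVneq t 0; first by rewrite mul0r subr0 mul1r add0r.
  have tp : 0 < t by rewrite lt_def tn0.
  have h1 : t * cabs ((e x)^-1 - w1) < t * d by rewrite ltr_pM2l.
  have t1' : 0 <= 1 - t by lra.
  have := ler_wpM2l t1' (ltW W2); lra.
Qed.



Lemma Re_cayley z w : cabs z = cabs w -> Re ((z + w) / (z - w)) = 0.
Proof.
move=> zw; have := congr1 (fun x => x ^+ 2) zw; rewrite !sqr_cabs.
case: z w {zw} => a b [x y] /= E.
set n := _ ^+ 2 + _ ^+ 2.
transitivity ((a ^+ 2 + b ^+ 2 - (x ^+ 2 + y ^+ 2)) / n); first by rewrite /n; ring.
by rewrite E subrr mul0r.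
Qed.

(** The derivative of [level_sets_convex] in the direction of the chord: the
    preimage of the chord from [1 / e z] to [1 / e w] starts at [z] and does not
    enter the disc of radius [cabs z]. *)
Lemma level_sets_support z w : cabs z < 1 -> z != 0 -> cabs w = cabs z -> w != z ->
  0 <= Re (z * der e z * e w / (e z * (e w - e z))).
Proof.
move=> z1 z0 wz wnz.
have w1 : cabs w < 1 by rewrite wz.
have w0 : w != 0 by rewrite -cabs_gt0 wz cabs_gt0.
have ez := e_neq0 z1 z0; have ew := e_neq0 w1 w0; have ewz := e_neq w1 z1 wnz.
have dz := der_e_neq0 z1.
pose c := w / z.
have c1 : cabs c = 1 by rewrite /c cabs_div wz divff // cabs_eq0.
pose d := (e w)^-1 - (e z)^-1.
pose h (t : C) := einv (((e z)^-1 + t * d)^-1).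
have H : has_der (fun t : C => (e z)^-1 + t * d) 0 d.
  have := has_derD (has_der_cst (e z)^-1 0) (has_derM (has_der_id 0) (has_der_cst d 0)).
  by rewrite mul1r mulr0 addr0 add0r.
have g0 : (e z)^-1 + 0 * d != 0 by rewrite mul0r addr0 invr_eq0.
have hl : has_der (fun t : C => ((e z)^-1 + t * d)^-1) 0 (- d / (e z)^-1 ^+ 2).
  by have := has_derV H g0; rewrite mul0r addr0.
have hh : has_der h 0 ((der e z)^-1 * (- d / (e z)^-1 ^+ 2)).
  apply: has_der_comp hl _; rewrite mul0r addr0 invrK; exact: einv_has_der.
have h0 : h 0 = z by rewrite /h mul0r addr0 invrK einvK.
have h0n : h 0 != 0 by rewrite h0.
have ch : cont (fun t : C => ((e z)^-1 + t * d)^-1) 0 := has_der_cont hl.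
have [s s0 Hs] := e_open z1 ltr01.
have [t0 t00 Ht] := near_and (ch s s0) (near_neq0 (has_der_cont H) g0).
have m0 : 0 < Num.min t0 1 by rewrite lt_min t00 ltr01.
have := outward_derivative hh h0n m0 _.
have -> : (der e z)^-1 * (- d / (e z)^-1 ^+ 2) / h 0 = (z * der e z * e w / (e z * (e w - e z)))^-1.
  by rewrite h0 /d; field; rewrite z0 ez ew dz -oppr_eq0 opprB subr_eq0 eq_sym -subr_eq0 ewz.
move=> Hout; rewrite -[X in Re X]invrK; apply: Re_inv_ge0; apply: Hout => t /andP[tp].
rewrite lt_min h0 => /andP[tt t1].
have ct : cabs (t%:C - 0) < t0 by rewrite subr0 cabs_pos // ltW.
have [y [_ y1 ey]] : exists y, [/\ cabs (y - z) < 1, cabs y < 1 & e y = ((e z)^-1 + t%:C * d)^-1].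
  by apply: Hs; have [] := Ht _ ct; rewrite mul0r addr0 invrK.
have [k1 ek] := einvP y1 ey.
have zG : (e (h t%:C))^-1 = chord (1 - t) c z.
  rewrite /h ek invrK /chord /d /c divfK // subKr rmorphB /=; ring.
have hn0 : h t%:C != 0.
  have [_] := Ht _ ct; apply: contraNneq => ht0.
  by rewrite -invr_eq0 -ek -/(h _) ht0 e0.
by apply: (@level_sets_convex (1 - t) c) => //; lra.
Qed.

Section Suffridge.
Variable w : C.
Hypotheses (w1 : cabs w < 1) (w0 : w != 0).

Let num z := - (2 * e w) * der e z / (dq e 0 z * dq e w z) + (z + w).
(** With [F = 1 / e] this is
    [2 * z * F' z / (F w - F z) + (z + w) / (z - w)]; writing it as a difference
    quotient of [num], which vanishes at [w], removes the singularity at [w], and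
    writing [e] as [dq e 0 z * z] removes the one at 0. *)
Definition suffridge := dq num w.

Let o1 : cabs (0 : C) < 1. Proof. by rewrite cabs0 ltr01. Qed.

Lemma cdiff_num z : cabs z < 1 -> cdiff num z.
Proof.
move=> z1; apply: cdiffD; last by apply: cdiffD; [exact: cdiff_id|exact: cdiff_cst].
apply: cdiff_div; last by rewrite mulf_neq0 ?dq_e_neq0.
  by apply: cdiffM; [exact: cdiff_cst|apply: cdiff_der; exact: near_diff_e].
by apply: cdiffM; exact: cdiff_dq_e.
Qed.

Lemma cdiff_suffridge z : cabs z < 1 -> cdiff suffridge z.
Proof.
move=> z1; apply: cdiff_dq; first exact: cdiff_num.
by apply: near_imp (in_disc_near w1) => y; exact: cdiff_num.
Qed.

Lemma num_w : num w = 0.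
Proof.
have dw := der_e_neq0 w1; have ew := e_neq0 w1 w0.
rewrite /num dqaa dqE // e0 !subr0; field.
by rewrite dw ew w0.
Qed.

Lemma suffridgeE z : cabs z < 1 -> z != w -> 
  suffridge z = - (2 * e w) * der e z / (dq e 0 z * (e z - e w)) + (z + w) / (z - w).
Proof.
move=> z1 zw; rewrite /suffridge dqE // num_w subr0 /num (dqE _ zw).
have d0 := dq_e_neq0 o1 z1; have ezw := e_neq z1 w1 zw.
have zw' : z - w != 0 by rewrite subr_eq0.
by field; rewrite d0 ezw zw'.
Qed.

Lemma suffridgeE' z : cabs z < 1 -> z != 0 -> z != w -> 
  suffridge z = 2 * (z * der e z * e w / (e z * (e w - e z))) + (z + w) / (z - w).
Proof.
move=> z1 z0 zw; rewrite suffridgeE // dqE // e0 !subr0.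
have d0 := e_neq0 z1 z0; have ezw := e_neq z1 w1 zw.
have ewz : e w - e z != 0 by rewrite -opprB oppr_eq0.
have zw' : z - w != 0 by rewrite subr_eq0.
by field; rewrite d0 ezw ewz zw' z0.
Qed.

Lemma suffridge0 : suffridge 0 = 1.
Proof.
have d0 := der_e_neq0 o1; have ew := e_neq0 w1 w0.
rewrite suffridgeE //; last by rewrite eq_sym.
rewrite dqaa e0; field; by rewrite w0 ew d0.
Qed.

Lemma Re_suffridge_circle z : cabs z = cabs w -> z != w -> 0 <= Re (suffridge z).
Proof.
move=> zw znw; have z1 : cabs z < 1 by rewrite zw.
have z0 : z != 0 by rewrite -cabs_gt0 zw cabs_gt0.
rewrite suffridgeE' // ReD Re_cayley // addr0.
have -> : 2 = 2%:R%:C :> C by rewrite rmorph_nat.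
by rewrite Re_real_mul mulr_ge0 // level_sets_support // eq_sym.
Qed.

(** The maximum principle applied to [suffridge - n]: on the circle its modulus is
    at most [sqrt (n ^+ 2 + M ^+ 2) <= n + M ^+ 2 / (2 * n)], and [n] is
    arbitrarily large. *)
Lemma Re_suffridge z : cabs z < cabs w -> 0 <= Re (suffridge z).
Proof.
move=> zw.
have [M HM] := @cont_bounded suffridge (cabs w) (cabs_ge0 w)
  (fun y h => cdiff_cont (cdiff_suffridge (le_lt_trans h w1))).
have M0 : 0 <= M by apply: le_trans (HM 0 _); rewrite ?cabs0 ?cabs_ge0.
rewrite leNgt; apply/negP => neg.
pose n := M ^+ 2 / (- Re (suffridge z)) + 1.
have n1 : 1 <= n by rewrite lerDr divr_ge0 ?sqr_ge0 //; lra.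
pose B := n + M ^+ 2 / (2 * n).
have nM : M ^+ 2 < n * (- Re (suffridge z)).
  by rewrite /n mulrDl mul1r divfK; [lra|rewrite gt_eqF //; lra].
have B0 : 0 <= B by rewrite addr_ge0 ?divr_ge0 ?sqr_ge0 ?mulr_ge0 //; lra.
have key : cabs (suffridge z - n%:C) <= B.
  apply: (@max_ball_except R 0 (cabs w) (fun z => suffridge z - n%:C) w) => //.
  - move=> y; rewrite subr0 => yw _; apply: cdiffB; last exact: cdiff_cst.
    by apply: cdiff_suffridge; exact: lt_trans yw w1.
  - exists (cabs (suffridge w - n%:C) + 1).
    apply: near_imp (cont_near_bd (contB (cdiff_cont (cdiff_suffridge w1)) (cont_cst n%:C _))).
    by move=> y.
  - move=> y; rewrite subr0 => yw ynw; split.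
      apply: contB; last exact: cont_cst.
      by apply: cdiff_cont; apply: cdiff_suffridge; rewrite yw.
    have r0 := Re_suffridge_circle yw ynw.
    have m0 := HM y; rewrite yw in m0; have {}m0 := m0 (lexx _).
    rewrite -(@ler_pXn2r _ 2) ?nnegrE ?cabs_ge0 //.
    have -> : cabs (suffridge y - n%:C) ^+ 2 = cabs (suffridge y) ^+ 2 - 2 * n * Re (suffridge y) + n ^+ 2.
      by rewrite !sqr_cabs; case: (suffridge y) => a b /=; ring.
    have b2 : n ^+ 2 + M ^+ 2 <= B ^+ 2.
      have -> : B ^+ 2 = n ^+ 2 + M ^+ 2 + (M ^+ 2 / (2 * n)) ^+ 2.
        by rewrite /B; field; rewrite gt_eqF //; lra.
      by rewrite lerDl sqr_ge0.
    have : cabs (suffridge y) ^+ 2 <= M ^+ 2 by rewrite ler_pXn2r ?nnegrE ?cabs_ge0.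
    have : 0 <= n * Re (suffridge y) by rewrite mulr_ge0 //; lra.
    lra.
  - by rewrite subr0.
  - by apply: contraTneq zw => ->; rewrite ltxx.
have := normr_Re (suffridge z - n%:C); rewrite ReB /= ler_norml => /andP[h _].
have : M ^+ 2 / (2 * n) < - Re (suffridge z).
  rewrite ltr_pdivrMr; last lra.
  by have : 0 <= M ^+ 2 by [exact: sqr_ge0]; lra.
by move: h key; rewrite /B; lra.
Qed.

Let q z := dq suffridge 0 z / (suffridge z + 1).

Lemma suffridge1_neq0 z : cabs z < cabs w -> suffridge z + 1 != 0.
Proof.
move=> zw; apply/negP => /eqP h; have := Re_suffridge zw.
have -> : suffridge z = -1 by apply/eqP; rewrite -subr_eq0 opprK h.
by rewrite raddfN /=; lra.
Qed.

(** Schwarz's lemma for [(suffridge - 1) / (suffridge + 1)], which vanishes at 0;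
    [q] is this function divided by [z]. *)
Lemma suffridge_schwarz z : cabs z < cabs w -> cabs w * cabs (q z) <= 1.
Proof.
move=> zw; have wp : 0 < cabs w by rewrite cabs_gt0.
have wlt y : cabs y < cabs w -> cabs y < 1 by move=> h; exact: lt_trans h w1.
have dqd y : cabs y < cabs w -> cdiff q y.
  move=> yw; have y1 := wlt y yw; apply: cdiff_div; last exact: suffridge1_neq0.
    apply: cdiff_dq; first exact: cdiff_suffridge.
    by apply: near_imp (in_disc_near o1) => x; exact: cdiff_suffridge.
  by apply: cdiffD; [exact: cdiff_suffridge|exact: cdiff_cst].
have B r : cabs z < r -> r < cabs w -> cabs (q z) <= r^-1.
  move=> zr rw; have r0 : 0 < r by have := cabs_ge0 z; lra.
  apply: (@max_ball R 0 r q); rewrite ?subr0 ?invr_ge0 ?(ltW r0) //.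
    by move=> y; rewrite subr0 => yr; apply: dqd; lra.
  move=> y; rewrite subr0 => yr.
  have yw : cabs y < cabs w by rewrite yr.
  split; first by apply: cdiff_cont; exact: dqd.
  have yn : y != 0 by rewrite -cabs_gt0 yr.
  rewrite /q dqE // suffridge0 subr0 !cabs_div yr -mulrA [X in _ * X]mulrC mulrA.
  rewrite ler_pdivrMr ?mulVf ?gt_eqF // ler_pdivrMr ?cabs_gt0 ?suffridge1_neq0 //.
  by rewrite mul1r -Re_ge0_dist Re_suffridge.
rewrite leNgt; apply/negP => H.
have qp : 0 < cabs (q z) by rewrite -(pmulr_rgt0 _ wp); lra.
have h1 : (cabs (q z))^-1 < cabs w by rewrite -[X in X < _]mul1r ltr_pdivrMr.
pose r := (Num.max (cabs z) (cabs (q z))^-1 + cabs w) / 2.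
have m1 : Num.max (cabs z) (cabs (q z))^-1 < cabs w by rewrite gt_max zw.
have m2 : cabs z <= Num.max (cabs z) (cabs (q z))^-1 by rewrite le_max lexx.
have m3 : (cabs (q z))^-1 <= Num.max (cabs z) (cabs (q z))^-1 by rewrite le_max lexx orbT.
have r0 : 0 < r by have := cabs_ge0 z; rewrite /r; lra.
have := B r ltac:(rewrite /r; lra) ltac:(rewrite /r; lra).
by rewrite -[cabs (q z)]invrK lef_pV2 ?posrE ?invr_gt0 // /r; lra.
Qed.

Lemma suffridge_bound z : cabs z < cabs w -> cabs w * cabs (suffridge z - 1) <= cabs z * cabs (suffridge z + 1).
Proof.
move=> zw; have [->|z0] := eqVneq z 0; first by rewrite suffridge0 subrr cabs0 mulr0 mul0r.
have := suffridge_schwarz zw; rewrite /q dqE // suffridge0 subr0 !cabs_div.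
have p1 : 0 < cabs (suffridge z + 1) by rewrite cabs_gt0 suffridge1_neq0.
have p2 : 0 < cabs z by rewrite cabs_gt0.
by rewrite !mulrA ler_pdivrMr // mul1r ler_pdivrMr // [X in _ <= X]mulrC.
Qed.

(** Off 0 the difference quotient of [suffridge] at 0 is an explicit rational
    expression in which a factor [z] cancels. *)
Lemma der_suffridge0 : der suffridge 0 = - 2 * (w^-1 - der (dq e 0) 0 / der e 0 - der e 0 / e w).
Proof.
have a0 := der_e_neq0 o1; have ew := e_neq0 w1 w0.
have w00 : 0 != w by rewrite eq_sym.
pose H z := - 2 * (e w * dq e 0 z + e w * der (dq e 0) z * (z - w) - w * dq e 0 z ^+ 2)
   / (dq e 0 z * dq e w z * (z - w) ^+ 2).
have dE z : cabs z < 1 -> cdiff (dq e 0) z by exact: cdiff_dq_e.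
have cH : cont H 0.
  apply: cdiff_cont; apply: cdiff_div.
  - apply: cdiffM; first exact: cdiff_cst.
    apply: cdiffB; last by apply: cdiffM; [exact: cdiff_cst|apply: cdiffX; exact: dE].
    apply: cdiffD; first by apply: cdiffM; [exact: cdiff_cst|exact: dE].
    apply: cdiffM; last exact: cdiff_shift.
    apply: cdiffM; first exact: cdiff_cst.
    by apply: cdiff_der; apply: near_imp (in_disc_near o1) => y; exact: dE.
  - apply: cdiffM; last by apply: cdiffX; exact: cdiff_shift.
    by apply: cdiffM; exact: cdiff_dq_e.
  - by rewrite !mulf_neq0 ?dq_e_neq0 ?expf_neq0 // sub0r oppr_eq0.
have cS : cont (dq suffridge 0) 0 by apply: der_spec; exact: cdiff_suffridge.
have E : dq suffridge 0 0 = H 0.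
  apply: (cont_uniq cS cH).
  apply: near_imp (near_and (in_disc_near o1) (near_neq w00)) => z [z1 zw] z0.
  rewrite dqE // suffridge0 subr0 suffridgeE // /H.
  have -> : der e z = dq e 0 z + z * der (dq e 0) z.
    apply: has_der_der; have := has_derM (der_spec (dE z z1)) (has_der_id z).
    rewrite mulr1 addrC [X in _ + X]mulrC; apply: has_der_congr.
    by apply: near_all => y; rewrite -e_dq0.
  have d0 := dq_e_neq0 o1 z1; have d1 := dq_e_neq0 w1 z1.
  have zw' : z - w != 0 by rewrite subr_eq0.
  have ezw : e z - e w = dq e w z * (z - w) by exact: dqP.
  have ez : e w = dq e 0 z * z - dq e w z * (z - w) by rewrite -e_dq0 -ezw subKr.
  rewrite ezw; move: d0 d1 zw' ez z0 zw.
  set E0 := dq e 0 z; set Ew := dq e w z; set D := der _ z => d0 d1 zw' ez z0 zw.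
  rewrite ez; field; by rewrite d0 d1 zw' z0.
rewrite -[LHS](dqaa suffridge) E /H dqaa (dqE _ w00) e0 !sub0r.
field; by rewrite w0 ew a0.
Qed.

(** The case [z = 0] of [suffridge_schwarz]. With [F = 1 / e] it compares [F w] to
    the first two terms of the Laurent expansion of [F] at 0. *)
Lemma suffridge_pole : cabs ((e w)^-1 - (der e 0)^-1 / w + der (dq e 0) 0 / der e 0 ^+ 2)
   <= cabs (der e 0)^-1 / cabs w.
Proof.
have a0 := der_e_neq0 o1; have ew := e_neq0 w1 w0.
have wp : 0 < cabs w by rewrite cabs_gt0.
have := @suffridge_schwarz 0; rewrite cabs0 => /(_ wp).
rewrite /q dqaa suffridge0 der_suffridge0.
set X := _ - _ - _; set Y := _ + _ / _ ^+ 2.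
have -> : - 2 * X / (1 + 1) = - X.
  by rewrite -[1 + 1]/(2%:R) mulNr mulNr mulrAC divff ?mul1r // pnatr_eq0.
have -> : Y = - X / der e 0 by rewrite /Y /X; field; rewrite a0 ew w0.
rewrite cabs_div cabsV cabsN => H.
rewrite [X in X <= _]mulrC; apply: ler_wpM2l; first by rewrite invr_ge0 cabs_ge0.
by rewrite -[(cabs w)^-1]mul1r ler_pdivlMr // mulrC.
Qed.

End Suffridge.

End Reciprocal.

(** * Transfer to functions with pole at p *)

Section Mobius.
Variable R : realType.
Local Notation C := R[i].
Variable p : R.
Hypotheses (p0 : 0 < p) (p1 : p < 1).
Local Notation P := (p%:C : C).

Definition mob (z : C) : C := (P - z) / (1 - P * z).

Lemma pC_neq0 : P != 0. Proof. by rewrite -cabs_gt0 cabs_pos // ltW. Qed.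
Lemma cabs_pC : cabs P = p. Proof. by rewrite cabs_pos // ltW. Qed.
Lemma pC2_neq1 : 1 - P ^+ 2 != 0.
Proof.
rewrite subr_eq0 -cabs_sub_gt0; apply: lt_le_trans (lerB_cabs _ _).
by rewrite cabs1 cabsX cabs_pC subr_gt0 expr_lt1 // ltW.
Qed.
Lemma pC2_neqN1 : 1 + P ^+ 2 != 0.
Proof.
rewrite -cabs_gt0; apply: lt_le_trans (lerB_cabsD _ _).
by rewrite cabs1 cabsX cabs_pC subr_gt0 expr_lt1 // ltW.
Qed.

Lemma mob_den z : cabs z < 1 -> 1 - P * z != 0.
Proof.
move=> z1; rewrite -cabs_gt0; apply: lt_le_trans (lerB_cabs _ _).
rewrite cabs1 cabsM cabs_pC subr_gt0.
by apply: le_lt_trans p1; rewrite ler_piMr // ltW.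
Qed.

Lemma mobK z : cabs z < 1 -> mob (mob z) = z.
Proof.
move=> z1; have h := mob_den z1; rewrite /mob; field.
by rewrite h (_ : _ - _ = 1 - P ^+ 2) ?pC2_neq1 //; ring.
Qed.

Lemma mob_identity z : cabs z < 1 ->
  1 - cabs (mob z) ^+ 2 = (1 - p ^+ 2) * (1 - cabs z ^+ 2) / cabs (1 - P * z) ^+ 2.
Proof.
move=> z1; have h : cabs (1 - P * z) != 0 by rewrite cabs_eq0 mob_den.
have E : cabs (1 - P * z) ^+ 2 - cabs (P - z) ^+ 2 = (1 - p ^+ 2) * (1 - cabs z ^+ 2).
  by rewrite !sqr_cabs; case: (z) => a b /=; ring.
by rewrite -E /mob cabs_div; field.
Qed.

Lemma mob_disc z : cabs z < 1 -> cabs (mob z) < 1.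
Proof.
move=> z1; have h : 0 < cabs (1 - P * z) by rewrite cabs_gt0 mob_den.
have := mob_identity z1.
have : 0 < (1 - p ^+ 2) * (1 - cabs z ^+ 2) / cabs (1 - P * z) ^+ 2.
  rewrite divr_gt0 ?exprn_gt0 // mulr_gt0 // subr_gt0 expr_lt1 ?cabs_ge0 //; exact: ltW.
move=> h1 h2; rewrite -(@ltr_pXn2r _ 2) ?nnegrE ?cabs_ge0 // expr1n; lra.
Qed.

Lemma mob_boundary z : cabs z < 1 ->
  1 - cabs (mob z) ^+ 2 <= 2 / (1 - p) * (1 - cabs z ^+ 2).
Proof.
move=> z1; rewrite mob_identity //.
have h : 1 - p <= cabs (1 - P * z).
  apply: le_trans (lerB_cabs _ _); rewrite cabs1 cabsM cabs_pC.
  by rewrite lerD2l lerN2 ler_piMr // ltW.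
have p1' := p1; have p0' := p0.
have q0 : 0 < 1 - p by lra.
have h2 : (1 - p) ^+ 2 <= cabs (1 - P * z) ^+ 2 by rewrite ler_pXn2r ?nnegrE ?cabs_ge0 // ltW.
have z2 : 0 <= 1 - cabs z ^+ 2 by rewrite subr_ge0 expr_le1 ?cabs_ge0 // ltW.
rewrite ler_pdivrMr; last by apply: lt_le_trans h2; rewrite exprn_gt0.
have E : 2 / (1 - p) * (1 - p) ^+ 2 = 2 * (1 - p) by field; rewrite gt_eqF.
have h3 : 2 / (1 - p) * (1 - p) ^+ 2 <= 2 / (1 - p) * cabs (1 - P * z) ^+ 2.
  by rewrite ler_wpM2l // divr_ge0 // ltW.
rewrite [leRHS]mulrAC; apply: ler_wpM2r => //; rewrite E in h3; nra.
Qed.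

Lemma mob_has_der z : cabs z < 1 -> has_der mob z (- (1 - P ^+ 2) / (1 - P * z) ^+ 2).
Proof.
move=> z1; have h := mob_den z1.
have h1 : has_der (fun z => P - z) z (0 - 1) := has_derB (has_der_cst _ _) (has_der_id _).
have h2 : has_der (fun z => 1 - P * z) z (0 - (0 * z + P * 1)).
  exact: has_derB (has_der_cst _ _) (has_derM (has_der_cst _ _) (has_der_id _)).
have := has_derM h1 (has_derV h2 h); congr has_der; field; exact: h.
Qed.

Lemma mob0 : mob 0 = P. Proof. by rewrite /mob mulr0 !subr0 divr1. Qed.
Lemma mobP : mob P = 0. Proof. by rewrite /mob subrr mul0r. Qed.

Lemma mob_neqP z : cabs z < 1 -> z != 0 -> mob z != P.
Proof.
move=> z1; apply: contra_neq => h; rewrite -(mobK z1) h mobP //.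
Qed.

Lemma mob_neq0 z : cabs z < 1 -> z != P -> mob z != 0.
Proof. by move=> z1; apply: contra_neq => h; rewrite -(mobK z1) h mob0. Qed.

End Mobius.

Section CayleyOmega.
Variable F : fieldType.
(** In terms of [omega], the Cayley transform of the Suffridge function at [p] is,
    up to the factor [P * eta], the value at [omega] of the automorphism of the
    disc that exchanges 0 and [P ^+ 2]. *)
Lemma cayley_omega_alg (P eta om x f S : F) :
  1 - P * eta != 0 -> 1 - P ^+ 2 != 0 -> 1 + P ^+ 2 != 0 -> P != 0 -> eta != 0 ->
  P - eta != 0 -> f != 0 -> x = (P - eta) / (1 - P * eta) ->
  f = (x - P / (1 + P ^+ 2) * (1 + om) * x ^+ 2) / ((1 - x / P) * (1 - x * P)) ->
  S = - (2 * P) / ((1 - P ^+ 2) * f) + (P + eta) / (P - eta) ->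
  (S - 1) * (1 - P ^+ 2 * om) = P * eta * (P ^+ 2 - om) * (S + 1).
Proof.
move=> d1 d2 d3 d4 en0 d5 f0 xE fE SE.
pose B := (1 + P ^+ 2) * (1 - P * eta) - P * (1 + om) * (P - eta).
have xB : f = P * (P - eta) * B / ((1 + P ^+ 2) * eta * (1 - P ^+ 2) ^+ 2).
  have k1 : 1 - x / P = eta * (1 - P ^+ 2) / (P * (1 - P * eta)).
    by rewrite xE; field; rewrite d1 d4.
  have k2 : 1 - x * P = (1 - P ^+ 2) / (1 - P * eta) by rewrite xE; field.
  rewrite fE k1 k2 xE /B. field.
  by rewrite d1 d2 d3 d4 en0.
have B0 : B != 0 by apply: contraNneq f0 => h; rewrite xB h mulr0 mul0r.
have SB : S * ((P - eta) * B) = - 2 * (1 + P ^+ 2) * eta * (1 - P ^+ 2) + (P + eta) * B.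
  rewrite SE xB. field. by rewrite d5 B0 d2 d3 d4 en0.
have D0 : (P - eta) * B != 0 by rewrite mulf_neq0.
apply: (mulIf D0).
transitivity ((S * ((P - eta) * B) - (P - eta) * B) * (1 - P ^+ 2 * om)); first by ring.
transitivity (P * eta * (P ^+ 2 - om) * (S * ((P - eta) * B) + (P - eta) * B)); last by ring.
rewrite SB /B. ring.
Qed.
End CayleyOmega.

Section DiscEstimate.
Variable R : realType.
Local Notation C := R[i].

(** For [r = 1] the assumption says that the image of [w] under a disc
    automorphism lies in the closed disc, so that [cabs w <= 1]; this is the
    version for [r] close to 1. *)
Lemma blaschke_bound (a r s : R) (w : C) : 0 < a < 1 -> 0 <= r <= 1 -> 0 < s ->
  8 * (1 - r) < (1 - a ^+ 2) * (1 - (1 + s) ^- 2) ->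
  r * cabs (a%:C - w) <= cabs (1 - a%:C * w) -> cabs w <= 1 + s.
Proof.
move=> /andP[a0 a1] /andP[r0 r1] s0 H h; rewrite leNgt; apply/negP => ts.
set t := cabs w in ts; set E := (1 + s) ^- 2 in H.
have t0 : 0 <= t := cabs_ge0 w.
have h2 : r ^+ 2 * cabs (a%:C - w) ^+ 2 <= cabs (1 - a%:C * w) ^+ 2.
  by rewrite -exprMn ler_pXn2r ?nnegrE ?mulr_ge0 ?cabs_ge0.
have e1 : cabs (a%:C - w) ^+ 2 = a ^+ 2 - 2 * a * Re w + t ^+ 2.
  by rewrite /t !sqr_cabs; case: (w) => x y /=; ring.
have e2 : cabs (1 - a%:C * w) ^+ 2 = 1 - 2 * a * Re w + a ^+ 2 * t ^+ 2.
  by rewrite /t !sqr_cabs; case: (w) => x y /=; ring.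
rewrite e1 e2 in h2.
have ET : 1 < E * t ^+ 2.
  rewrite /E -[X in X < _](mulVf (x := (1 + s) ^+ 2)); last by rewrite expf_neq0 // gt_eqF //; lra.
  by rewrite ltr_pM2l ?invr_gt0 ?exprn_gt0 ?ltr_pXn2r ?nnegrE //; lra.
have tt : t <= t ^+ 2 by rewrite expr2 ler_peMl //; lra.
have u1 : - (a * Re w) <= t ^+ 2.
  apply: le_trans tt; have := normr_Re w; rewrite ler_norml -/t => /andP[u _].
  have : a * (- Re w) <= a * t by rewrite ler_wpM2l ?(ltW a0) //; lra.
  have : a * t <= 1 * t by rewrite ler_wpM2r // ltW.
  lra.
have a2 : a ^+ 2 <= 1 by rewrite expr_le1 // ltW.
have t1 : 1 <= t ^+ 2 by lra.
have X0 : 0 <= a ^+ 2 - 2 * a * Re w + t ^+ 2 by rewrite -e1 sqr_ge0.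
set X := a ^+ 2 - 2 * a * Re w + t ^+ 2 in h2 X0.
have X4 : X <= 4 * t ^+ 2 by rewrite /X; lra.
have s1 : (1 - a ^+ 2) * (t ^+ 2 - 1) <= (1 - r ^+ 2) * X by rewrite /X in h2 *; lra.
have s2 : (1 - r ^+ 2) * X <= 2 * (1 - r) * (4 * t ^+ 2).
  apply: ler_pM => //; first by rewrite subr_ge0 expr_le1.
  have := sqr_ge0 (1 - r); lra.
have s3 : (1 - a ^+ 2) * ((1 - E) * t ^+ 2) <= (1 - a ^+ 2) * (t ^+ 2 - 1).
  by rewrite ler_wpM2l //; lra.
have s4 : 8 * (1 - r) * t ^+ 2 < (1 - a ^+ 2) * (1 - E) * t ^+ 2 by rewrite ltr_pM2r //; lra.
lra.
Qed.

End DiscEstimate.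

Section ConcaveFunction.
Variable R : realType.
Local Notation C := R[i].
Variables (p : R) (phi : C -> C).
Hypotheses (p0 : 0 < p) (p1 : p < 1).
Local Notation P := (p%:C : C).
Local Notation q := (P / (1 + P ^+ 2)).
Hypothesis dphi : forall z, cabs z < 1 -> z != P -> cdiff phi z.
Variable h : C -> C.
Hypothesis dh : cdiff h P.
Hypothesis hP : h P != 0.
Hypothesis phi_pole : nearC P (fun z => z != P -> phi z = h z / (z - P)).
Hypothesis iphi : forall z w, cabs z < 1 -> z != P -> cabs w < 1 -> w != P -> phi z = phi w -> z = w.
Hypothesis phi0 : phi 0 = 0.
Hypothesis dphi0 : has_der phi 0 1.

Definition omitted (w : C) := forall z, cabs z < 1 -> z != P -> phi z != w.

Hypothesis Kconv : forall w1 w2 (t : R), 0 <= t <= 1 -> omitted w1 -> omitted w2 ->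
  omitted (t%:C * w1 + (1 - t)%:C * w2).

Let P0 : P != 0. Proof. exact: pC_neq0. Qed.
Let o1 : cabs (0 : C) < 1. Proof. by rewrite cabs0 ltr01. Qed.
Let P1 : cabs P < 1. Proof. by rewrite cabs_pC. Qed.
Let oP : (0 : C) != P. Proof. by rewrite eq_sym. Qed.

(** Otherwise the inverse of [phi] would be a bounded entire function, hence
    constant. *)
Lemma omitted_nonempty : exists w, omitted w.
Proof.
apply: contrapT => no.
have surj w : exists z, [/\ cabs z < 1, z != P & phi z = w].
  apply: contrapT => H; apply: no; exists w => z z1 zP; apply/negP => /eqP zw.
  by apply: H; exists z.
pose g w := xget 0 [set z | [/\ cabs z < 1, z != P & phi z = w]].
have gP w : [/\ cabs (g w) < 1, g w != P & phi (g w) = w].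
  exact: (@xgetPex _ 0 [set z | [/\ cabs z < 1, z != P & phi z = w]] (surj w)).
have dg w : cdiff g w.
  have [g1 gnP gw] := gP w; set a := g w in g1 gnP gw.
  pose r := Num.min (1 - cabs a) (cabs (a - P)) / 2.
  have m0 : 0 < Num.min (1 - cabs a) (cabs (a - P)) by rewrite lt_min subr_gt0 g1 cabs_sub_gt0.
  have r0 : 0 < r by rewrite divr_gt0.
  have rm : r < Num.min (1 - cabs a) (cabs (a - P)) by rewrite /r; lra.
  move: rm; rewrite lt_min => /andP[r1 rP].
  have inU z : cabs (z - a) <= r -> cabs z < 1 /\ z != P.
    move=> za; split; first by have := ler_cabsD (z - a) a; rewrite subrK; lra.
    by apply: contraTneq za => ->; rewrite cabsBC -ltNge.
  rewrite -gw; exists (der phi a)^-1.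
  apply: (@inverse_has_der R phi a r) => //.
  - by move=> z /inU[]; exact: dphi.
  - by move=> z y /inU[? ?] /inU[? ?]; exact: iphi.
  - move=> z /ltW/inU[z1 zP]; have [h1 h2 h3] := gP (phi z); exact: iphi.
have const w : g w = g 0.
  apply/eqP; rewrite -subr_eq0 -cabs_eq0; apply/eqP/le_anti; rewrite cabs_ge0 andbT.
  apply/ler_addgt0Pl => s s0; rewrite addr0.
  pose r := 8 * cabs w / s + 2 * cabs w + 1.
  have w0 := cabs_ge0 w.
  have r0 : 0 < r by rewrite /r; have : 0 <= 8 * cabs w / s by [rewrite divr_ge0 ?mulr_ge0 // ltW]; lra.
  have := @cdiff_lipschitz R g 0 r 1 r0 (fun z _ => dg z) (fun z _ => ltW (let: And3 h _ _ := gP z in h)) w.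
  rewrite subr0 => H; apply: le_trans (H _) _.
    by rewrite /r; have : 0 <= 8 * cabs w / s by [rewrite divr_ge0 ?mulr_ge0 // ltW]; lra.
  rewrite mulr1 mulrAC ler_pdivrMr //.
  have : s * (8 * cabs w / s) = 8 * cabs w by field; rewrite gt_eqF.
  have : 0 <= s * (2 * cabs w + 1) by rewrite mulr_ge0 ?(ltW s0) //; lra.
  rewrite /r; lra.
have [_ _ h1] := gP 0; have [_ _ h2] := gP 1.
by have := oner_neq0 C; rewrite -{1}h2 const h1 eqxx.
Qed.

Section WithOmitted.
Variable k0 : C.
Hypothesis Kk0 : omitted k0.

Let eD z : C := if z == P then 0 else (phi z - k0)^-1.
Let e z : C := eD (mob p z).

Let k0n : k0 != 0. Proof. by have := Kk0 o1 oP; rewrite phi0 eq_sym. Qed.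

Lemma eD_diff z : cabs z < 1 -> cdiff eD z.
Proof.
move=> z1; have [zP|zP] := eqVneq z P.
  rewrite zP; apply: (@cdiff_congr _ (fun y => (y - P) / (h y - k0 * (y - P)))).
    apply: near_imp phi_pole => y hy; rewrite /eD.
    case: eqVneq => [->|yP]; first by rewrite subrr mul0r.
    rewrite hy // -invf_div; congr (_^-1); field; by rewrite subr_eq0.
  apply: cdiff_div; first exact: cdiff_shift.
    by apply: cdiffB => //; apply: cdiffM; [exact: cdiff_cst|exact: cdiff_shift].
  by rewrite subrr mulr0 subr0.
apply: (@cdiff_congr _ (fun y => (phi y - k0)^-1)).
  by apply: near_imp (near_neq zP) => y /negbTE yP; rewrite /eD yP.
apply: cdiffV; last by rewrite subr_eq0; exact: Kk0.
by apply: cdiffB; [exact: dphi|exact: cdiff_cst].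
Qed.

Lemma eD_inj z w : cabs z < 1 -> cabs w < 1 -> eD z = eD w -> z = w.
Proof.
move=> z1 w1; rewrite /eD; case: eqVneq => [->|zP]; case: eqVneq => [->|wP] //.
- by move/esym/eqP; rewrite invr_eq0 subr_eq0 => /eqP E; have := Kk0 w1 wP; rewrite E eqxx.
- by move/eqP; rewrite invr_eq0 subr_eq0 => /eqP E; have := Kk0 z1 zP; rewrite E eqxx.
- by move/invr_inj/addIr; exact: iphi.
Qed.

Lemma e_diff z : cabs z < 1 -> cdiff e z.
Proof.
move=> z1; apply: (@cdiff_comp _ (mob p) eD); last by apply: eD_diff; exact: mob_disc.
by eexists; exact: mob_has_der.
Qed.

Lemma e_inj z w : cabs z < 1 -> cabs w < 1 -> e z = e w -> z = w.
Proof.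
move=> z1 w1 /eD_inj E; rewrite -(mobK p0 p1 z1) E ?mob_disc //; exact: mobK.
Qed.

Lemma e_zero : e 0 = 0. Proof. by rewrite /e mob0 /eD eqxx. Qed.

Lemma eE z : cabs z < 1 -> z != 0 -> e z = (phi (mob p z) - k0)^-1.
Proof. by move=> z1 z0; rewrite /e /eD (negbTE (mob_neqP p0 p1 z1 z0)). Qed.

Lemma inv_omittedE w : inv_omitted e w <-> omitted (w + k0).
Proof.
split=> [[->|H] z z1 zP|H].
- by rewrite add0r; exact: Kk0.
- have mz1 := mob_disc p0 p1 z1; have mz0 := mob_neq0 p0 p1 z1 zP.
  have := H _ mz1; rewrite eE // mobK //; apply: contra_neq => ->.
  by rewrite addrK.
- have [->|w0] := eqVneq w 0; [by left|right=> z z1].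
  have [->|z0] := eqVneq z 0; first by rewrite e_zero eq_sym invr_eq0.
  rewrite eE //; apply: contra_neq (H _ (mob_disc p0 p1 z1) (mob_neqP p0 p1 z1 z0)).
  by move/invr_inj => <-; rewrite subrK.
Qed.

Lemma inv_omitted_conv w1 w2 (t : R) : 0 <= t <= 1 -> inv_omitted e w1 -> inv_omitted e w2 ->
  inv_omitted e (t%:C * w1 + (1 - t)%:C * w2).
Proof.
move=> t01 /inv_omittedE K1 /inv_omittedE K2; apply/inv_omittedE.
have := Kconv t01 K1 K2; congr omitted.
by rewrite rmorphB /=; ring.
Qed.

Let Np z : C := if z == P then h P else phi z * (z - P).

Lemma Np_diff z : cabs z < 1 -> cdiff Np z.
Proof.
move=> z1; have [zP|zP] := eqVneq z P.
  rewrite zP; apply: cdiff_congr dh; apply: near_imp phi_pole => y hy.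
  rewrite /Np; case: eqVneq => [->//|yP]; by rewrite hy // divfK // subr_eq0.
apply: (@cdiff_congr _ (fun y => phi y * (y - P))).
  by apply: near_imp (near_neq zP) => y /negbTE yP; rewrite /Np yP.
by apply: cdiffM; [exact: dphi|exact: cdiff_shift].
Qed.

Let W z : C := - Np z * (1 - z * P) / P.

Lemma W_diff z : cabs z < 1 -> cdiff W z.
Proof.
move=> z1; apply: cdiff_div => //; last exact: cdiff_cst.
apply: cdiffM; first by apply: cdiffN; exact: Np_diff.
apply: cdiffB; first exact: cdiff_cst.
by apply: cdiffM; [exact: cdiff_id|exact: cdiff_cst].
Qed.

Lemma WE z : z != P -> W z = phi z * ((1 - z / P) * (1 - z * P)).
Proof. by move=> zP; rewrite /W /Np (negbTE zP); field. Qed.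

Lemma W0 : W 0 = 0. Proof. by rewrite WE // phi0 mul0r. Qed.

Lemma W_has_der0 : has_der W 0 1.
Proof.
have H : has_der (fun z => phi z * ((1 - z / P) * (1 - z * P))) 0 1.
  have [l hl] : cdiff (fun z => (1 - z / P) * (1 - z * P)) 0.
    exact: (cdiffM (cdiffB (cdiff_cst 1 0) (cdiff_div (cdiff_id 0) (cdiff_cst P 0) P0))
      (cdiffB (cdiff_cst 1 0) (cdiffM (cdiff_id 0) (cdiff_cst P 0)))).
  by have := has_derM dphi0 hl; rewrite phi0 !mul0r addr0 subr0 mulr1 mulr1.
apply: has_der_congr H; apply: near_imp (near_neq oP) => y yP; by rewrite WE.
Qed.

Let Y := dq W 0.
Let Vq := dq Y 0.
Definition omega z : C := - (1 + P ^+ 2) / P * Vq z - 1.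

Lemma Y_diff z : cabs z < 1 -> cdiff Y z.
Proof.
move=> z1; apply: cdiff_dq; first exact: W_diff.
by apply: near_imp (in_disc_near o1) => y; exact: W_diff.
Qed.

(** [omega] is obtained from the numerator [W] by two divisions by [z], both
    possible because of the normalisation at 0. *)
Lemma omega_diff z : cabs z < 1 -> cdiff omega z.
Proof.
move=> z1; apply: cdiffB; last exact: cdiff_cst.
apply: cdiffM; first exact: cdiff_cst.
apply: cdiff_dq; first exact: Y_diff.
by apply: near_imp (in_disc_near o1) => y; exact: Y_diff.
Qed.

Lemma W_omega z : W z = z - q * (1 + omega z) * z ^+ 2.
Proof.
have E1 : W z = Y z * z by have := dqP W 0 z; rewrite W0 !subr0.
have E2 : Y z = 1 + Vq z * z.
  have := dqP Y 0 z; rewrite subr0 {2}/Y dqaa (has_der_der W_has_der0) => <-.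
  by rewrite addrC subrK.
have q0 := pC2_neqN1 p0 p1.
by rewrite E1 E2 /omega; field; rewrite q0 P0.
Qed.

Lemma phi_omega z : cabs z < 1 -> z != P ->
  phi z = (z - q * (1 + omega z) * z ^+ 2) / ((1 - z / P) * (1 - z * P)).
Proof.
move=> z1 zP; rewrite -W_omega WE // mulfK // mulf_neq0 //.
  by rewrite subr_eq0 eq_sym; apply: contra_neq zP => E; rewrite -[z](divfK P0) E mul1r.
by rewrite mulrC; exact: mob_den.
Qed.

Lemma der_e_P : der e P = (1 - P ^+ 2)^-1 / k0 ^+ 2.
Proof.
have P2 := pC2_neq1 p0 p1.
have H1 : has_der (mob p) P (- (1 - P ^+ 2)^-1).
  by have := mob_has_der p0 p1 P1; congr has_der; rewrite -expr2; field; exact: P2.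
have H2 : has_der (fun y => (phi y - k0)^-1) (mob p P) (- 1 / k0 ^+ 2).
  rewrite mobP.
  have := has_derV (has_derB dphi0 (has_der_cst k0 0)); rewrite phi0 !sub0r subr0 oppr_eq0 sqrrN.
  by apply.
have H3 : has_der eD (mob p P) (- 1 / k0 ^+ 2).
  apply: has_der_congr H2; rewrite mobP; apply: near_imp (near_neq oP) => y /negbTE yP.
  by rewrite /eD yP.
rewrite (has_der_der (has_der_comp H1 H3)); field.
by rewrite P2 k0n.
Qed.

(** [suffridge_bound] at the point [p], which [mob p] sends to 0, where [phi] is
    normalised. *)
Lemma omega_ineq x : cabs x < 1 -> x != 0 -> x != P -> p < cabs (mob p x) ->
  cabs (mob p x) ^+ 2 * cabs (P ^+ 2 - omega x) <= cabs (1 - P ^+ 2 * omega x).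
Proof.
move=> x1 x0 xP; set eta := mob p x => pe.
have eta1 : cabs eta < 1 by exact: mob_disc.
have xE : x = mob p eta by rewrite /eta mobK.
have eta0 : eta != 0 by exact: mob_neq0.
have Peta : P != eta by rewrite xE -[P]mob0 in x0 *; apply: contra_neq x0 => <-; rewrite mob0 mobP.
have f0 : phi x != 0 by rewrite -phi0; apply: contra_neq x0; exact: iphi.
have cP : cabs P < cabs eta by rewrite cabs_pC.
clearbody eta.
pose S := suffridge e eta P.
have d1 := pC2_neq1 p0 p1.
have fk : phi x - k0 != 0 by rewrite subr_eq0; exact: Kk0.
have SE : S = - (2 * P) / ((1 - P ^+ 2) * phi x) + (P + eta) / (P - eta).
  rewrite /S (suffridgeE' e_diff e_inj e_zero eta1 eta0 P1 P0 Peta); congr (_ + _).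
  rewrite der_e_P !eE // mobP -xE phi0 sub0r.
  have E : (phi x - k0)^-1 - (- k0)^-1 = phi x / (k0 * (phi x - k0)).
    by field; rewrite k0n fk.
  by rewrite E; field; rewrite k0n fk f0 d1.
have alg := cayley_omega_alg (mob_den p0 p1 eta1) d1 (pC2_neqN1 p0 p1) P0 eta0 _ f0 xE (phi_omega x1 xP) SE.
have {}alg := alg ltac:(by rewrite subr_eq0).
have := suffridge_bound e_diff e_inj e_zero inv_omitted_conv eta1 eta0 cP; rewrite -/S cabs_pC // => H.
have S1 : S + 1 != 0 := suffridge1_neq0 e_diff e_inj e_zero inv_omitted_conv eta1 eta0 cP.
have := congr1 (@cabs R) alg; rewrite !cabsM cabs_pC // => E.
have s1 : 0 < cabs (S + 1) by rewrite cabs_gt0.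
suff : p * (cabs eta ^+ 2 * cabs (P ^+ 2 - omega x)) * cabs (S + 1) <=
       p * cabs (1 - P ^+ 2 * omega x) * cabs (S + 1) by rewrite (ler_pM2r s1) (ler_pM2l p0).
have -> : p * (cabs eta ^+ 2 * cabs (P ^+ 2 - omega x)) * cabs (S + 1) =
  cabs eta * (p * cabs eta * cabs (P ^+ 2 - omega x) * cabs (S + 1)) by ring.
rewrite -E mulrA [X in _ <= X]mulrAC; apply: ler_wpM2r; first exact: cabs_ge0.
exact: H.
Qed.

End WithOmitted.

Lemma omega_le1 z : cabs z < 1 -> cabs (omega z) <= 1.
Proof.
have p0' := p0; have p1' := p1.
have [k0 Kk0] := omitted_nonempty.
apply: (@max_principle R (fun z => cabs z < 1) omega 1 1) => //.
- by move=> y; exact: in_disc_near.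
- by move=> y /ltW.
- by move=> y; exact: omega_diff.
move=> y ny s s0.
pose D := (1 - (p ^+ 2) ^+ 2) * (1 - (1 + s) ^- 2).
have a1 : p ^+ 2 < 1 by rewrite expr_lt1 // ltW.
have a0 : 0 < p ^+ 2 by rewrite exprn_gt0.
have D0 : 0 < D.
  rewrite mulr_gt0 // subr_gt0; first by rewrite expr_lt1 // ltW.
  by rewrite invf_lt1 ?exprn_gt0 ?exprn_egt1 //; lra.
pose k := Num.min (1 - p ^+ 2) (D / 8).
have k0' : 0 < k by rewrite lt_min subr_gt0 a1 divr_gt0.
have k1 : k <= 1 - p ^+ 2 by rewrite ge_min lexx.
have k2 : k <= D / 8 by rewrite ge_min lexx orbT.
pose d := k * (1 - p) / 4.
have p1'' : 0 < 1 - p by lra.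
have d0 : 0 < d by rewrite divr_gt0 // mulr_gt0.
have kp : k * (1 - p) <= k by rewrite ler_piMr // ?ltW //; lra.
have yd : 1 - d < cabs (y - 0).
  by rewrite subr0; move/negP: ny; rewrite -leNgt => ny; lra.
apply: near_imp (near_far yd) => x; rewrite subr0 => xd x1.
have x2 : 1 - k * (1 - p) / 2 < cabs x ^+ 2.
  apply: (@lt_le_trans _ _ ((1 - d) ^+ 2)); last first.
    by rewrite ler_pXn2r ?nnegrE ?cabs_ge0 ?(ltW xd) // /d; lra.
  by have := exprn_gt0 2 d0; rewrite /d; lra.
have xp : p ^+ 2 < cabs x ^+ 2 by lra.
have x0 : x != 0 by apply: contraTneq xp => ->; rewrite cabs0 expr0n -leNgt ltW.
have xP : x != P by apply: contraTneq xp => ->; rewrite cabs_pC // ltxx.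
have mb := mob_boundary p0 p1 x1.
have m1 : 1 - cabs (mob p x) ^+ 2 < k.
  apply: le_lt_trans mb _.
  have -> : k = 2 / (1 - p) * (k * (1 - p) / 2) by field; rewrite gt_eqF.
  by rewrite ltr_pM2l ?divr_gt0 //; lra.
have mp : p < cabs (mob p x).
  by rewrite -(@ltr_pXn2r _ 2) ?nnegrE ?cabs_ge0 ?ltW //; lra.
have := omega_ineq Kk0 x1 x0 xP mp.
rewrite -[P ^+ 2](rmorphXn (real_complex R)).
apply: blaschke_bound => //.
- by rewrite a0.
- by rewrite exprn_ge0 ?cabs_ge0 //= expr_le1 ?cabs_ge0 // ltW // mob_disc.
- by rewrite -/D; lra.
Qed.

(** The residue [A] is computed from the formula with [omega] by letting [z] tend
    to 0. *)
Lemma pole_bound : exists A b : C, cabs A <= p ^+ 2 / (1 - p ^+ 2) ^+ 2 /\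
  forall z, cabs z < 1 -> z != 0 -> cabs (phi (mob p z) - A / z - b) <= cabs A / cabs z.
Proof.
have [k0 Kk0] := omitted_nonempty.
pose e z := if mob p z == P then 0 else (phi (mob p z) - k0)^-1.
have ed : forall z, cabs z < 1 -> cdiff e z := e_diff Kk0.
have ei : forall z w, cabs z < 1 -> cabs w < 1 -> e z = e w -> z = w := e_inj Kk0.
have e0 : e 0 = 0 := e_zero k0.
have eK := inv_omitted_conv Kk0.
have eE z : cabs z < 1 -> z != 0 -> e z = (phi (mob p z) - k0)^-1 := @eE k0 z.
have a0 := der_e_neq0 ed ei o1.
pose A := (der e 0)^-1.
exists A; exists (k0 - der (dq e 0) 0 / der e 0 ^+ 2); split; last first.
  move=> z z1 z0; have := suffridge_pole ed ei e0 eK z1 z0.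
  by rewrite eE // invrK -/A; congr (cabs _ <= _); ring.
pose W z := z - P / (1 + P ^+ 2) * (1 + omega z) * z ^+ 2.
have d1 := pC2_neq1 p0 p1; have d2 := pC2_neqN1 p0 p1.
have dW z : cabs z < 1 -> cdiff W z.
  move=> z1; apply: cdiffB; first exact: cdiff_id.
  apply: cdiffM; last by apply: cdiffX; exact: cdiff_id.
  apply: cdiffM; first exact: cdiff_cst.
  by apply: cdiffD; [exact: cdiff_cst|exact: omega_diff].
pose g z := P / (1 - P ^+ 2) ^+ 2 * W (mob p z) * (1 - P * z) ^+ 2 - k0 * z.
have cg : cont g 0.
  apply: cdiff_cont; apply: cdiffB; last by apply: cdiffM; [exact: cdiff_cst|exact: cdiff_id].
  apply: cdiffM; last first.
    apply: cdiffX; apply: cdiffB; first exact: cdiff_cst.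
    by apply: cdiffM; [exact: cdiff_cst|exact: cdiff_id].
  apply: cdiffM; first exact: cdiff_cst.
  apply: (@cdiff_comp _ (mob p) W); last by apply: dW; exact: mob_disc.
  by eexists; exact: mob_has_der.
have ce : cont (fun z => (dq e 0 z)^-1) 0.
  apply: contV; last by rewrite dqaa.
  by apply: der_spec; exact: ed.
have : (dq e 0 0)^-1 = g 0.
  apply: (cont_uniq ce cg).
  apply: near_imp (in_disc_near o1) => z z1 z0.
  have mz := mob_den p0 p1 z1.
  rewrite dqE // e0 !subr0 eE // invfM !invrK /g.
  rewrite (@phi_omega _ (mob_disc p0 p1 z1) (mob_neqP p0 p1 z1 z0)).
  rewrite -/(W _).
  have k1 : 1 - mob p z / P = z * (1 - P ^+ 2) / (P * (1 - P * z)).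
    by rewrite /mob; field; rewrite mz P0.
  have k2 : 1 - mob p z * P = (1 - P ^+ 2) / (1 - P * z) by rewrite /mob; field.
  rewrite k1 k2; move: (W _) => w; field.
  by rewrite d1 z0 mz P0.
rewrite dqaa -/A /g mob0 !mulr0 !subr0 expr1n mulr1 => ->.
have -> : P / (1 - P ^+ 2) ^+ 2 * W P = (P ^+ 2 / (1 - P ^+ 2) ^+ 2) * ((1 - P ^+ 2 * omega P) / (1 + P ^+ 2)).
  by rewrite /W; field; rewrite d1 d2.
have p2 : 0 <= p ^+ 2 / (1 - p ^+ 2) ^+ 2 by rewrite divr_ge0 ?sqr_ge0.
have E : P ^+ 2 / (1 - P ^+ 2) ^+ 2 = (p ^+ 2 / (1 - p ^+ 2) ^+ 2)%:C.
  by rewrite fmorph_div /= !rmorphXn rmorphB rmorph1 rmorphXn.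
rewrite E cabsM cabs_pos // ler_piMr // cabs_div.
have q1 : 0 < 1 + p ^+ 2 by rewrite ltr_pwDl ?sqr_ge0.
have -> : cabs (1 + P ^+ 2) = 1 + p ^+ 2.
  by rewrite -(rmorphXn (real_complex R)) -(rmorph1 (real_complex R)) -rmorphD cabs_pos // ltW.
rewrite ler_pdivrMr // mul1r; apply: le_trans (ler_cabsB _ _) _.
rewrite cabs1 lerD2l cabsM cabsX cabs_pC // ler_piMr ?sqr_ge0 //.
exact: omega_le1.
Qed.

End ConcaveFunction.

(** * The closed convex class *)

Section Bridge.
Variable R : realType.
Local Notation C := R[i].

Lemma posC (e : C) : 0 < e -> e = (Re e)%:C /\ 0 < Re e.
Proof. by case: e => a b; rewrite ltcE /= => /andP[/eqP -> a0]. Qed.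

Lemma nbhs_nearC (a : C) (Q : C -> Prop) : nbhs a Q <-> nearC a Q.
Proof.
split.
  move/nbhs_ballP => [e /= e0 H].
  have [eE e0'] := posC e0.
  exists (Re e) => // z za; apply: H; rewrite eE.
  rewrite /ball /=.
  by rewrite cabsE ltcR cabsBC.
move=> [d d0 H]; apply/nbhs_ballP; exists (d%:C) => /=; first by rewrite ltcR.
move=> z. rewrite /ball /= => za; apply: H. by rewrite -ltcR -cabsE distrC.
Qed.

Lemma dnbhs_nearC (a : C) (Q : C -> Prop) :
  (dnbhs a) Q <-> nearC a (fun z => z != a -> Q z).
Proof. exact: nbhs_nearC. Qed.

Lemma has_der_cvg (f : C -> C) (a l : C) :
  (fun h : C => h^-1 *: ((f \o shift a) (h *: (1 : C)) - f a)) @ 0^' --> l <->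
  has_der f a l.
Proof.
have simp (h : C) : h != 0 ->
   h^-1 *: ((f \o shift a) (h *: (1 : C)) - f a) = dqv f a l (a + h).
  move=> h0; rewrite /dqv -subr_eq0 addrAC subrr add0r (negbTE h0).
  by rewrite /= /shift /= [h *: 1]mulr1 [h + a]addrC mulrC.
split=> [H e e0|H].
  have : nbhs l (fun w => cabs (w - l) < e) by apply/nbhs_nearC; exists e.
  move/H/dnbhs_nearC => [d d0 Hd]; exists d => // z zd; rewrite dqvaa.
  have [->|za] := eqVneq z a; first by rewrite dqvaa subrr cabs0.
  have za' : z - a != 0 by rewrite subr_eq0.
  have K := Hd (z - a); rewrite subr0 in K.
  by have E := simp _ za'; rewrite [a + _]addrC subrK in E; rewrite -E; exact: K.
move=> A /nbhs_nearC [e e0 He]; have [d d0 Hd] := H e e0.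
apply/dnbhs_nearC; exists d => // h; rewrite subr0 => hd0 h0.
have E := simp _ h0; rewrite /preimage /mkset E; apply: He.
by have := Hd (a + h); rewrite addrAC subrr add0r dqvaa; apply.
Qed.

Lemma derivable_diff (f : C -> C) (a : C) : derivable f a 1 <-> cdiff f a.
Proof.
split=> [/cvg_ex[l /has_der_cvg H]|[l H]]; first by exists l.
by apply/cvg_ex; exists l; apply/has_der_cvg.
Qed.

Lemma derive1_has_der (f : C -> C) (a l : C) : has_der f a l -> derive1 f a = l.
Proof.
move=> /has_der_cvg H; rewrite derive1E; apply: cvg_lim => //.
Qed.


Lemma unit_discE (z : C) : unit_disc z <-> cabs z < 1.
Proof. by rewrite /unit_disc /= cabsE -ltcR. Qed.

Lemma punctured_discE (p : R) (z : C) : punctured_disc p z <-> cabs z < 1 /\ z != p%:C.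
Proof.
rewrite /punctured_disc; split=> [[/unit_discE h1 h2]|[h1 /eqP h2]]; split=> //.
  by apply/eqP.
by apply/unit_discE.
Qed.

Lemma convexC (A : set C) (x y : C) (t : R) : convex_set A -> 0 <= t <= 1 ->
  A x -> A y -> A (t%:C * x + (1 - t)%:C * y).
Proof.
move=> cA /andP[t0 t1] Ax Ay.
have t0' : 0 <= t%:C by rewrite lecR.
have t1' : t%:C <= 1 by rewrite lecR.
have := cA x y (Itv01 t0' t1'); rewrite !inE => /(_ Ax Ay).
by rewrite rmorphB /=.
Qed.

Lemma convex_funs (A : set (C -> C)) :
  (forall (f g : C -> C) (t : R), 0 <= t <= 1 -> A f -> A g ->
     A (fun z => t%:C * f z + (1 - t)%:C * g z)) -> convex_set A.
Proof.
move=> H f g k; rewrite !inE => Af Ag.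
have k0 : 0 <= k%:num by [].
have k1 : k%:num <= 1 by [].
have [t kE] : exists t : R, k%:num = t%:C.
  by exists (Re k%:num); apply/eqP; rewrite eq_complex /= eqxx (ger0_Im k0) eqxx.
have := H f g t; rewrite -(lecR t) -(lecR 0) -kE k0 => /(_ k1 Af Ag).
by rewrite rmorphB /= -kE.
Qed.

(** Finite sets are compact, so a locally uniform closure point can be
    approximated at finitely many points. *)
Lemma closed_by_points (U : set C) (A : set (C -> C)) :
  (forall f, (forall s : seq C, (forall z, z \in s -> U z) -> forall e : R, 0 < e ->
     exists2 g, A g & forall z, z \in s -> cabs (g z - f z) < e) -> A f) ->
  closed (A : set {family compactly_in U, C -> C}).
Proof.
move=> H f clf; apply: H => s sU e e0.
pose E : set (C * C) := [set xy | ball xy.1 (e%:C) xy.2].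
have entE : entourage E.
  by rewrite -entourage_ballE; exists e%:C => //=; rewrite ltcR.
have cs : compactly_in U [set` s].
  split; first by move=> z; exact: sU.
  by apply: finite_compact; exact: finite_seq.
have [g [Ag Hg]] := clf _ (@fam_nbhs C C (compactly_in U) _ E f entE cs).
exists g => // z zs; have := Hg z zs.
by rewrite /E /= /ball /= cabsE ltcR cabsBC.
Qed.

End Bridge.

Section OmegaClass.
Variable R : realType.
Local Notation C := R[i].
Variable p : R.
Hypotheses (p0 : 0 < p) (p1 : p < 1).
Local Notation P := (p%:C : C).
Local Notation q := (P / (1 + P ^+ 2)).

Definition omega_form (om : C -> C) (z : C) : C :=
  (z - q * (1 + om z) * z ^+ 2) / ((1 - z / P) * (1 - z * P)).

Lemma qE : (p / (1 + p ^+ 2))%:C = q.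
Proof. by rewrite fmorph_div rmorphD rmorph1 rmorphXn. Qed.

Lemma omega_classE (f : C -> C) : omega_class p f <->
  exists om : C -> C, [/\ forall z, cabs z < 1 -> cdiff om z,
    forall z, cabs z < 1 -> cabs (om z) <= 1 &
    forall z, cabs z < 1 -> z != P -> f z = omega_form om z].
Proof.
have le1 (w : C) : (`|w| <= 1) = (cabs w <= 1) by rewrite cabsE -lecR.
split=> [[om hom fE]|[om [dom bom fE]]]; exists om.
- split=> z z1.
  + by have [/derivable_diff] := hom z (proj2 (unit_discE z) z1).
  + by have [_] := hom z (proj2 (unit_discE z) z1); rewrite le1.
  + move=> zP; have := fE z (proj2 (punctured_discE p z) (conj z1 zP)).
    by rewrite qE.
- move=> z /unit_discE z1; split; first by apply/derivable_diff; exact: dom.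
  by rewrite le1; exact: bom.
- by move=> z /punctured_discE[z1 zP]; rewrite fE // /omega_form -qE.
Qed.

Let P0 : P != 0. Proof. exact: pC_neq0. Qed.
Let q0 : q != 0. Proof. by rewrite mulf_neq0 ?invr_eq0 // pC2_neqN1. Qed.

Lemma omega_form_den (z : C) : cabs z < 1 -> z != P -> (1 - z / P) * (1 - z * P) != 0.
Proof.
move=> z1 zP; rewrite mulf_neq0 //; last by rewrite mulrC; exact: mob_den.
by rewrite subr_eq0 eq_sym; apply: contra_neq zP => E; rewrite -[z](divfK P0) E mul1r.
Qed.

Lemma omega_class_convex : convex_set (omega_class p).
Proof.
apply: convex_funs => f g t t01 /omega_classE[u [du bu fu]] /omega_classE[v [dv bv gv]].
have t0 : 0 <= t by case/andP: t01.
have t1 : 0 <= 1 - t by rewrite subr_ge0; case/andP: t01.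
apply/omega_classE; exists (fun z => t%:C * u z + (1 - t)%:C * v z); split=> z z1.
- exact: (cdiffD (cdiffM (cdiff_cst _ _) (du z z1)) (cdiffM (cdiff_cst _ _) (dv z z1))).
- apply: le_trans (ler_cabsD _ _) _; rewrite !cabsM !cabs_pos //.
  have := ler_wpM2l t0 (bu z z1); have := ler_wpM2l t1 (bv z z1); lra.
- move=> zP; rewrite fu // gv // /omega_form rmorphB rmorph1.
  have := omega_form_den z1 zP; move: (_ * _) => D D0; field.
  by rewrite ?D0 ?pC2_neqN1.
Qed.

Lemma cont_norm_le (f : C -> C) (a : C) (B : R) : cont f a -> 
  nearC a (fun z => z != a -> cabs (f z) <= B) -> cabs (f a) <= B.
Proof.
move=> cf H; rewrite leNgt; apply/negP => h.
have e0 : 0 < cabs (f a) - B by lra.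
have [d d0 Hd] := near_and H (cf _ e0).
pose z := a + (d / 2)%:C.
have za : cabs (z - a) = d / 2 by rewrite /z addrAC subrr add0r cabs_pos //; lra.
have [] := Hd z; first by rewrite za; lra.
have zna : z != a by rewrite -cabs_sub_gt0 za; lra.
by move=> /(_ zna) h1 h2; have := lerB_cabs (f a) (f z); rewrite cabsBC; lra.
Qed.

Lemma min_tolerance (s : seq C) (c : C -> R) : (forall z, z \in s -> 0 < c z) ->
  exists2 e : R, 0 < e & forall z, z \in s -> e <= c z.
Proof.
elim: s => [|a s IH] H; first by exists 1.
have [|e e0 He] := IH; first by move=> z zs; apply: H; rewrite inE zs orbT.
exists (Num.min (c a) e); first by rewrite lt_min e0 andbT; apply: H; rewrite inE eqxx.
move=> z; rewrite inE => /orP[/eqP->|/He h]; first by rewrite ge_min lexx.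
by rewrite ge_min h orbT.
Qed.

(** Off 0 and [p] the formula determines [omega] from [f], continuously at each
    point, so the functions [omega] of approximants converge pointwise to a
    holomorphic function bounded by 1, whose singularities at 0 and [p] are
    removable. *)
Lemma omega_class_closed :
  closed (omega_class p : set {family compactly_in (punctured_disc p), C -> C}).
Proof.
apply: closed_by_points => f Hf.
pose D (z : C) := (1 - z / P) * (1 - z * P).
pose w z := (z - f z * D z) / (q * z ^+ 2) - 1.
have wE (g u : C -> C) z : cabs z < 1 -> z != P -> z != 0 -> g z = omega_form u z ->
    u z = (z - g z * D z) / (q * z ^+ 2) - 1.
  move=> z1 zP z0 ->; rewrite /omega_form -/(D z) divfK; last exact: omega_form_den.
  by field; rewrite z0 P0 pC2_neqN1.
(* Approximation of [f] at finitely many points yields approximation of [w] there. *)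
have approx (s : seq C) (e : R) : 0 < e ->
    (forall z, z \in s -> [/\ cabs z < 1, z != P & z != 0]) ->
    exists u : C -> C, [/\ forall z, cabs z < 1 -> cdiff u z,
      forall z, cabs z < 1 -> cabs (u z) <= 1 &
      forall z, z \in s -> cabs (u z - w z) < e].
  move=> e0 Hs.
  have [z zs|e' e'0 He'] := @min_tolerance s (fun z => e * cabs (q * z ^+ 2) / cabs (D z)).
    have [z1 zP z0] := Hs z zs.
    apply: divr_gt0; last by rewrite cabs_gt0; exact: omega_form_den.
    apply: mulr_gt0 => //; rewrite cabs_gt0; apply: mulf_neq0; first exact: q0.
    by rewrite expf_neq0.
  have [z zs|g /omega_classE[u [du bu gu]] Hg] := Hf s _ e' e'0.
    by have [z1 zP z0] := Hs z zs; apply/punctured_discE.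
  exists u; split=> // z zs; have [z1 zP z0] := Hs z zs.
  rewrite (wE g u) ?gu // /w -gu //.
  have Q0 : q * z ^+ 2 != 0 by apply: mulf_neq0; [exact: q0|rewrite expf_neq0].
  have D0 : D z != 0 by exact: omega_form_den.
  have -> : (z - g z * D z) / (q * z ^+ 2) - 1 - ((z - f z * D z) / (q * z ^+ 2) - 1) =
     - (g z - f z) * D z / (q * z ^+ 2) by ring.
  rewrite cabs_div cabsM cabsN ltr_pdivrMr ?cabs_gt0 // -ltr_pdivlMr ?cabs_gt0 //.
  exact: lt_le_trans (Hg z zs) (He' z zs).
pose U (z : C) := [/\ cabs z < 1, z != P & z != 0].
have bw z : U z -> cabs (w z) <= 1.
  move=> Uz; apply/ler_addgt0Pr => e e0.
  have [|u [_ bu Hu]] := approx [:: z] e e0; first by move=> y; rewrite inE => /eqP->.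
  have [z1 _ _] := Uz; have := Hu z; rewrite inE eqxx => /(_ isT); rewrite cabsBC => h.
  by have := lerB_cabs (w z) (u z); have := bu z z1; lra.
have nearU z : U z -> nearC z U.
  move=> [z1 zP z0]; apply: near_imp (near_and (in_disc_near z1) (near_and (near_neq zP) (near_neq z0))).
  by move=> y [? []].
have dw z : U z -> cdiff w z.
  move=> Uz; have [r r0 Hr] := nearU z Uz.
  apply: (@cdiff_limit R w z r 1 r0) => y k yr kr e e0.
  have [|u [du bu Hu]] := approx [:: z; y; k] e e0.
    by move=> x; rewrite !inE => /or3P[]/eqP-> //; exact: Hr.
  exists u; split.
  - by move=> x /Hr[x1 _ _]; exact: du.
  - by move=> x /Hr[x1 _ _]; exact: bu.
  - by split; apply: Hu; rewrite !inE eqxx ?orbT.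
have o1 : cabs (0 : C) < 1 by rewrite cabs0 ltr01.
have oP : (0 : C) != P by rewrite eq_sym.
have P1 : cabs P < 1 by rewrite cabs_pC.
have [l0 Hl0] : exists l, cdiff (fun z => if z == 0 then l else w z) 0.
  have [r r0 Hr] := near_and (in_disc_near o1) (near_neq oP).
  apply: (@removable R w 0 r 1) => // z /Hr[z1 zP] z0; first exact: dw.
  exact: bw.
have [lP HlP] : exists l, cdiff (fun z => if z == P then l else w z) P.
  have [r r0 Hr] := near_and (in_disc_near P1) (near_neq P0).
  apply: (@removable R w P r 1) => // z /Hr[z1 zP] z0; first exact: dw.
  exact: bw.
pose om z := if z == 0 then l0 else if z == P then lP else w z.
have omE z : U z -> om z = w z by move=> [_ /negbTE zP /negbTE z0]; rewrite /om z0 zP.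
have d_om z : cabs z < 1 -> cdiff om z.
  move=> z1; have [->|z0] := eqVneq z 0.
    apply: cdiff_congr Hl0; apply: near_imp (near_neq oP) => y /negbTE yP.
    by rewrite /om yP.
  have [->|zP] := eqVneq z P.
    apply: cdiff_congr HlP; apply: near_imp (near_neq P0) => y /negbTE y0.
    by rewrite /om y0.
  have Uz : U z by [].
  by apply: cdiff_congr (dw z Uz); apply: near_imp (nearU z Uz) => y /omE.
apply/omega_classE; exists om; split=> // z z1.
  have [z0|z0] := eqVneq z 0.
    apply: cont_norm_le; first exact: cdiff_cont (d_om z z1).
    rewrite z0; apply: near_imp (near_and (in_disc_near o1) (near_neq oP)) => y [y1 yP] y0.
    by rewrite omE //; exact: bw.
  have [zP|zP] := eqVneq z P.
    apply: cont_norm_le; first exact: cdiff_cont (d_om z z1).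
    rewrite zP; apply: near_imp (near_and (in_disc_near P1) (near_neq P0)) => y [y1 y0] yP.
    by rewrite omE //; exact: bw.
  by rewrite omE //; exact: bw.
move=> zP; have [z0|z0] := eqVneq z 0.
  rewrite z0 /omega_form expr0n mulr0 subr0 mul0r; apply/eqP; rewrite -cabs_eq0.
  apply/eqP/le_anti; rewrite cabs_ge0 andbT; apply/ler_addgt0Pl => e e0; rewrite addr0.
  have [y|g /omega_classE[u [du bu gu]] Hg] := Hf [:: 0] _ e e0.
    by rewrite inE => /eqP->; apply/punctured_discE.
  have := Hg 0; rewrite inE eqxx => /(_ isT).
  by rewrite gu // /omega_form expr0n mulr0 subr0 mul0r sub0r cabsN => /ltW.
rewrite /omega_form omE // /w.
have D0 : D z != 0 by exact: omega_form_den.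
rewrite -/(D z); move: D0; move: (D z) => d d0; field.
by rewrite d0 z0 P0 pC2_neqN1.
Qed.

End OmegaClass.

(** * Concave functions and the separating functional *)

Section CoClass.
Variable R : realType.
Local Notation C := R[i].
Variable p : R.
Hypotheses (p0 : 0 < p) (p1 : p < 1).
Local Notation P := (p%:C : C).

(** By injectivity [p] is the only pole, so all the data are conditions on the
    finite part of [f]. *)
Lemma Co_unpack f : Co p f -> exists h : C -> C, let phi := finite_part f in
  [/\ [/\ forall z, cabs z < 1 -> z != P -> cdiff phi z, cdiff h P, h P != 0 &
      nearC P (fun z => z != P -> phi z = h z / (z - P))],
    forall z w, cabs z < 1 -> z != P -> cabs w < 1 -> w != P -> phi z = phi w -> z = w,
    phi 0 = 0 /\ has_der phi 0 1 &
    forall w1 w2 (t : R), 0 <= t <= 1 -> omitted p phi w1 -> omitted p phi w2 ->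
      omitted p phi (t%:C * w1 + (1 - t)%:C * w2)].
Proof.
move=> [[mero [_ fP [h [hh hP fh]]]] [f0 f1] [_ inj] [K cK KE]].
have P1 : cabs P < 1 by rewrite cabs_pC.
have o1 : cabs (0 : C) < 1 by rewrite cabs0 ltr01.
have oP : (0 : C) != P by rewrite eq_sym pC_neq0.
have injf z w : cabs z < 1 -> cabs w < 1 -> f z = f w -> z = w.
  by move=> z1 w1; apply: inj; rewrite inE; apply/unit_discE.
have fin z : cabs z < 1 -> z != P -> f z = finite (finite_part f z).
  move=> z1 zP; rewrite /finite_part; case fz: (f z) => [w|] //.
  by have /eqP := injf z P z1 P1 ltac:(by rewrite fz fP); rewrite (negbTE zP).
exists h => phi.
have dphi z : cabs z < 1 -> z != P -> cdiff phi z.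
  move=> z1 zP; case: (mero z (proj2 (unit_discE z) z1)) => [[g hg fg]|[n [_ fz _]]].
    have dg := near_self (proj1 (nbhs_nearC _ _) hg).
    move/nbhs_nearC: fg => fg; apply: cdiff_congr (proj1 (derivable_diff g z) dg).
    by apply: near_imp fg => y fy; rewrite /phi /finite_part fy.
  by have := fin z z1 zP; rewrite fz.
split.
- split=> //.
    by apply/derivable_diff; exact: near_self (proj1 (nbhs_nearC _ _) hh).
  move/dnbhs_nearC: fh; apply: near_imp => z H zP.
  by rewrite /phi /finite_part H // expr1.
- by move=> z w z1 zP w1 wP E; apply: injf => //; rewrite !fin // -/phi E.
- have ph0 : phi 0 = 0 by rewrite /phi /finite_part f0.
  split=> //; have [l hl] := dphi 0 o1 oP.
  suff -> : 1 = l :> C by [].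
  by rewrite -(derive1_has_der hl); apply/esym/eqP; rewrite -subr_eq0; apply/eqP.
have omE w : omitted p phi w <-> K w.
  have KE' : (~` (f @` @unit_disc R)) (finite w) <-> (@finite R @` K) (finite w) by rewrite KE.
  split=> [ow|Kw].
    have /KE' [w' Kw' [<-//]] : (~` (f @` @unit_disc R)) (finite w).
    move=> [z /unit_discE z1 fz]; have [zP|zP] := eqVneq z P.
      by move: fz; rewrite zP fP.
    by have := ow z z1 zP; rewrite /phi /finite_part fz eqxx.
  move=> z z1 zP; apply/negP => /eqP zw.
  have /KE' : (@finite R @` K) (finite w) by exists w.
  apply; exists z; first by apply/unit_discE.
  by rewrite fin // -/phi zw.
by move=> w1 w2 t t01 /omE K1 /omE K2; apply/omE; exact: convexC.
Qed.

Lemma Co_omega_class f : Co p f -> omega_class p (finite_part f).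
Proof.
move=> /Co_unpack[h [[d1 d2 d3 d4] ii [z0 dz] Kc]].
apply/omega_classE; exists (omega p (finite_part f) h); split.
- by move=> z; exact: omega_diff.
- by move=> z; exact: omega_le1.
- by move=> z z1 zP; rewrite /omega_form; exact: phi_omega.
Qed.

(** On Laurent series in the variable of [mob p] this filter keeps the exponents
    congruent to 1 modulo 4; in particular it ignores the polar part and the
    constant term. *)
Definition mod4_filter (s : R) (g : C -> C) : C :=
  g (mob p s%:C) - g (mob p (- s%:C))
  - 'i%C * g (mob p ('i%C * s%:C)) + 'i%C * g (mob p (- ('i%C * s%:C))).

Lemma mod4_filter_points (s : R) (z : C) : 0 < s < 1 ->
  z \in [:: s%:C; - s%:C; 'i%C * s%:C; - ('i%C * s%:C)] -> cabs z = s.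
Proof.
move=> /andP[s0 s1].
have ss : cabs (s%:C : C) = s by rewrite cabs_pos // ltW.
by rewrite !inE => /or4P[]/eqP->; rewrite ?cabsN ?cabsM ?cabs_i ?ss ?mul1r.
Qed.

Lemma mod4_filter_affine (A b : C) (s : R) (u : C -> C) : 0 < s ->
  let g z := A / z + b + u z in
  g s%:C - g (- s%:C) - 'i%C * g ('i%C * s%:C) + 'i%C * g (- ('i%C * s%:C)) =
  u s%:C - u (- s%:C) - 'i%C * u ('i%C * s%:C) + 'i%C * u (- ('i%C * s%:C)).
Proof.
move=> s0 g; rewrite /g.
have sn : (s%:C : C) != 0 by rewrite -cabs_gt0 cabs_pos // ltW.
have i2 : 'i%C * 'i%C = -1 :> C by rewrite -expr2 sqr_i.
have iv : ('i%C : C)^-1 = - 'i%C.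
  have i0 : 'i%C != 0 :> C by rewrite -cabs_gt0 cabs_i.
  by apply: (mulfI i0); rewrite mulfV // mulrN i2 opprK.
have E1 : A / (- s%:C) = - (A / s%:C) by rewrite invrN mulrN.
have E2 : A / ('i%C * s%:C) = - 'i%C * (A / s%:C) by rewrite invfM iv; ring.
have E3 : A / (- ('i%C * s%:C)) = 'i%C * (A / s%:C) by rewrite invrN invfM iv; ring.
rewrite E1 E2 E3; move: (A / _) => a.
transitivity (2 * a * (1 + 'i%C * 'i%C) + (u s%:C - u (- s%:C) - 'i%C * u ('i%C * s%:C) + 'i%C * u (- ('i%C * s%:C)))).
  ring.
by rewrite i2 subrr mulr0 add0r.
Qed.

Lemma Co_filter_le f (s : R) : Co p f -> 0 < s < 1 ->
  cabs (mod4_filter s (finite_part f)) <= 4 * (p ^+ 2 / (1 - p ^+ 2) ^+ 2) / s.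
Proof.
move=> /Co_unpack[h [[d1 d2 d3 d4] ii [z0 dz] Kc]] s01; have /andP[s0 s1] := s01.
have [A [b [Ab HA]]] := pole_bound p0 p1 d1 d2 d3 d4 ii z0 dz Kc.
set phi := finite_part f in HA *.
pose u z := phi (mob p z) - A / z - b.
have E : mod4_filter s phi = u s%:C - u (- s%:C) - 'i%C * u ('i%C * s%:C) + 'i%C * u (- ('i%C * s%:C)).
  by rewrite -(mod4_filter_affine A b u s0) /mod4_filter /u; congr (_ - _ - _ * _ + _ * _); ring.
have ub z : z \in [:: s%:C; - s%:C; 'i%C * s%:C; - ('i%C * s%:C)] ->
    cabs (u z) <= p ^+ 2 / (1 - p ^+ 2) ^+ 2 / s.
  move=> zs; have cz := mod4_filter_points s01 zs.
  have zn : z != 0 by rewrite -cabs_gt0 cz.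
  apply: le_trans (HA z _ zn) _; first by rewrite cz.
  by rewrite cz ler_wpM2r // invr_ge0 ltW.
have b1 := ub s%:C ltac:(by rewrite !inE eqxx).
have b2 := ub (- s%:C) ltac:(by rewrite !inE eqxx ?orbT).
have b3 := ub ('i%C * s%:C) ltac:(by rewrite !inE eqxx ?orbT).
have b4 := ub (- ('i%C * s%:C)) ltac:(by rewrite !inE eqxx ?orbT).
rewrite E; apply: le_trans (ler_cabsD _ _) _; rewrite cabsM cabs_i mul1r.
apply: le_trans (lerD (ler_cabsB _ _) (lexx _)) _; rewrite cabsM cabs_i mul1r.
apply: le_trans (lerD (lerD (ler_cabsB _ _) (lexx _)) (lexx _)) _.
lra.
Qed.

Definition half_space (s c : R) : set (C -> C) := [set g | Re (mod4_filter s g) <= c].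

Lemma half_space_convex (s c : R) : convex_set (half_space s c).
Proof.
apply: convex_funs => f g t /andP[t0 t1]; rewrite /half_space /= => hf hg.
have -> : mod4_filter s (fun z => t%:C * f z + (1 - t)%:C * g z) =
  t%:C * mod4_filter s f + (1 - t)%:C * mod4_filter s g by rewrite /mod4_filter; ring.
rewrite ReD !Re_real_mul.
have t1' : 0 <= 1 - t by lra.
have := ler_wpM2l t0 hf; have := ler_wpM2l t1' hg; lra.
Qed.

Lemma half_space_closed (s c : R) : 0 < s < 1 ->
  closed (half_space s c : set {family compactly_in (punctured_disc p), C -> C}).
Proof.
move=> s01; have /andP[s0 s1] := s01; apply: closed_by_points => f Hf.
rewrite /half_space /=; apply/ler_addgt0Pr => e e0.
pose pts : seq C := [:: s%:C; - s%:C; 'i%C * s%:C; - ('i%C * s%:C)].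
have [z|g hg Hg] := Hf (map (mob p) pts) _ (e / 4) ltac:(by rewrite divr_gt0).
  move=> /mapP[w wp ->]; have cw := mod4_filter_points s01 wp.
  have w1 : cabs w < 1 by rewrite cw.
  have wn : w != 0 by rewrite -cabs_gt0 cw.
  by apply/punctured_discE; split; [exact: mob_disc|exact: mob_neqP].
have cl w : w \in pts -> cabs (g (mob p w) - f (mob p w)) <= e / 4.
  by move=> wp; apply: ltW; apply: Hg; exact: map_f.
have b1 := cl s%:C ltac:(by rewrite !inE eqxx).
have b2 := cl (- s%:C) ltac:(by rewrite !inE eqxx ?orbT).
have b3 := cl ('i%C * s%:C) ltac:(by rewrite !inE eqxx ?orbT).
have b4 := cl (- ('i%C * s%:C)) ltac:(by rewrite !inE eqxx ?orbT).
have E : mod4_filter s (fun z => g z - f z) = mod4_filter s g - mod4_filter s f by rewrite /mod4_filter; ring.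
have H : cabs (mod4_filter s (fun z => g z - f z)) <= e.
  rewrite /mod4_filter; apply: le_trans (ler_cabsD _ _) _; rewrite cabsM cabs_i mul1r.
  apply: le_trans (lerD (ler_cabsB _ _) (lexx _)) _; rewrite cabsM cabs_i mul1r.
  apply: le_trans (lerD (lerD (ler_cabsB _ _) (lexx _)) (lexx _)) _.
  lra.
rewrite E in H; have := normr_Re (mod4_filter s g - mod4_filter s f); rewrite ReB ler_norml.
rewrite /half_space /= in hg; lra.
Qed.

(** The product [(1 + z) * (P - z) ^+ 2] produces the extremal coefficient: the
    exponent 2 comes with [1 - 2 * P]. *)
Lemma mod4_filter_mob (s : R) : 0 < s < 1 -> mod4_filter s (omega_form p (mob p)) =
  (4 * (p / (1 - p ^+ 2) ^+ 2) * s * (p + p / (1 + p ^+ 2) * (2 * p - 1)))%:C.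
Proof.
move=> s01; have /andP[s0 s1] := s01.
pose c0 := P / (1 - P ^+ 2) ^+ 2.
pose q := P / (1 + P ^+ 2).
have d1 := pC2_neq1 p0 p1; have d2 := pC2_neqN1 p0 p1; have d3 := pC_neq0 p0.
pose A := c0 * (P - q * P ^+ 2).
pose b := c0 * (- (1 + P ^+ 2) + q * (2 * P - P ^+ 2)).
pose u z := c0 * ((P + q * (2 * P - 1)) * z - q * z ^+ 2).
have gE z : cabs z < 1 -> z != 0 -> omega_form p (mob p) (mob p z) = A / z + b + u z.
  move=> z1 z0; rewrite /omega_form mobK //.
  have mz := mob_den p0 p1 z1.
  have k1 : 1 - mob p z / P = z * (1 - P ^+ 2) / (P * (1 - P * z)).
    by rewrite /mob; field; rewrite mz d3.
  have k2 : 1 - mob p z * P = (1 - P ^+ 2) / (1 - P * z) by rewrite /mob; field.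
  rewrite k1 k2 /mob /A /b /u /c0 /q; field.
  by rewrite ?d1 ?d2 ?d3 ?mz ?z0.
have gE' z : z \in [:: s%:C; - s%:C; 'i%C * s%:C; - ('i%C * s%:C)] ->
    omega_form p (mob p) (mob p z) = A / z + b + u z.
  move=> /(mod4_filter_points s01) cz; apply: gE; first by rewrite cz.
  by rewrite -cabs_gt0 cz.
rewrite /mod4_filter !gE' ?inE ?eqxx ?orbT // mod4_filter_affine //.
have i2 : 'i%C * 'i%C = -1 :> C by rewrite -expr2 sqr_i.
transitivity (c0 * ((P + q * (2 * P - 1)) * s%:C * (2 - 2 * ('i%C * 'i%C)))).
  by rewrite /u; ring.
rewrite i2 /c0 /q !(rmorphM, rmorphD, rmorphN, rmorph1, fmorphV, rmorphXn, rmorphB) /=.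
field.
by rewrite ?d1 ?d2.
Qed.

Lemma omega_form_class : omega_class p (omega_form p (mob p)).
Proof.
apply/omega_classE; exists (mob p); split=> // z z1.
  by eexists; exact: mob_has_der.
by apply: ltW; exact: mob_disc.
Qed.

End CoClass.

Theorem theorem3 (R : realType) (p : R)
  (hp : Num.sqrt 3 - 1 < p) (hp1 : p < 1) :
  closed_convex_hull_Co p `<` omega_class p.
Proof.
have p_half : 1 / 2 < p.
  have : 3 / 2 <= Num.sqrt 3 :> R.
    rewrite -(ger0_norm (_ : 0 <= 3 / 2)) ?divr_ge0 // -sqrtr_sqr ler_sqrt //.
    by rewrite expr_div_n; lra.
  lra.
have p0 : 0 < p by lra.
split.
  apply: smallest_sub.
    by split; [exact: omega_class_closed|exact: omega_class_convex].
  by move=> _ [f cf <-]; exact: Co_omega_class.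
move=> sub.
pose v := (2 * p - 1) / (1 + p ^+ 2).
have q0 : 0 < 1 + p ^+ 2 by rewrite ltr_pwDl ?sqr_ge0.
have v0 : 0 < v by rewrite divr_gt0 //; lra.
have v1 : v < 1 by rewrite ltr_pdivrMr // mul1r; have := sqr_ge0 p; lra.
(* Then [s ^+ 2 * (1 + v) >= (1 - v / 4) * (1 + v) > 1], as [0 < v < 1]. *)
pose s := 1 - v / 8.
have s01 : 0 < s < 1 by rewrite /s; lra.
pose c := 4 * (p ^+ 2 / (1 - p ^+ 2) ^+ 2) / s.
have : half_space p s c (omega_form p (mob p)).
  have := sub _ (omega_form_class p0 hp1); apply; split.
    by split; [exact: half_space_closed|exact: half_space_convex].
  move=> _ [f cf <-]; rewrite /half_space /=.
  exact: le_trans (ler_Re _) (Co_filter_le p0 hp1 cf s01).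
rewrite /half_space /mkset (mod4_filter_mob p0 hp1 s01) [Re _]/=; apply/negP; rewrite -ltNge.
have /andP[s0 s1] := s01.
have d0 : 0 < 1 - p ^+ 2 by rewrite subr_gt0 expr_lt1 // ltW.
rewrite /c ltr_pdivrMr //.
have -> : 4 * (p ^+ 2 / (1 - p ^+ 2) ^+ 2) = 4 * (p ^+ 2 / (1 - p ^+ 2) ^+ 2) * 1 by rewrite mulr1.
have -> : 4 * (p / (1 - p ^+ 2) ^+ 2) * s * (p + p / (1 + p ^+ 2) * (2 * p - 1)) * s =
  4 * (p ^+ 2 / (1 - p ^+ 2) ^+ 2) * (s ^+ 2 * (1 + v)).
  by rewrite /v; field; rewrite ?gt_eqF //; split; apply/eqP; rewrite gt_eqF.
rewrite ltr_pM2l; last by rewrite mulr_gt0 // divr_gt0 // exprn_gt0.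
have s2 : 1 - v / 4 <= s ^+ 2 by rewrite /s; have := sqr_ge0 v; lra.
have : (1 - v / 4) * (1 + v) <= s ^+ 2 * (1 + v) by rewrite ler_wpM2r //; lra.
have : v * v <= v * 1 by rewrite ler_wpM2l // ltW.
lra.
Qed.
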